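(* Let $B=B_R(x_0)\subset\mathbb{R}^2$ be a ball. There exists $c<\infty$ such that the following is true. Let $0<\nu\le\Lambda<\infty$ and suppose $a\in L^\infty(B;\mathbb{R}^{2\times2})$ is such that $a(x)$ is symmetric for almost every $x\in B$ and $$\nu|z|^2\le a(x)z\cdot z\le\Lambda|z|^2\quad\text{for every }z\in\mathbb{R}^2\text{ and almost every }x\in B.$$ Let $v\in W^{1,2}(B)$ be a subsolution, that is, $$\int_Ba\nabla v\cdot\nabla\varphi\,dx\le0\quad\text{for all }\varphi\in C^1_c(B)\text{ with }\varphi\ge0.$$ Then $$\sup_{\frac12B}v\le c\Bigl(\frac\Lambda\nu\Bigr)^{\frac14}\Bigl(\frac{1}{|B|}\int_B(v_+)^2\,dx\Bigr)^{\frac12}.$$ Moreover, the exponent $\frac14$ is optimal, in the sense that for no $\theta<\frac14$ does there exist a constant $c<\infty$, independent of $\nu,\Lambda,a,v$, such that the estimate $$\sup_{\frac12B}v\le c\Bigl(\frac\Lambda\nu\Bigr)^{\theta}\Bigl(\frac{1}{|B|}\int_B(v_+)^2\,dx\Bigr)^{\frac12}$$ holds for all such $\nu,\Lambda,a,v$.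
   Context: $v_+:=\max\{v,0\}$. $\frac12B=B_{R/2}(x_0)$ is the concentric ball with half the radius. The supremum of a Sobolev function is understood as the essential supremum. *)

(* Defs.v *)
From HB Require Import structures.
From mathcomp Require Import all_boot all_order all_algebra.
From mathcomp Require Import all_classical all_reals all_analysis.
From mathcomp Require Import ess_sup_inf.

Set Implicit Arguments.
Unset Strict Implicit.
Unset Printing Implicit Defensive.

Import Order.TTheory GRing.Theory Num.Theory.
Import numFieldNormedType.Exports.

Local Open Scope classical_set_scope.
Local Open Scope ring_scope.

Section Plane.
Context {R : realType}.

(* Points of the plane are pairs, so that the library's product topology and
   product measure apply; vectors (gradients) are columns, so that matrices act
   on them. *)
Definition leb2 :
    {measure set (measurableTypeR R * measurableTypeR R) -> \bar R} :=
  (@lebesgue_measure R \x @lebesgue_measure R)%E.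

(* The Euclidean ball: the library's [ball] on [R * R] is the one of the
   max-norm. *)
Definition disk (x0 : R * R) (r : R) : set (R * R) :=
  [set x | (x.1 - x0.1) ^+ 2 + (x.2 - x0.2) ^+ 2 < r ^+ 2].

Definition dot (y z : 'cV[R]_2) : R := \sum_i y i 0 * z i 0.

Definition basis (i : 'I_2) : R * R := ((i == 0)%:R, (i == 1)%:R).

Definition grad (phi : R * R -> R) (x : R * R) : 'cV[R]_2 :=
  \col_i 'D_(basis i) phi x.

(* Elements of C^1_c(B), B open, extended by zero to the plane. *)
Definition C1c (B : set (R * R)) (phi : R * R -> R) : Prop :=
  [/\ forall x, differentiable phi x,
      forall i, continuous (fun x => grad phi x i 0),
      compact (closure [set x | phi x != 0]) &
      closure [set x | phi x != 0] `<=` B].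

(* Functions on B are represented by functions on the plane, the values of
   which outside B are irrelevant; [f \_ B] is f extended by zero off B. *)
Definition Lp_on (B : set (R * R)) (p : \bar R) (f : R * R -> R) : Prop :=
  (f \_ B) \in Lfun leb2 p.

Definition L2_weak_gradient (B : set (R * R)) (v : R * R -> R)
    (g : R * R -> 'cV[R]_2) : Prop :=
  forall i, Lp_on B 2%:E (fun x => g x i 0) /\
    forall phi, C1c B phi ->
      \int[leb2]_(x in B) (v x * grad phi x i 0)
      = - \int[leb2]_(x in B) (g x i 0 * phi x).

Definition W12 (B : set (R * R)) (v : R * R -> R) : Prop :=
  Lp_on B 2%:E v /\ exists g, L2_weak_gradient B v g.

Definition bounded_elliptic (B : set (R * R)) (nu Lambda : R)
    (a : R * R -> 'M[R]_2) : Prop :=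
  [/\ forall i j, Lp_on B +oo%E (fun x => a x i j),
      {ae leb2, forall x, B x -> (a x)^T = a x} &
      {ae leb2, forall x, B x -> forall z : 'cV[R]_2,
         nu * dot z z <= dot (a x *m z) z <= Lambda * dot z z}].

(* The weak gradient is unique up to a null set, hence the choice of g is
   immaterial. *)
Definition subsolution (B : set (R * R)) (a : R * R -> 'M[R]_2)
    (v : R * R -> R) : Prop :=
  exists2 g, L2_weak_gradient B v g &
    forall phi, C1c B phi -> (forall x, 0 <= phi x) ->
      \int[leb2]_(x in B) dot (a x *m g x) (grad phi x) <= 0.

(* Off D the function is set to -oo, so that only its values on D count. *)
Definition ess_sup_on (D : set (R * R)) (f : R * R -> R) : \bar R :=
  ess_sup leb2 (patch (fun=> -oo%E) D (EFin \o f)).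

Definition average (B : set (R * R)) (f : R * R -> R) : R :=
  (fine (leb2 B))^-1 * \int[leb2]_(x in B) f x.

Definition sup_estimate (x0 : R * R) (r c theta : R) : Prop :=
  forall (nu Lambda : R) (a : R * R -> 'M[R]_2) (v : R * R -> R),
    0 < nu -> nu <= Lambda ->
    bounded_elliptic (disk x0 r) nu Lambda a ->
    W12 (disk x0 r) v ->
    subsolution (disk x0 r) a v ->
    (ess_sup_on (disk x0 (r / 2)) v <=
      (c * (Lambda / nu) `^ theta *
       Num.sqrt (average (disk x0 r) (fun x => Num.max (v x) 0 ^+ 2)))%:E)%E.

End Plane.

(* Main.v *)
Require Import Defs.
From HB Require Import structures.
From mathcomp Require Import all_boot all_order all_algebra.
From mathcomp Require Import all_classical all_reals all_analysis.
From mathcomp Require Import measurable_realfun ess_sup_inf ring lra.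

(** Write [lam = Lambda / nu].  The upper bound is De Giorgi's argument in the
    form that dimension two allows, without iteration.

    - Caccioppoli's inequality [caccioppoli] bounds the integral of
      [|grad v_+|^2] over a smaller square by [C lam int v_+^2].  Hence
      [int |grad (v_+^2)|], at most twice the product of the L^2 norms of [v_+]
      and [grad v_+], is bounded by [C sqrt(lam) int v_+^2]
      ([sqtheta_bound]): the gradient enters once, not squared, and so does
      only the square root of [lam].
    - In dimension one an integral of [|F| + |F'|] controls the supremum of
      [F].  By Fubini there are therefore two vertical and two horizontal lines
      between two concentric squares on which
      [v_+^2 <= C sqrt(lam) int v_+^2] ([good_lines]).
    - These lines enclose a rectangle.  By the maximum principle the bound on
      its boundary holds inside; the square root of [sqrt(lam)] is the factor
      [lam^(1/4)].

    A function of W^{1,2} has no values on lines, and a truncation of it is not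
    an admissible test function.  So the argument is run for a smooth function
    [u] close to [v], obtained by mollification ([C1_approximation]).  The
    gradient of [u] differs from the weak gradient [g] of [v], and [u] satisfies
    the weak inequality up to an error that Young's inequality bounds by
    [int |grad u - g|^2 / tau + tau int |grad phi|^2] ([energy]).  The maximum
    principle becomes the statement that a truncation of [u - k] has small
    integral over the rectangle ([inside_poincare]), and letting the errors tend
    to zero gives [v <= k] almost everywhere ([local_bound]).

    Mollifications converge in L^2 because the mean square oscillation of an L^2
    function at scale [e] tends to zero.  On the line this follows from
    Lebesgue's differentiation theorem, Fatou's lemma and the parallelogram
    identity ([osc_cvg0]); the plane is treated by slicing ([convol_cvg]).

    The exponent is optimal because of the saddles
    [r^2 + (x.2 - x0.2)^2 - L (x.1 - x0.1)^2], which solve the equation for the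
    matrix diag(1, L).  They are at least [r^2 / 2] near the centre, while their
    positive part is bounded and lives in a strip of width comparable to
    [L^(-1/2)]; so the mean of [v_+^2] decays like [L^(-1/2)] and its square root
    like [L^(-1/4)] ([exponent_optimal]). *)

Set Implicit Arguments.
Unset Strict Implicit.
Unset Printing Implicit Defensive.

Import Order.TTheory GRing.Theory Num.Theory.
Import numFieldNormedType.Exports.

Local Open Scope classical_set_scope.
Local Open Scope ring_scope.

(** * Borel sets and continuously differentiable functions of the plane *)

Section Topology.
Context {R : realType}.
Local Notation mR := (measurableTypeR R).

(** Every point of an open set lies in a square with rational centre and side [2
    / (m + 1)] that is contained in the set, and there are countably many such
    squares. *)
Lemma open_measurable2 (U : set (R * R)) :
  open U -> measurable (U : set (mR * mR)).
Proof.
move=> oU.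
pose sq (i : (rat * rat) * nat) : set (R * R) :=
  ball (ratr i.1.1 : R, ratr i.1.2 : R) (i.2.+1%:R^-1).
pose G i := if asbool (sq i `<=` U) then sq i else set0.
have -> : U = \bigcup_i G i.
  apply/seteqP; split=> [x Ux|x [i _]]; last first.
    by rewrite /G; case: ifPn => // /asboolP; apply.
  have /nbhs_ballP[e /= e0 xeU] : nbhs x U by exact: open_nbhs_nbhs.
  have [m me] : exists m : nat, m.+1%:R^-1 < e / 2.
    exists (Num.truncn (e / 2)^-1); rewrite -[ltRHS]invrK ltf_pV2 ?posrE ?invr_gt0 ?divr_gt0//.
    exact: truncnS_gt.
  have m0 : 0 < m.+1%:R^-1 :> R by rewrite invr_gt0.
  set e' := m.+1%:R^-1 in me m0.
  have rat_close (t : R) : exists q : rat, ball (ratr q : R) (e') t.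
    have /rat_in_itvoo[q] : t - e' < t + e' by lra.
    rewrite in_itv/= => /andP[q1 q2]; exists q.
    by rewrite /ball/= ltr_norml; apply/andP; split; lra.
  have [q1 hq1] := rat_close x.1; have [q2 hq2] := rat_close x.2.
  exists (q1, q2, m) => //; rewrite /G; case: ifPn => [_|/asboolP []]; first by split.
  move=> y [/= hy1 hy2]; apply: xeU.
  have tri (a b c : R) : ball a (e') b -> ball a (e') c -> ball b e c.
    move=> /ball_sym ab ac; apply: (@le_ball _ _ _ (e' + e')); first by lra.
    exact: ball_triangle ab ac.
  by split; [exact: (tri (ratr q1))|exact: (tri (ratr q2))].
apply: countable_bigcupT_measurable => [|i]; first exact: countableP.
rewrite /G; case: ifPn => // _.
rewrite (_ : sq i = (ball (ratr i.1.1 : R) (i.2.+1%:R^-1)) `*` (ball (ratr i.1.2 : R) (i.2.+1%:R^-1))) //.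
by apply: measurableX; apply: open_measurable; exact: ball_open.
Qed.

Lemma continuous_measurable2 (f : R * R -> R) :
  continuous f -> measurable_fun [set: mR * mR] (f : mR * mR -> mR).
Proof.
move=> /continuousP cf; apply: (measurability _ (RGenOpens.measurableE R)).
move=> _ [_ [a [b ->] <-]]; rewrite setTI; apply: open_measurable2.
exact/cf/interval_open.
Qed.

End Topology.

Section Quad.
Context {R : realType}.

(** A quadratic bound of the remainder is inherited by convolutions from their
    kernel, and holds for the piecewise polynomials used below; so
    differentiability is always proved in this form. *)
Lemma is_diff_quadratic (V : normedModType R) (f : V -> R) (L : {linear V -> R}) (x : V) (C : R) :
  continuous L -> (forall h, `|f (h + x) - f x - L h| <= C * `|h| ^+ 2) ->
  is_diff x f L.
Proof.
move=> cL hq.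
have fE : f \o shift x = cst (f x) + L +o_ 0 id.
  apply/eqaddoP => _/posnumP[e]; near=> h.
  rewrite [X in `|X|](_ : _ = f (h + x) - f x - L h); last first.
    by rewrite !fctE /= opprD addrA.
  apply: (le_trans (hq h)); rewrite expr2 mulrA ler_wpM2r//=.
  apply: (@le_trans _ _ ((`|C| + 1) * `|h|)).
    by apply: ler_wpM2r => //; apply: (le_trans (ler_norm _)); rewrite lerDl.
  rewrite mulrC -ler_pdivlMr; last by rewrite ltr_pwDr.
  near: h; apply: nbhs0_le; rewrite divr_gt0 //; by rewrite ltr_pwDr.
have dE := diff_unique cL fE.
split => //; apply/diff_locallyP; split; first by rewrite dE.
by rewrite dE.
Unshelve. all: by end_near. Qed.

Lemma is_derive_is_diff (f : R -> R) (t d : R) :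
  is_derive t 1 f d -> is_diff t f (fun h => h * d).
Proof.
move=> [df dE]; split; first exact/derivable1_diffP.
by rewrite deriv1E//; apply/funext => h /=; rewrite derive1E dE.
Qed.

Lemma is_diff_is_derive (f : R -> R) (t d : R) :
  is_diff t f (fun h => h * d) -> is_derive t 1 f d.
Proof.
move=> [df dE]; split; first exact/derivable1_diffP.
by rewrite deriveE // dE mul1r.
Qed.

End Quad.

Section C1.
Context {R : realType}.
Implicit Types (u v : R * R -> R).

(** The partial derivatives are named, so that they can be integrated and
    estimated as ordinary functions. *)
Definition C1 u (u1 u2 : R * R -> R) : Prop :=
  [/\ continuous u1, continuous u2 &
      forall x, is_diff x u (fun h => h.1 * u1 x + h.2 * u2 x)].

Lemma C1_continuous u u1 u2 : C1 u u1 u2 -> continuous u.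
Proof. by move=> [_ _ du] x; apply: differentiable_continuous; case: (du x). Qed.

Lemma C1_differentiable u u1 u2 x : C1 u u1 u2 -> differentiable u x.
Proof. by move=> [_ _ du]; case: (du x). Qed.

Lemma C1_grad0 u u1 u2 x : C1 u u1 u2 -> grad u x 0 0 = u1 x.
Proof.
move=> [_ _ du]; case: (du x) => du1 dE.
by rewrite mxE deriveE// dE /= mul1r mul0r addr0.
Qed.

Lemma C1_grad1 u u1 u2 x : C1 u u1 u2 -> grad u x 1 0 = u2 x.
Proof.
move=> [_ _ du]; case: (du x) => du1 dE.
by rewrite mxE deriveE// dE /= mul1r mul0r add0r.
Qed.

Lemma differentiable_C1 u : (forall x, differentiable u x) ->
  (forall i, continuous (fun x => grad u x i 0)) ->
  C1 u (fun x => grad u x 0 0) (fun x => grad u x 1 0).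
Proof.
move=> du cu; split=> // x; split => //.
apply/funext => -[h1 h2] /=; rewrite !mxE !deriveE// -[_ * _]linearZ -[X in _ = _ + X]linearZ -linearD.
by congr ('d _ _ _); congr pair; rewrite /= /GRing.scale /= !(mulr1, mulr0, addr0, add0r).
Qed.

Lemma C1_comp (f f' : R -> R) u u1 u2 : C1 u u1 u2 ->
  (forall t : R, is_derive t (1 : R) f (f' t)) -> continuous f' ->
  C1 (f \o u) (fun x => f' (u x) * u1 x) (fun x => f' (u x) * u2 x).
Proof.
move=> Cu df cf'; have cu := C1_continuous Cu; case: Cu => cu1 cu2 du.
have cfu : continuous (f' \o u) by move=> x; apply: continuous_comp; [exact: cu|exact: cf'].
split.
- by move=> x; apply: continuousM; [exact: cfu|exact: cu1].
- by move=> x; apply: continuousM; [exact: cfu|exact: cu2].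
- move=> x; have := is_derive_is_diff (df (u x)) => dfu; have := du x => dux.
  apply: is_diff_eq; apply/funext => h /=; ring.
Qed.

Lemma C1_mul u u1 u2 v v1 v2 : C1 u u1 u2 -> C1 v v1 v2 ->
  C1 (fun x => u x * v x) (fun x => u x * v1 x + v x * u1 x)
     (fun x => u x * v2 x + v x * u2 x).
Proof.
move=> Cu Cv; have cu := C1_continuous Cu; have cv := C1_continuous Cv.
case: Cu => cu1 cu2 du; case: Cv => cv1 cv2 dv.
split.
- by move=> x; apply: cvgD; apply: cvgM; [exact: cu|exact: cv1|exact: cv|exact: cu1].
- by move=> x; apply: cvgD; apply: cvgM; [exact: cu|exact: cv2|exact: cv|exact: cu2].
- move=> x; have := dv x => dvx; have := du x => dux.
  rewrite -[fun _ => u _ * v _]/(u * v).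
  apply: is_diff_eq; apply/funext => h /=.
  rewrite !fctE /= /GRing.scale /=; ring.
Qed.

Lemma C1_fst : C1 (fst : R * R -> R) (fun=> 1) (fun=> 0).
Proof.
split; [exact: cst_continuous|exact: cst_continuous|move=> x].
have cf : continuous (fst : R * R -> R) by move=> ?; exact: cvg_fst.
have := @is_diff_quadratic R (R * R)%type fst fst x 0 cf.
move=> /(_ _)/is_diff_eq; apply.
  by move=> h; rewrite mul0r /= addrK subrr normr0.
by apply/funext => h; rewrite mulr1 mulr0 addr0.
Qed.

Lemma C1_snd : C1 (snd : R * R -> R) (fun=> 0) (fun=> 1).
Proof.
split; [exact: cst_continuous|exact: cst_continuous|move=> x].
have cf : continuous (snd : R * R -> R) by move=> ?; exact: cvg_snd.
have := @is_diff_quadratic R (R * R)%type snd snd x 0 cf.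
move=> /(_ _)/is_diff_eq; apply.
  by move=> h; rewrite mul0r /= addrK subrr normr0.
by apply/funext => h; rewrite mulr1 mulr0 add0r.
Qed.

Lemma C1_derive1 u u1 u2 (x y : R) : C1 u u1 u2 ->
  is_derive x 1 (fun t => u (t, y)) (u1 (x, y)).
Proof.
move=> [_ _ du]; apply: is_diff_is_derive.
have dp : is_diff x (fun t : R => (t, y)) (fun h : R => (h, 0)).
  by apply: is_diff_eq.
have := du (x, y) => dxy.
rewrite -[fun t => _]/(u \o (fun t : R => (t, y))).
apply: is_diff_eq; apply/funext => h /=; ring.
Qed.

Lemma C1_derive2 u u1 u2 (x y : R) : C1 u u1 u2 ->
  is_derive y 1 (fun t => u (x, t)) (u2 (x, y)).
Proof.
move=> [_ _ du]; apply: is_diff_is_derive.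
have dp : is_diff y (fun t : R => (x, t)) (fun h : R => (0, h)).
  by apply: is_diff_eq.
have := du (x, y) => dxy.
rewrite -[fun t => _]/(u \o (fun t : R => (x, t))).
apply: is_diff_eq; apply/funext => h /=; ring.
Qed.

Lemma C1_quadratic u u1 u2 (C : R) : continuous u1 -> continuous u2 ->
  (forall x h, `|u (h + x) - u x - (h.1 * u1 x + h.2 * u2 x)| <= C * `|h| ^+ 2) ->
  C1 u u1 u2.
Proof.
move=> c1 c2 hq; split=> // x.
pose L (h : R * R) := h.1 * u1 x + h.2 * u2 x.
have lL : linear L.
  by move=> a [h1 h2] [k1 k2]; rewrite /L /= /GRing.scale /=; ring.
pose LL := GRing.isLinear.Build _ _ _ _ L lL.
pose Lin : {linear (R * R)%type -> R} := HB.pack L LL.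
apply: (@is_diff_quadratic R (R * R)%type u Lin x C) => //.
move=> h; rewrite /Lin /= /L; apply: cvgD; apply: cvgM; try exact: cvg_cst.
  exact: cvg_fst.
exact: cvg_snd.
Qed.

Lemma is_diff_near0 (V : normedModType R) (u : V -> R) (x : V) : (\forall y \near x, u y = 0) -> is_diff x u (fun=> 0).
Proof.
move=> u0; have ux0 : u x = 0 by exact: (nbhs_singleton u0).
have dE : u \o shift x = cst (u x) + (\0 : V -> R) +o_ 0 id.
  apply/eqaddoP => _/posnumP[e].
  move: u0; rewrite (near_shift 0) /= => u0.
  near=> h; rewrite !fctE /= ux0 !addr0 subr0.
  rewrite (_ : u (h + x) = 0) ?normr0 ?mulr_ge0//.
  near: h; apply: filterS u0 => h; by rewrite /= subr0.
have cz : continuous (\0 : V -> R) by exact: cst_continuous.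
have dE2 := diff_unique cz dE.
split=> //; apply/diff_locallyP; split; first by rewrite dE2.
by rewrite dE2.
Unshelve. all: by end_near. Qed.

Lemma C1_near0 u u1 u2 (x : R * R) : C1 u u1 u2 -> (\forall y \near x, u y = 0) ->
  u1 x = 0 /\ u2 x = 0.
Proof.
move=> [_ _ /(_ x)[_ dE]] /is_diff_near0[_]; rewrite dE funeqE => E.
by split; [have := E (1, 0)|have := E (0, 1)]; rewrite /= !(mul1r, mul0r, addr0, add0r).
Qed.

Lemma is_diff_near_eq u v (L : R * R -> R) (x : R * R) : (\forall y \near x, u y = v y) ->
  is_diff x u L -> is_diff x v L.
Proof.
move=> uv du; have : is_diff x (v - u) (fun=> 0).
  by apply: is_diff_near0; apply: filterS uv => y uvy; rewrite !fctE uvy subrr.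
move=> dvu; have vE : u + (v - u) = v by apply/funext => y; rewrite !fctE addrC subrK.
have := is_diffD du dvu; rewrite vE => /is_diff_eq; apply.
by apply/funext => h; rewrite !fctE addr0.
Qed.

(** Cutting a function off along the boundary of [A] keeps it smooth if it
    vanishes near every boundary point. The test function of the maximum
    principle is localized to a rectangle in this way. *)
Lemma C1_local u u1 u2 (A : set (R * R)) : C1 u u1 u2 ->
  (forall x : R * R, [\/ (\forall y \near x, A y), (\forall y \near x, u y = 0) |
                 (\forall y \near x, ~ A y)]) ->
  C1 (u \_ A) (u1 \_ A) (u2 \_ A).
Proof.
move=> Cu HA; case: (Cu) => cu1 cu2 du.
have inA (f : R * R -> R) y : A y -> (f \_ A) y = f y.
  by move=> Ay; rewrite /patch mem_set.
have outA (f : R * R -> R) y : ~ A y -> (f \_ A) y = 0.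
  by move=> Ay; rewrite /patch memNset.
have zA (f : R * R -> R) y : f y = 0 -> (f \_ A) y = 0.
  by move=> fy; rewrite /patch; case: ifP.
have u12 (x : R * R) : (\forall y \near x, u y = 0) -> \forall y \near x, u1 y = 0 /\ u2 y = 0.
  by move=> /near_join; apply: filterS => y; exact: C1_near0.
have ct (f : R * R -> R) : continuous f ->
    (forall x : R * R, (\forall y \near x, u y = 0) -> \forall y \near x, f y = 0) ->
    continuous (f \_ A).
  move=> cf f0 x; case: (HA x) => [nA|/f0 nz|nA].
  - apply: cvg_trans (near_eq_cvg _) _; last by rewrite inA; [exact: cf|exact: (nbhs_singleton nA)].
    by apply: filterS nA => y Ay; rewrite inA.
  - rewrite /continuous_at zA; last exact: (nbhs_singleton nz).
    apply: cvg_trans (near_eq_cvg _) (cvg_cst 0).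
    by apply: filterS nz => y fy; rewrite zA.
  - rewrite /continuous_at outA; last exact: (nbhs_singleton nA).
    apply: cvg_trans (near_eq_cvg _) (cvg_cst 0).
    by apply: filterS nA => y fy; rewrite outA.
split.
- by apply: ct => // x /u12; apply: filterS => y [].
- by apply: ct => // x /u12; apply: filterS => y [].
- move=> x; case: (HA x) => [nA|nz|nA].
  + rewrite !inA; try exact: (nbhs_singleton nA).
    by apply: is_diff_near_eq (du x); apply: filterS nA => y Ay; rewrite inA.
  + have [z1 z2] := nbhs_singleton (u12 _ nz).
    rewrite !zA//; apply: (is_diff_eq (is_diff_near0 _)); last first.
      by apply/funext => h; rewrite !mulr0 addr0.
    by apply: filterS nz => y uy; rewrite zA.
  + rewrite !outA; try exact: (nbhs_singleton nA).
    apply: (is_diff_eq (is_diff_near0 _)); last first.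
      by apply/funext => h; rewrite !mulr0 addr0.
    by apply: filterS nA => y uy; rewrite outA.
Qed.

End C1.

(** * Truncations and mollifiers on the line *)

Section Scalar.
Context {R : realType}.
Implicit Types (s t k e : R).

Definition pos t : R := Num.max t 0.
Definition sqpos t : R := pos t ^+ 2.

Lemma pos_ge0 t : 0 <= pos t.
Proof. by rewrite /pos le_max lexx orbT. Qed.

Lemma posP t : (t <= 0 /\ pos t = 0) \/ (0 <= t /\ pos t = t).
Proof.
rewrite /pos; case: (leP t 0) => t0; [left; split => //; exact: max_r|right; split; [exact: ltW|]].
by [].
Qed.

Lemma pos_lip s t : `|pos s - pos t| <= `|s - t|.
Proof.
by case: (posP s) => -[s0 ->]; case: (posP t) => -[t0 ->];
  case: (ler0P (s - t)) => st; first [lra | rewrite ler_norml; apply/andP; split; lra].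
Qed.

Lemma lipschitz_continuous (V : normedModType R) (f : V -> R) (C : R) :
  (forall x y, `|f x - f y| <= C * `|x - y|) -> continuous f.
Proof.
move=> fC x; apply/cvgrPdist_le => _/posnumP[e].
near=> y; apply: (le_trans (fC _ _)).
apply: (@le_trans _ _ ((`|C| + 1) * `|x - y|)).
  by apply: ler_wpM2r => //; apply: (le_trans (ler_norm _)); rewrite lerDl.
rewrite mulrC -ler_pdivlMr; last by rewrite ltr_pwDr.
near: y; apply: cvgr_dist_le; first exact: cvg_id.
by rewrite divr_gt0// ltr_pwDr.
Unshelve. all: by end_near. Qed.

Lemma pos_continuous : continuous pos.
Proof. by apply: (@lipschitz_continuous R pos 1) => s t; rewrite mul1r pos_lip. Qed.

Lemma is_derive_quadratic (f : R -> R) (d C t : R) :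
  (forall h, `|f (h + t) - f t - h * d| <= C * `|h| ^+ 2) -> is_derive t (1 : R) f d.
Proof.
move=> hq; apply: is_diff_is_derive.
have lL : linear (fun h : R => h * d).
  by move=> a h k; rewrite /GRing.scale /=; ring.
pose LL := GRing.isLinear.Build _ _ _ _ _ lL.
pose Lin : {linear R -> R} := HB.pack (fun h : R => h * d) LL.
apply: (@is_diff_quadratic R R f Lin t C) => // h.
by rewrite /Lin /=; apply: cvgM; [exact: cvg_id|exact: cvg_cst].
Qed.

Lemma sqpos_remainder t h : `|sqpos (h + t) - sqpos t - h * (2 * pos t)| <= h ^+ 2.
Proof.
rewrite /sqpos; case: (posP t) => -[t0 ->]; case: (posP (h + t)) => -[th0 ->];
  rewrite ler_norml; apply/andP; split; nra.
Qed.

Lemma sqpos_derive t : is_derive t (1 : R) sqpos (2 * pos t).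
Proof.
apply: (@is_derive_quadratic sqpos _ 1) => h.
by rewrite mul1r real_normK ?num_real// sqpos_remainder.
Qed.

Lemma cubpos_derive t : is_derive t (1 : R) (fun t => pos t ^+ 3) (3 * sqpos t).
Proof.
have -> : (fun t => pos t ^+ 3) = (id * sqpos).
  apply/funext => s; rewrite !fctE /sqpos; case: (posP s) => -[_ ->]; ring.
have d := sqpos_derive t.
apply: is_derive_eq; rewrite /sqpos /GRing.scale /=; case: (posP t) => -[_ ->]; ring.
Qed.

(** A continuously differentiable substitute for the positive part: zero for [t
    <= 0], quadratic between 0 and [k], and of slope one beyond [k]. Composed
    with a smooth function it gives admissible test functions. *)
Definition theta k t : R := (sqpos t - sqpos (t - k)) / (2 * k).
Definition dtheta k t : R := (pos t - pos (t - k)) / k.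

Lemma is_derive_shift_comp (f : R -> R) (f' a t : R) :
  is_derive (t - a) (1 : R) f f' -> is_derive t (1 : R) (fun s => f (s - a)) f'.
Proof.
move=> df; apply: is_diff_is_derive; have df' := is_derive_is_diff df.
have d1 : is_diff t (fun s : R => s - a) (fun h => h).
  apply: (is_diff_eq (is_diffB _ _)); apply/funext => h.
  by rewrite !fctE subr0.
rewrite -[fun s => _]/(f \o (fun s : R => s - a)).
by apply: is_diff_eq.
Qed.

Lemma theta_derive k t : 0 < k -> is_derive t (1 : R) (theta k) (dtheta k t).
Proof.
move=> k0; have d1 := sqpos_derive t.
have d2 := is_derive_shift_comp (sqpos_derive (t - k)).
rewrite /theta (_ : (fun t0 => _) = (2 * k)^-1 *: (sqpos - (fun s => sqpos (s - k)))); last first.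
  by apply/funext => s; rewrite !fctE /GRing.scale /= mulrC.
apply: is_derive_eq; rewrite /dtheta /GRing.scale /=; field; lra.
Qed.

Lemma dtheta_continuous k : continuous (dtheta k).
Proof.
move=> t; apply: cvgM; last exact: cvg_cst.
apply: cvgB; first exact: pos_continuous.
have c : continuous (pos \o (fun s => s - k)); last exact: c.
move=> s; apply: continuous_comp; last exact: pos_continuous.
by apply: cvgB; [exact: cvg_id|exact: cvg_cst].
Qed.

Lemma dtheta_bounds k t : 0 < k -> 0 <= dtheta k t <= 1.
Proof.
move=> k0; rewrite /dtheta; rewrite ler_pdivrMr// mul1r; apply/andP; split.
  apply: divr_ge0; last exact: ltW.
  by case: (posP t) => -[t0 ->]; case: (posP (t - k)) => -[t1 ->]; lra.
by case: (posP t) => -[t0 ->]; case: (posP (t - k)) => -[t1 ->]; lra.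
Qed.

Lemma theta_cases k t : 0 < k ->
  [\/ [/\ t <= 0, theta k t = 0 & dtheta k t = 0],
      [/\ 0 <= t <= k, theta k t = t ^+ 2 / (2 * k) & dtheta k t = t / k] |
      [/\ k <= t, theta k t = t - k / 2 & dtheta k t = 1]].
Proof.
move=> k0; rewrite /theta /dtheta /sqpos.
case: (posP t) => -[t0 ->]; case: (posP (t - k)) => -[t1 ->].
- by apply: Or31; split => //; rewrite ?subrr ?expr0n/= ?subrr mul0r.
- lra.
- by apply: Or32; split; rewrite ?expr0n/= ?subr0 ?t0//=; lra.
- apply: Or33; split; first lra.
    by field; lra.
  by field; lra.
Qed.

Lemma theta_ge0 k t : 0 < k -> 0 <= theta k t.
Proof.
move=> k0; case: (theta_cases t k0) => -[h -> _] //; last lra.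
by rewrite divr_ge0 ?sqr_ge0//; lra.
Qed.

Lemma theta_gt0 k t : 0 < k -> 0 < t -> 0 < theta k t.
Proof.
move=> k0 t0; case: (theta_cases t k0) => -[h -> _]; [lra| |lra].
by rewrite divr_gt0 ?exprn_gt0//; lra.
Qed.

(** The positive part satisfies this with equality; in Caccioppoli's inequality
    it allows the cross term to be absorbed. *)
Lemma theta_sq_le k t : 0 < k -> theta k t ^+ 2 <= dtheta k t * sqpos t.
Proof.
move=> k0; rewrite /sqpos; case: (theta_cases t k0) => -[h -> ->].
- by rewrite expr0n mul0r.
- have [_ ->] : 0 <= t /\ pos t = t by case: (posP t) => -[] // ?; lra.
  set w := t / k; have w0 : 0 <= w <= 1.
    by rewrite /w ler_pdivrMr// mul1r divr_ge0//; lra.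
  have -> : t ^+ 2 / (2 * k) = w * t / 2 by rewrite /w; field; lra.
  by nra.
- have [_ ->] : 0 <= t /\ pos t = t by case: (posP t) => -[] // ?; lra.
  nra.
Qed.

Lemma theta_le_pos k t : 0 < k -> theta k t <= pos t.
Proof.
move=> k0; have := theta_sq_le t k0; have := dtheta_bounds t k0; have := theta_ge0 t k0.
rewrite /sqpos => h1 /andP[h2 h3] h4.
rewrite -(@ler_sqr _ (theta k t) (pos t)) ?nnegrE ?pos_ge0//.
by apply: (le_trans h4); rewrite ler_piMl ?sqr_ge0.
Qed.

Lemma bounded_derive_lip (f f' : R -> R) (C : R) :
  (forall t, is_derive t (1 : R) f (f' t)) -> (forall t, `|f' t| <= C) ->
  forall s t, `|f s - f t| <= C * `|s - t|.
Proof.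
move=> df f'C s t.
wlog st : s t / s <= t => [H|].
  by case: (leP s t) => [/H//|/ltW/H]; rewrite distrC [`|t - s|]distrC.
rewrite distrC [`|s - t|]distrC.
have [|c _ ->] := @MVT_segment R f f' s t st (fun u _ => df u).
  by apply: derivable_within_continuous => u _; case: (df u).
by rewrite normrM ler_wpM2r.
Qed.

Lemma theta_lip k s t : 0 < k -> `|theta k s - theta k t| <= `|s - t|.
Proof.
move=> k0; rewrite -[leRHS]mul1r.
apply: (@bounded_derive_lip (theta k) (dtheta k) 1) => u; first exact: theta_derive.
by have /andP[b0 b1] := dtheta_bounds u k0; rewrite ger0_norm.
Qed.

Lemma theta_mono k s t : 0 < k -> s <= t -> theta k s <= theta k t.
Proof.
move=> k0 st.
have d u : is_derive u (1 : R) (theta k) (dtheta k u) by exact: theta_derive.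
rewrite -subr_ge0.
have [|c _ ->] := @MVT_segment R (theta k) (dtheta k) s t st (fun u _ => d u).
  by apply: derivable_within_continuous => u _; case: (d u).
have /andP[b0 b1] := dtheta_bounds c k0.
by rewrite mulr_ge0// subr_ge0.
Qed.

Lemma theta_at k : 0 < k -> theta k k = k / 2.
Proof. by move=> k0; case: (theta_cases k k0) => -[h -> _]; [lra|field; lra|lra]. Qed.

(** The quadratic B-spline with knots 0, 1, 2, 3: a compactly supported density
    of class C^{1,1} given by explicit polynomials. [dkappa] is its derivative,
    [ikappa] its primitive. *)
Definition kappa s : R := (sqpos s - 3 * sqpos (s - 1) + 3 * sqpos (s - 2) - sqpos (s - 3)) / 2.
Definition dkappa s : R := pos s - 3 * pos (s - 1) + 3 * pos (s - 2) - pos (s - 3).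
Definition ikappa s : R :=
  (pos s ^+ 3 - 3 * pos (s - 1) ^+ 3 + 3 * pos (s - 2) ^+ 3 - pos (s - 3) ^+ 3) / 6.

Lemma kappa_cases s :
  [\/ [/\ s <= 0, kappa s = 0 & ikappa s = 0],
   [/\ 0 <= s <= 1, kappa s = s ^+ 2 / 2 & dkappa s = s],
   [/\ 1 <= s <= 2, kappa s = (- 2 * s ^+ 2 + 6 * s - 3) / 2 & dkappa s = 3 - 2 * s] |
   ([/\ 2 <= s <= 3, kappa s = (3 - s) ^+ 2 / 2 & dkappa s = s - 3] \/
    [/\ 3 <= s, kappa s = 0 & ikappa s = 1])].
Proof.
rewrite /kappa /dkappa /ikappa /sqpos.
case: (posP s) => -[? ->]; case: (posP (s - 1)) => -[? ->];
 case: (posP (s - 2)) => -[? ->]; case: (posP (s - 3)) => -[? ->]; try lra.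
- by apply: Or41; split => //; field.
- by apply: Or42; split; [lra|field|ring].
- by apply: Or43; split; [lra|field|ring].
- by apply: Or44; left; split; [lra|field|ring].
- by apply: Or44; right; split; [lra|field|field].
Qed.

Lemma ikappa_out s : (s <= 0 -> ikappa s = 0) /\ (3 <= s -> ikappa s = 1).
Proof.
rewrite /ikappa; split=> h;
case: (posP s) => -[? ->]; case: (posP (s - 1)) => -[? ->];
 case: (posP (s - 2)) => -[? ->]; case: (posP (s - 3)) => -[? ->];
 first [by field|by (have -> : s = 0 by lra); field|by (have -> : s = 3 by lra); field|lra].
Qed.

Lemma kappa_bounds s : 0 <= kappa s <= 1.
Proof.
by case: (kappa_cases s) => [[? -> _]|[/andP[? ?] -> _]|[/andP[? ?] -> _]|[[/andP[? ?] -> _]|[? -> _]]];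
  apply/andP; split; nra.
Qed.

Lemma kappa_out s : s <= 0 \/ 3 <= s -> kappa s = 0.
Proof.
move=> h; rewrite /kappa /sqpos; case: h => h;
case: (posP s) => -[? ->]; case: (posP (s - 1)) => -[? ->];
 case: (posP (s - 2)) => -[? ->]; case: (posP (s - 3)) => -[? ->]; first [by field|by (have -> : s = 0 by lra); field|by (have -> : s = 3 by lra); field|lra].
Qed.

Lemma dkappa_out s : s <= 0 \/ 3 <= s -> dkappa s = 0.
Proof.
move=> h; rewrite /dkappa; case: h => h;
case: (posP s) => -[? ->]; case: (posP (s - 1)) => -[? ->];
 case: (posP (s - 2)) => -[? ->]; case: (posP (s - 3)) => -[? ->]; first [ring|lra].
Qed.

Lemma dkappa_bounds s : `|dkappa s| <= 1.
Proof.
rewrite /dkappa ler_norml.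
case: (posP s) => -[? ->]; case: (posP (s - 1)) => -[? ->];
 case: (posP (s - 2)) => -[? ->]; case: (posP (s - 3)) => -[? ->]; apply/andP; split; lra.
Qed.

Lemma dkappa_lip s t : `|dkappa s - dkappa t| <= 8 * `|s - t|.
Proof.
have h a : `|pos (s - a) - pos (t - a)| <= `|s - t|.
  by apply: (le_trans (pos_lip _ _)); rewrite (_ : s - a - (t - a) = s - t); last ring.
have := h 1; have := h 2; have := h 3; have := pos_lip s t.
rewrite /dkappa !ler_norml => /andP[? ?] /andP[? ?] /andP[? ?] /andP[? ?].
by apply/andP; split; lra.
Qed.

Lemma ikappa_derive s : is_derive s (1 : R) ikappa (kappa s).
Proof.
have d0 := cubpos_derive s.
have d1 := is_derive_shift_comp (cubpos_derive (s - 1)).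
have d2 := is_derive_shift_comp (cubpos_derive (s - 2)).
have d3 := is_derive_shift_comp (cubpos_derive (s - 3)).
have d := is_deriveZ 6^-1 (is_deriveB (is_deriveD (is_deriveB d0 (is_deriveZ 3 d1)) (is_deriveZ 3 d2)) d3).
have E : 6^-1 \*: ((fun t => pos t ^+ 3) - 3 \*: (fun s => pos (s - 1) ^+ 3)
    + 3 \*: (fun s => pos (s - 2) ^+ 3) - (fun s => pos (s - 3) ^+ 3)) = ikappa :> (R -> R).
  by apply/funext => u; rewrite !fctE /GRing.scale /= /ikappa mulrC.
by rewrite E in d; apply: (is_derive_eq d); rewrite /kappa /GRing.scale /=; field.
Qed.

Lemma kappa_remainder s h : `|kappa (h + s) - kappa s - h * dkappa s| <= 4 * h ^+ 2.
Proof.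
have q a : `|sqpos (h + s - a) - sqpos (s - a) - h * (2 * pos (s - a))| <= h ^+ 2.
  by have := sqpos_remainder (s - a) h; rewrite (addrA h).
have := sqpos_remainder s h; have := q 1; have := q 2; have := q 3.
rewrite /kappa /dkappa !ler_norml => /andP[? ?] /andP[? ?] /andP[? ?] /andP[? ?].
by apply/andP; split; lra.
Qed.

Lemma kappa_derive s : is_derive s (1 : R) kappa (dkappa s).
Proof.
apply: (@is_derive_quadratic _ _ 4) => h.
by rewrite real_normK ?num_real// kappa_remainder.
Qed.

Lemma is_derive_continuous (F f : R -> R) :
  (forall t, is_derive t (1 : R) F (f t)) -> continuous F.
Proof.
move=> dF t; apply: differentiable_continuous.
by apply/derivable1_diffP; case: (dF t).
Qed.

Lemma FTC2_everywhere (F f : R -> R) (a b : R) : a < b ->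
  (forall t, is_derive t (1 : R) F (f t)) -> continuous f ->
  (\int[@lebesgue_measure R]_(t in `[a, b]) (f t)%:E = (F b - F a)%:E)%E.
Proof.
move=> ab dF cf; have cF := is_derive_continuous dF.
rewrite (@continuous_FTC2 _ f F)//; first exact: continuous_subspaceT.
  split; first by move=> t _; case: (dF t).
    exact/cvg_at_right_filter/cF.
  exact/cvg_at_left_filter/cF.
by move=> t _; rewrite derive1E; case: (dF t).
Qed.

End Scalar.

Section Kernel.
Context {R : realType}.
Variable e : R.
Hypothesis e01 : 0 < e <= 1.

Definition mollifier (s : R) : R := kappa (s / e) / e.
Definition dmollifier (s : R) : R := dkappa (s / e) / e ^+ 2.
(** A common bound for the kernel, its derivative, their Lipschitz constants and
    the quadratic remainder. *)
Definition kbound : R := 8 / e ^+ 3.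
Local Notation M := kbound.

Let e0 : 0 < e. Proof. by case/andP: e01. Qed.
Let e1 : e <= 1. Proof. by case/andP: e01. Qed.
Let inve : 1 <= e^-1. Proof. by rewrite invf_ge1. Qed.

Let normie : `|e^-1| = e^-1. Proof. by rewrite ger0_norm// invr_ge0 ltW. Qed.

Let ME : M = 8 * e^-1 ^+ 3. Proof. by rewrite /M exprVn. Qed.

Lemma kbound_ge0 : 0 <= M. Proof. by rewrite divr_ge0// exprn_ge0// ltW. Qed.

Lemma mollifier_bounds s : 0 <= mollifier s <= M.
Proof.
rewrite /mollifier ME; have /andP[k0 k1] := kappa_bounds (s / e).
set w := kappa _ in k0 k1 *; have ii := inve; set i := e^-1 in ii *.
have i3 : i <= i ^+ 3 by rewrite -[leLHS]expr1 ler_weXn2l.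
by apply/andP; split; nra.
Qed.

Lemma mollifier_ge0 s : 0 <= mollifier s. Proof. by case/andP: (mollifier_bounds s). Qed.

Lemma dmollifier_bounds s : `|dmollifier s| <= M.
Proof.
rewrite /dmollifier ME normrM -exprVn; have k1 := dkappa_bounds (s / e).
have k0 := normr_ge0 (dkappa (s / e)).
set w := `|dkappa _| in k0 k1 *; have ii := inve; set i := e^-1 in ii *.
have i3 : i ^+ 2 <= i ^+ 3 by rewrite ler_weXn2l.
have i0 : 0 <= i ^+ 2 by rewrite sqr_ge0.
by rewrite ger0_norm//; nra.
Qed.

Lemma mollifier_lip s h : `|mollifier (h + s) - mollifier s| <= M * `|h|.
Proof.
rewrite /mollifier -mulrBl normrM ME.
have := @bounded_derive_lip R kappa dkappa 1 kappa_derive dkappa_bounds ((h + s) / e) (s / e).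
rewrite mul1r (_ : (h + s) / e - s / e = h / e); last by rewrite mulrDl addrK.
rewrite normrM normie => k1.
have h0 := normr_ge0 h; have ii := inve; set i := e^-1 in ii k1 *.
set w := `|kappa _ - _| in k1 *.
have i3 : i ^+ 2 <= i ^+ 3 by rewrite ler_weXn2l.
apply: (@le_trans _ _ (`|h| * i * i)); first by apply: ler_wpM2r => //; lra.
by nra.
Qed.

Lemma dmollifier_lip s h : `|dmollifier (h + s) - dmollifier s| <= M * `|h|.
Proof.
rewrite /dmollifier -mulrBl normrM ME.
have := dkappa_lip ((h + s) / e) (s / e).
rewrite (_ : (h + s) / e - s / e = h / e); last by rewrite mulrDl addrK.
rewrite normrM normie => k1.
have h0 := normr_ge0 h; rewrite -exprVn; have ii := inve; set i := e^-1 in ii k1 *.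
rewrite (ger0_norm (_ : 0 <= i ^+ 2)) ?sqr_ge0//.
set w := `|dkappa _ - _| in k1 *.
apply: (@le_trans _ _ (8 * (`|h| * i) * i ^+ 2)); first by apply: ler_wpM2r => //; exact: sqr_ge0.
by rewrite le_eqVlt; apply/orP; left; apply/eqP; ring.
Qed.

Lemma mollifier_remainder s h : `|mollifier (h + s) - mollifier s - h * dmollifier s| <= M * h ^+ 2.
Proof.
rewrite /mollifier /dmollifier ME.
have := kappa_remainder (s / e) (h / e); rewrite -mulrDl.
rewrite (_ : _ / e - _ / e - _ = (kappa ((h + s) / e) - kappa (s / e) - h / e * dkappa (s / e)) / e); last first.
  by field; rewrite gt_eqF.
rewrite normrM normie => k1.
rewrite (_ : 8 * _ * _ = 8 * (h / e) ^+ 2 / e); last by field; rewrite gt_eqF.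
apply: ler_wpM2r; first by rewrite invr_ge0 ltW.
by apply: (le_trans k1); rewrite ler_wpM2r ?sqr_ge0//; lra.
Qed.

Lemma mollifier_out s : s <= 0 \/ 3 * e <= s -> mollifier s = 0.
Proof.
move=> h; rewrite /mollifier kappa_out ?mul0r//; case: h => h; [left|right].
  by rewrite pmulr_lle0// invr_gt0.
by rewrite ler_pdivlMr.
Qed.

Lemma dmollifier_out s : s <= 0 \/ 3 * e <= s -> dmollifier s = 0.
Proof.
move=> h; rewrite /dmollifier dkappa_out ?mul0r//; case: h => h; [left|right].
  by rewrite pmulr_lle0// invr_gt0.
by rewrite ler_pdivlMr.
Qed.

Lemma mollifier_continuous : continuous mollifier.
Proof.
apply: (@lipschitz_continuous R R mollifier M) => s t.
by have := mollifier_lip t (s - t); rewrite subrK.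
Qed.

Definition rho (z : R * R) : R := mollifier z.1 * mollifier z.2.
Definition drho1 (z : R * R) : R := dmollifier z.1 * mollifier z.2.
Definition drho2 (z : R * R) : R := mollifier z.1 * dmollifier z.2.

Lemma norm_fst (h : R * R) : `|h.1| <= `|h|.
Proof. by rewrite prod_normE le_max lexx. Qed.

Lemma norm_snd (h : R * R) : `|h.2| <= `|h|.
Proof. by rewrite prod_normE le_max lexx orbT. Qed.

Lemma rho_ge0 z : 0 <= rho z. Proof. by rewrite mulr_ge0// mollifier_ge0. Qed.

Lemma rho_bound z : `|rho z| <= M ^+ 2.
Proof.
rewrite normrM expr2; have /andP[a0 a1] := mollifier_bounds z.1.
have /andP[b0 b1] := mollifier_bounds z.2.
by rewrite !ger0_norm// ler_pM.
Qed.

Lemma drho1_bound z : `|drho1 z| <= M ^+ 2.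
Proof.
rewrite normrM expr2; have a1 := dmollifier_bounds z.1.
have /andP[b0 b1] := mollifier_bounds z.2.
by rewrite (ger0_norm b0)// ler_pM.
Qed.

Lemma drho2_bound z : `|drho2 z| <= M ^+ 2.
Proof.
rewrite normrM expr2; have a1 := dmollifier_bounds z.2.
have /andP[b0 b1] := mollifier_bounds z.1.
by rewrite (ger0_norm b0)// ler_pM.
Qed.

Let lip_mul (f g : R -> R) (z h : R * R) :
  (forall s, `|f s| <= M) -> (forall s, `|g s| <= M) ->
  (forall s t, `|f (t + s) - f s| <= M * `|t|) ->
  (forall s t, `|g (t + s) - g s| <= M * `|t|) ->
  `|f (h + z).1 * g (h + z).2 - f z.1 * g z.2| <= 2 * M ^+ 2 * `|h|.
Proof.
move=> bf bg lf lg; have M0 := kbound_ge0.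
rewrite (_ : _ - _ = f (h.1 + z.1) * (g (h.2 + z.2) - g z.2) + (f (h.1 + z.1) - f z.1) * g z.2); last by rewrite /=; ring.
apply: (le_trans (ler_normD _ _)).
rewrite (_ : 2 * M ^+ 2 * `|h| = M * (M * `|h|) + (M * `|h|) * M); last ring.
by rewrite !normrM; apply: lerD; apply: ler_pM => //; [apply: (le_trans (lg _ _))|apply: (le_trans (lf _ _))];
  rewrite ler_wpM2l// ?norm_fst ?norm_snd.
Qed.

Lemma mollifier_norm s : `|mollifier s| <= M.
Proof. by have /andP[a0 a1] := mollifier_bounds s; rewrite ger0_norm. Qed.

Lemma drho1_lip z h : `|drho1 (h + z) - drho1 z| <= 2 * M ^+ 2 * `|h|.
Proof. by apply: (@lip_mul dmollifier mollifier); [exact: dmollifier_bounds|exact: mollifier_norm|exact: dmollifier_lip|exact: mollifier_lip]. Qed.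

Lemma drho2_lip z h : `|drho2 (h + z) - drho2 z| <= 2 * M ^+ 2 * `|h|.
Proof. by apply: (@lip_mul mollifier dmollifier); [exact: mollifier_norm|exact: dmollifier_bounds|exact: mollifier_lip|exact: dmollifier_lip]. Qed.

Lemma rho_remainder z h :
  `|rho (h + z) - rho z - (h.1 * drho1 z + h.2 * drho2 z)| <= 3 * M ^+ 2 * `|h| ^+ 2.
Proof.
have M0 := kbound_ge0; have h1 := norm_fst h; have h2 := norm_snd h.
rewrite (_ : _ - _ - _ =
  mollifier (h.1 + z.1) * (mollifier (h.2 + z.2) - mollifier z.2 - h.2 * dmollifier z.2)
  + (mollifier (h.1 + z.1) - mollifier z.1) * (h.2 * dmollifier z.2)
  + (mollifier (h.1 + z.1) - mollifier z.1 - h.1 * dmollifier z.1) * mollifier z.2); last first.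
  by rewrite /rho /drho1 /drho2 /=; ring.
apply: (le_trans (ler_normD _ _)).
rewrite (_ : 3 * M ^+ 2 * `|h| ^+ 2 =
  M * (M * `|h| ^+ 2) + (M * `|h|) * (`|h| * M) + (M * `|h| ^+ 2) * M); last ring.
have sq (t : R) : `|t| <= `|h| -> t ^+ 2 <= `|h| ^+ 2.
  by move=> th; rewrite -[t ^+ 2]real_normK ?num_real// ler_sqr ?nnegrE.
apply: lerD; last first.
  rewrite normrM; apply: ler_pM => //; last exact: mollifier_norm.
  by apply: (le_trans (mollifier_remainder _ _)); rewrite ler_wpM2l// sq.
apply: (le_trans (ler_normD _ _)); apply: lerD.
  rewrite normrM; apply: ler_pM => //; first exact: mollifier_norm.
  by apply: (le_trans (mollifier_remainder _ _)); rewrite ler_wpM2l// sq.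
rewrite normrM; apply: ler_pM => //.
  by apply: (le_trans (mollifier_lip _ _)); rewrite ler_wpM2l.
by rewrite normrM; apply: ler_pM => //; exact: dmollifier_bounds.
Qed.

Lemma drho1_continuous : continuous drho1.
Proof.
apply: (@lipschitz_continuous R (R * R)%type drho1 (2 * M ^+ 2)) => x y.
by have := drho1_lip y (x - y); rewrite subrK.
Qed.

Lemma drho2_continuous : continuous drho2.
Proof.
apply: (@lipschitz_continuous R (R * R)%type drho2 (2 * M ^+ 2)) => x y.
by have := drho2_lip y (x - y); rewrite subrK.
Qed.

Lemma rho_C1 : C1 rho drho1 drho2.
Proof.
apply: (@C1_quadratic R rho drho1 drho2 (3 * M ^+ 2)).
- exact: drho1_continuous.
- exact: drho2_continuous.
- exact: rho_remainder.
Qed.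

Lemma rho_out z : ~ (0 < z.1 < 3 * e /\ 0 < z.2 < 3 * e) -> [/\ rho z = 0, drho1 z = 0 & drho2 z = 0].
Proof.
move=> h; rewrite /rho /drho1 /drho2.
have alt (s : R) : (0 < s < 3 * e) \/ (mollifier s = 0 /\ dmollifier s = 0).
  have [s0|s0] := ltP 0 s; last by right; split; [apply: mollifier_out|apply: dmollifier_out]; left.
  have [s3|s3] := ltP s (3 * e); first by left.
  by right; split; [apply: mollifier_out|apply: dmollifier_out]; right.
case: (alt z.1) => [z1|[-> ->]]; last by rewrite !mul0r.
case: (alt z.2) => [z2|[-> ->]]; last by rewrite !mulr0.
by exfalso; apply: h.
Qed.

Local Notation mu := (@lebesgue_measure R).

Lemma mollifier_integral (x : R) : (\int[mu]_y (mollifier (x - y))%:E = 1)%E.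
Proof.
have dF y : is_derive y (1 : R) (fun y => - ikappa ((x - y) / e)) (mollifier (x - y)).
  apply: is_diff_is_derive.
  have /is_derive_is_diff d1 : is_derive y (1 : R) (fun y : R => (x - y) / e) (- e^-1).
    apply: (@is_derive_quadratic R _ _ 0) => h.
    by rewrite mul0r normr_le0; apply/eqP; ring.
  have /is_derive_is_diff d2 := ikappa_derive ((x - y) / e).
  rewrite -[fun y0 => _]/(- (ikappa \o (fun y : R => (x - y) / e))).
  apply: is_diff_eq; apply/funext => h; rewrite !fctE /= /mollifier; ring.
have cf : continuous (fun y => mollifier (x - y)).
  move=> y; apply: (@continuous_comp _ _ _ (fun y => x - y) mollifier); last exact: mollifier_continuous.
  by apply: cvgB; [exact: cvg_cst|exact: cvg_id].
have e30 : x - 3 * e < x by rewrite ltrBlDr ltrDl mulr_gt0.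
transitivity (\int[mu]_(y in `[(x - 3 * e)%R, x]) (mollifier (x - y))%:E)%E.
  rewrite [RHS]integral_mkcond; apply: eq_integral => y _.
  rewrite patchE; case: ifPn => // /negP; rewrite inE /= in_itv/= => h.
  rewrite mollifier_out//; have [yx|] := leP y x; last by left; lra.
  right; move/negP: h; rewrite negb_and yx orbF -ltNge; lra.
rewrite (FTC2_everywhere e30 dF cf).
rewrite subrr mul0r (_ : (x - (x - 3 * e)) / e = 3); last by field; rewrite gt_eqF.
by rewrite (ikappa_out 0).1// (ikappa_out 3).2// oppr0 sub0r opprK.
Qed.

End Kernel.

(** * Mollification *)

Section Integr.
Context {R : realType}.
Local Notation mR := (measurableTypeR R).
Local Notation P := (mR * mR)%type.

Lemma integrable_mul_bounded d (T : measurableType d) (mu : {measure set T -> \bar R})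
  (D : set T) (f K : T -> R) (M : R) : measurable D ->
  mu.-integrable D (EFin \o f) -> measurable_fun D K -> (forall y, D y -> `|K y| <= M) ->
  mu.-integrable D (EFin \o (fun y => f y * K y)).
Proof.
move=> mD fi mK KM.
have mf : measurable_fun D f by apply/measurable_EFinP; exact: measurable_int fi.
apply: (@le_integrable _ _ _ mu D mD _ (fun y => (`|M| * `|f y|)%:E)).
- by apply/measurable_EFinP; exact: measurable_funM.
- move=> y Dy /=; rewrite lee_fin normrM mulrC [leRHS]ger0_norm ?mulr_ge0// ler_wpM2r//.
  by apply: (le_trans (KM _ Dy)); exact: ler_norm.
- by have := integrableZl mD `|M| (integrable_norm fi); apply: eq_integrable.
Qed.

Lemma continuous_shift2 (K : R * R -> R) (x : R * R) : continuous K ->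
  measurable_fun [set: P] (fun y : P => K (x - y) : mR).
Proof.
move=> cK; have c : continuous (K \o (fun y : R * R => x - y)).
  move=> y; apply: continuous_comp; last exact: cK.
  by apply: cvgB; [exact: cvg_cst|exact: cvg_id].
exact: continuous_measurable2 c.
Qed.

Definition convol (K f : R * R -> R) (x : R * R) : R := \int[leb2]_y (f y * K (x - y)).

Lemma convol_integrable K (f : R * R -> R) M x : continuous K -> (forall z, `|K z| <= M) ->
  leb2.-integrable [set: P] (EFin \o f) ->
  leb2.-integrable [set: P] (EFin \o (fun y : P => f y * K (x - y))).
Proof.
move=> cK KM fi; apply: (@integrable_mul_bounded _ _ _ _ _ _ M) => //.
exact: continuous_shift2.
Qed.

Lemma convol_lip K (f : R * R -> R) M L : continuous K -> (forall z, `|K z| <= M) ->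
  (forall z h, `|K (h + z) - K z| <= L * `|h|) ->
  leb2.-integrable [set: P] (EFin \o f) ->
  forall x y, `|convol K f x - convol K f y| <= (\int[leb2]_z `|f z|) * L * `|x - y|.
Proof.
move=> cK KM KL fi x y.
have ix := convol_integrable x cK KM fi; have iy := convol_integrable y cK KM fi.
rewrite /convol -RintegralB//.
have id : leb2.-integrable [set: P] (EFin \o (fun z : P => f z * K (x - z) - f z * K (y - z))).
  by have := integrableB measurableT ix iy; apply: eq_integrable.
apply: (le_trans (le_normr_Rintegral measurableT id)).
rewrite -mulrA -RintegralZr//; last exact: integrable_norm.
apply: le_Rintegral => //.
- exact: integrable_norm.
- have := integrableZr measurableT (L * `|x - y|) (integrable_norm fi).
  by apply: eq_integrable.
- move=> z _; rewrite -mulrBr normrM ler_wpM2l//.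
  by have := KL (y - z) (x - y); rewrite addrA subrK.
Qed.

(** The quadratic remainder of the kernel, integrated against [f], is a
    quadratic remainder for the convolution. *)
Lemma convol_C1 e (f : R * R -> R) : 0 < e <= 1 -> leb2.-integrable [set: P] (EFin \o f) ->
  C1 (convol (rho e) f) (convol (drho1 e) f) (convol (drho2 e) f).
Proof.
move=> e01 fi.
have c0 := C1_continuous (rho_C1 e01).
have c1 := drho1_continuous e01; have c2 := drho2_continuous e01.
have b0 := rho_bound e01; have b1 := drho1_bound e01; have b2 := drho2_bound e01.
apply: (@C1_quadratic R _ _ _ ((\int[leb2]_z `|f z|) * (3 * kbound e ^+ 2))).
- apply: (lipschitz_continuous (convol_lip c1 b1 (drho1_lip e01) fi)).
- apply: (lipschitz_continuous (convol_lip c2 b2 (drho2_lip e01) fi)).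
move=> x h.
have i0 := convol_integrable x c0 b0 fi; have ih := convol_integrable (h + x) c0 b0 fi.
have i1 := convol_integrable x c1 b1 fi; have i2 := convol_integrable x c2 b2 fi.
have j1 : leb2.-integrable [set: P] (EFin \o (fun z : P => h.1 * (f z * drho1 e (x - z)))).
  by have := integrableZl measurableT h.1 i1; apply: eq_integrable.
have j2 : leb2.-integrable [set: P] (EFin \o (fun z : P => h.2 * (f z * drho2 e (x - z)))).
  by have := integrableZl measurableT h.2 i2; apply: eq_integrable.
have jd : leb2.-integrable [set: P] (EFin \o (fun z : P => f z * rho e (h + x - z) - f z * rho e (x - z))).
  by have := integrableB measurableT ih i0; apply: eq_integrable.
have js : leb2.-integrable [set: P] (EFin \o (fun z : P => h.1 * (f z * drho1 e (x - z)) + h.2 * (f z * drho2 e (x - z)))).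
  by have := integrableD measurableT j1 j2; apply: eq_integrable.
rewrite /convol -!RintegralZl// -RintegralD// -RintegralB// -RintegralB//.
have id : leb2.-integrable [set: P] (EFin \o (fun z : P => f z * rho e (h + x - z) - f z * rho e (x - z) - (h.1 * (f z * drho1 e (x - z)) + h.2 * (f z * drho2 e (x - z))))).
  by have := integrableB measurableT jd js; apply: eq_integrable.
apply: (le_trans (le_normr_Rintegral measurableT id)).
rewrite -mulrA -RintegralZr//; last exact: integrable_norm.
apply: le_Rintegral => //.
- exact: integrable_norm.
- have := integrableZr measurableT (3 * kbound e ^+ 2 * `|h| ^+ 2) (integrable_norm fi).
  by apply: eq_integrable.
- move=> z _.
  have -> : f z * rho e (h + x - z) - f z * rho e (x - z) - (h.1 * (f z * drho1 e (x - z)) + h.2 * (f z * drho2 e (x - z)))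
    = f z * (rho e (h + (x - z)) - rho e (x - z) - (h.1 * drho1 e (x - z) + h.2 * drho2 e (x - z))).
    by rewrite addrA; ring.
  by rewrite normrM ler_wpM2l// rho_remainder.
Qed.

End Integr.

(** * Mean square oscillation and convergence in L^2 *)

Section OneDim.
Context {R : realType}.
Local Notation mR := (measurableTypeR R).
Local Notation mu := (@lebesgue_measure R).
Local Open Scope ereal_scope.

Lemma fin_num_of_lty d (T : measurableType d) (m : {measure set T -> \bar R}) (D : set T) (f : T -> \bar R) :
  (forall x, D x -> 0 <= f x) -> \int[m]_(x in D) f x < +oo -> \int[m]_(x in D) f x \is a fin_num.
Proof. by move=> f0 fi; rewrite ge0_fin_numE// integral_ge0. Qed.

Lemma ge0_integral_lin2 d (T : measurableType d) (m : {measure set T -> \bar R}) (D : set T)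
  (a b : R) (f g : T -> R) : measurable D -> measurable_fun D f -> measurable_fun D g ->
  (forall x, D x -> 0 <= f x)%R -> (forall x, D x -> 0 <= g x)%R -> (0 <= a)%R -> (0 <= b)%R ->
  \int[m]_(x in D) (a * f x + b * g x)%:E =
  a%:E * \int[m]_(x in D) (f x)%:E + b%:E * \int[m]_(x in D) (g x)%:E.
Proof.
move=> mD mf mg f0 g0 a0 b0.
under eq_integral do rewrite EFinD.
rewrite ge0_integralD//.
- by congr (_ + _); under eq_integral do rewrite EFinM; rewrite ge0_integralZl_EFin//; exact/measurable_EFinP.
- by move=> x Dx; rewrite lee_fin mulr_ge0// f0.
- by apply/measurable_EFinP; apply: measurable_funM.
- by move=> x Dx; rewrite lee_fin mulr_ge0// g0.
- by apply/measurable_EFinP; apply: measurable_funM.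
Qed.

(** [|f| <= 1 + f^2], and a probability density is integrable. *)
Lemma integrable_weight d (T : measurableType d) (m : {measure set T -> \bar R}) (f k : T -> R) :
  measurable_fun setT f -> measurable_fun setT k -> (forall y, 0 <= k y)%R ->
  \int[m]_y (k y)%:E = 1 -> \int[m]_y (f y ^+ 2 * k y)%:E < +oo ->
  [/\ m.-integrable setT (EFin \o k), m.-integrable setT (EFin \o (fun y => f y ^+ 2 * k y)%R) &
     m.-integrable setT (EFin \o (fun y => f y * k y)%R)].
Proof.
move=> mf mk k0 k1 fi.
have f2k0 y : (0 <= f y ^+ 2 * k y)%R by rewrite mulr_ge0 ?sqr_ge0.
have ik : m.-integrable setT (EFin \o k).
  apply/integrableP; split; first exact/measurable_EFinP.
  rewrite (_ : \int[m]_x _ = 1) ?ltry// -k1; apply: eq_integral => y _.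
  by rewrite /= ger0_norm.
have mf2k : measurable_fun setT (fun y => f y ^+ 2 * k y)%R.
  by apply: measurable_funM => //; exact: measurable_funX.
have if2k : m.-integrable setT (EFin \o (fun y => f y ^+ 2 * k y)%R).
  apply/integrableP; split; first exact/measurable_EFinP.
  by under eq_integral do rewrite /= ger0_norm//.
have ifk : m.-integrable setT (EFin \o (fun y => f y * k y)%R).
  apply: (le_integrable measurableT _ _ (integrableD measurableT ik if2k)).
    by apply/measurable_EFinP; exact: measurable_funM.
  move=> y _ /=; rewrite lee_fin normrM (ger0_norm (k0 y)) [leRHS]ger0_norm ?addr_ge0//.
  have := k0 y; have := normr_ge0 (f y); rewrite -[(f y ^+ 2)%R]real_normK ?num_real//.
  set a := `|f y|%R; set b := k y => a0 b0.
  rewrite -[X in (_ <= X + _)%R]mul1r -mulrDl; apply: ler_wpM2r => //; nra.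
by split.
Qed.

(** With [c] the mean of [f], integrate [2 c f - c^2 <= f^2] against the density
    [k]. *)
Lemma jensen_sq d (T : measurableType d) (m : {measure set T -> \bar R}) (f k : T -> R) :
  measurable_fun setT f -> measurable_fun setT k -> (forall y, 0 <= k y)%R ->
  \int[m]_y (k y)%:E = 1 ->
  ((\int[m]_y (f y * k y))%R ^+ 2)%:E <= \int[m]_y (f y ^+ 2 * k y)%:E.
Proof.
move=> mf mk k0 k1.
have f2k0 y : (0 <= f y ^+ 2 * k y)%R by rewrite mulr_ge0 ?sqr_ge0.
have [fi|] := ltP (\int[m]_y (f y ^+ 2 * k y)%:E) +oo; last by rewrite leye_eq => /eqP ->; rewrite leey.
have [ik if2k ifk] := integrable_weight mf mk k0 k1 fi.
set c := (\int[m]_y (f y * k y))%R.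
have j1 : m.-integrable setT (EFin \o (fun y => 2 * c * (f y * k y))%R).
  by have := integrableZl measurableT (2 * c)%R ifk; apply: eq_integrable.
have j2 : m.-integrable setT (EFin \o (fun y => c ^+ 2 * k y)%R).
  by have := integrableZl measurableT (c ^+ 2)%R ik; apply: eq_integrable.
have -> : (c ^+ 2 = \int[m]_y (2 * c * (f y * k y) - c ^+ 2 * k y))%R.
  rewrite RintegralB// !RintegralZl// -/c.
  rewrite (_ : \int[m]_y k y = 1)%R; last by rewrite /Rintegral k1.
  ring.
rewrite -[leRHS](@fineK _) ?fin_num_of_lty//; last by move=> y _; rewrite lee_fin.
rewrite lee_fin; apply: le_Rintegral => //.
  by have := integrableB measurableT j1 j2; apply: eq_integrable.
move=> y _; have k0y := k0 y; rewrite -subr_ge0.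
rewrite (_ : _ - _ = (f y - c) ^+ 2 * k y)%R; last by ring.
by rewrite mulr_ge0// sqr_ge0.
Qed.

Lemma mollifier_integral_x e (y : R) : (0 < e <= 1)%R -> \int[mu]_x (mollifier e (x - y))%:E = 1.
Proof.
move=> e01; have e0 : (0 < e)%R by case/andP: e01.
have dF x : is_derive x (1%R : R) (fun x => ikappa ((x - y) / e))%R (mollifier e (x - y)).
  apply: is_diff_is_derive.
  have /is_derive_is_diff d1 : is_derive x (1%R : R) (fun x : R => (x - y) / e)%R (e^-1)%R.
    apply: (@is_derive_quadratic R _ _ 0) => h.
    by rewrite mul0r normr_le0; apply/eqP; ring.
  have /is_derive_is_diff d2 := ikappa_derive ((x - y) / e)%R.
  rewrite -[fun x0 => _]/(ikappa \o (fun x : R => (x - y) / e)%R).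
  apply: is_diff_eq; apply/funext => h; rewrite !fctE /= /mollifier; ring.
have cf : continuous (fun x => mollifier e (x - y)%R).
  move=> x; apply: (@continuous_comp _ _ _ (fun x => (x - y)%R) (mollifier e)); last exact: mollifier_continuous.
  by apply: cvgB; [exact: cvg_id|exact: cvg_cst].
have e30 : (y < y + 3 * e)%R by rewrite ltrDl mulr_gt0.
transitivity (\int[mu]_(x in `[y, (y + 3 * e)%R]) (mollifier e (x - y))%:E).
  rewrite [RHS]integral_mkcond; apply: eq_integral => x _.
  rewrite patchE; case: ifPn => // /negP; rewrite inE /= in_itv/= => h.
  rewrite mollifier_out//; have [yx|] := leP y x; last by left; lra.
  right; move/negP: h; rewrite negb_and yx /= -ltNge; lra.
rewrite (FTC2_everywhere e30 dF cf).
rewrite subrr mul0r (_ : (y + 3 * e - y) / e = 3)%R; last by field; rewrite gt_eqF.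
by rewrite (ikappa_out 0).1// (ikappa_out 3).2// subr0.
Qed.

(** The mean square oscillation of [h] at scale [e]. By Jensen's inequality it
    bounds the squared L^2 distance between [h] and its mollification; unlike
    this distance it behaves well under slicing. *)
Definition osc e (h : R -> R) : \bar R :=
  \int[mu]_x \int[mu]_y ((h y - h x) ^+ 2 * mollifier e (x - y))%:E.

Lemma measurable_mollifier e : (0 < e <= 1)%R -> measurable_fun [set: mR] (mollifier e : mR -> mR).
Proof. by move=> e01; apply: continuous_measurable_fun; exact: mollifier_continuous. Qed.

Lemma measurable_mollifier2 e : (0 < e <= 1)%R ->
  measurable_fun [set: mR * mR] (fun z => mollifier e (z.1 - z.2)%R).
Proof.
move=> e01; apply: (measurableT_comp (measurable_mollifier e01)).
by apply: measurable_funB; [exact: measurable_fst|exact: measurable_snd].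
Qed.

Lemma int_ker_l e (f : R -> R) : (0 < e <= 1)%R -> measurable_fun [set: mR] f ->
  (forall x, 0 <= f x)%R ->
  \int[mu]_x \int[mu]_y (f x * mollifier e (x - y))%:E = \int[mu]_x (f x)%:E.
Proof.
move=> e01 mf f0; apply: eq_integral => x _.
under eq_integral do rewrite EFinM.
rewrite ge0_integralZl_EFin//; first by rewrite mollifier_integral// mule1.
  by move=> y _; rewrite lee_fin mollifier_ge0.
apply/measurable_EFinP; apply: (measurableT_comp (measurable_mollifier e01)).
by apply: measurable_funB.
Qed.

Lemma int_ker_r e (f : R -> R) : (0 < e <= 1)%R -> measurable_fun [set: mR] f ->
  (forall x, 0 <= f x)%R ->
  \int[mu]_x \int[mu]_y (f y * mollifier e (x - y))%:E = \int[mu]_y (f y)%:E.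
Proof.
move=> e01 mf f0.
rewrite (fubini_tonelli (fun z : mR * mR => (f z.2 * mollifier e (z.1 - z.2))%:E)); last 2 first.
- apply/measurable_EFinP; apply: measurable_funM; last exact: measurable_mollifier2.
  exact: (measurableT_comp mf).
- by move=> z; rewrite lee_fin mulr_ge0 ?mollifier_ge0.
apply: eq_integral => y _ /=.
under eq_integral do rewrite EFinM.
rewrite ge0_integralZl_EFin//; first by rewrite mollifier_integral_x// mule1.
  by move=> x _; rewrite lee_fin mollifier_ge0.
apply/measurable_EFinP; apply: (measurableT_comp (measurable_mollifier e01)).
by apply: measurable_funB.
Qed.

(** The identity [(p - q)^2 + (p + q)^2 = 2 p^2 + 2 q^2] under the integral; the
    kernel has mass one in each of the two variables. *)
Lemma osc_split e (h : R -> R) : (0 < e <= 1)%R -> measurable_fun [set: mR] h ->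
  osc e h + \int[mu]_x \int[mu]_y ((h y + h x) ^+ 2 * mollifier e (x - y))%:E =
  4%:E * \int[mu]_x (h x ^+ 2)%:E.
Proof.
move=> e01 mh.
have mh2 : measurable_fun [set: mR] (fun x => h x ^+ 2)%R by exact: measurable_funX.
have mha : measurable_fun [set: mR * mR] (fun z => h z.1) by exact: (measurableT_comp mh).
have mhb : measurable_fun [set: mR * mR] (fun z => h z.2) by exact: (measurableT_comp mh).
have mk := measurable_mollifier2 e01.
pose F (s : bool) (z : mR * mR) := (((if s then h z.2 - h z.1 else h z.2 + h z.1) ^+ 2 * mollifier e (z.1 - z.2))%R)%:E.
have mF s : measurable_fun setT (F s).
  apply/measurable_EFinP; apply: measurable_funM => //; apply: measurable_funX.
  by case: s; [exact: measurable_funB|exact: measurable_funD].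
have F0 s z : 0 <= F s z by rewrite lee_fin mulr_ge0 ?sqr_ge0 ?mollifier_ge0.
rewrite /osc -[X in X + _](fubini_tonelli1 (F true))// -[X in _ + X](fubini_tonelli1 (F false))//.
rewrite -ge0_integralD//.
transitivity (\int[mu \x mu]_z ((2 * (h z.1 ^+ 2 * mollifier e (z.1 - z.2)) + 2 * (h z.2 ^+ 2 * mollifier e (z.1 - z.2)))%R)%:E).
  by apply: eq_integral => z _; rewrite /F -EFinD; congr EFin; ring.
have m1 : measurable_fun [set: mR * mR] (fun z => h z.1 ^+ 2 * mollifier e (z.1 - z.2))%R.
  by apply: measurable_funM => //; exact: measurable_funX.
have m2 : measurable_fun [set: mR * mR] (fun z => h z.2 ^+ 2 * mollifier e (z.1 - z.2))%R.
  by apply: measurable_funM => //; exact: measurable_funX.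
have g1 (z : mR * mR) : (0 <= h z.1 ^+ 2 * mollifier e (z.1 - z.2))%R by rewrite mulr_ge0 ?sqr_ge0 ?mollifier_ge0.
have g2 (z : mR * mR) : (0 <= h z.2 ^+ 2 * mollifier e (z.1 - z.2))%R by rewrite mulr_ge0 ?sqr_ge0 ?mollifier_ge0.
rewrite ge0_integral_lin2//.
have -> : \int[mu \x mu]_z (h z.1 ^+ 2 * mollifier e (z.1 - z.2))%:E = \int[mu]_x (h x ^+ 2)%:E.
  rewrite (fubini_tonelli1 (fun z : mR * mR => (h z.1 ^+ 2 * mollifier e (z.1 - z.2))%:E)); last 2 first.
  - exact/measurable_EFinP.
  - by move=> z; rewrite lee_fin.
  by rewrite /fubini_F /= (int_ker_l e01 mh2)// => x; exact: sqr_ge0.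
have -> : \int[mu \x mu]_z (h z.2 ^+ 2 * mollifier e (z.1 - z.2))%:E = \int[mu]_x (h x ^+ 2)%:E.
  rewrite (fubini_tonelli1 (fun z : mR * mR => (h z.2 ^+ 2 * mollifier e (z.1 - z.2))%:E)); last 2 first.
  - exact/measurable_EFinP.
  - by move=> z; rewrite lee_fin.
  by rewrite /fubini_F /= (int_ker_r e01 mh2)// => x; exact: sqr_ge0.
by rewrite -ge0_muleDl ?lee_fin// -EFinD; congr (_%:E * _); ring.
Qed.

Definition conv1 e (h : R -> R) (x : R) : R := (\int[mu]_y (h y * mollifier e (x - y)))%R.

Lemma measurable_Rintegral_param d1 d2 (T1 : measurableType d1) (T2 : measurableType d2)
  (m2 : {sigma_finite_measure set T2 -> \bar R}) (F : T1 * T2 -> R) :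
  measurable_fun setT F -> measurable_fun setT (fun x => \int[m2]_y F (x, y))%R.
Proof.
move=> mF; rewrite /Rintegral; apply: (measurableT_comp (@fine_measurable _ _ measurableT)).
under eq_fun do rewrite integralE.
have mF' : measurable_fun setT (EFin \o F) by exact/measurable_EFinP.
apply: emeasurable_funB.
  rewrite [X in measurable_fun _ X](_ : _ = fubini_F m2 ((EFin \o F)^\+)); last first.
    by apply/funext => x; rewrite /fubini_F; apply: eq_integral => y _; rewrite ?funeposE ?funenegE.
  apply: measurable_fun_fubini_tonelli_F => //.
  exact: measurable_funepos.
rewrite [X in measurable_fun _ X](_ : _ = fubini_F m2 ((EFin \o F)^\-)); last first.
  by apply/funext => x; rewrite /fubini_F; apply: eq_integral => y _; rewrite ?funeposE ?funenegE.
apply: measurable_fun_fubini_tonelli_F => //.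
exact: measurable_funeneg.
Qed.

Lemma measurable_mollifierx e x : (0 < e <= 1)%R -> measurable_fun [set: mR] (fun y => mollifier e (x - y)%R).
Proof.
move=> e01; apply: (measurableT_comp (measurable_mollifier e01)); exact: measurable_funB.
Qed.

Lemma measurable_conv1 e (h : R -> R) : (0 < e <= 1)%R -> measurable_fun [set: mR] h ->
  measurable_fun [set: mR] (conv1 e h).
Proof.
move=> e01 mh; apply: (@measurable_Rintegral_param _ _ mR mR mu (fun z => h z.2 * mollifier e (z.1 - z.2))%R).
by apply: measurable_funM; [exact: (measurableT_comp mh)|exact: measurable_mollifier2].
Qed.

Lemma sq_ker_lty e (h : R -> R) x : (0 < e <= 1)%R -> measurable_fun [set: mR] h ->
  \int[mu]_y (h y ^+ 2)%:E < +oo -> \int[mu]_y (h y ^+ 2 * mollifier e (x - y))%:E < +oo.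
Proof.
move=> e01 mh hi.
apply: (@le_lt_trans _ _ (\int[mu]_y ((kbound e)%:E * (h y ^+ 2)%:E))).
  apply: ge0_le_integral => //.
  - by move=> y _; rewrite lee_fin mulr_ge0 ?sqr_ge0 ?mollifier_ge0.
  - apply/measurable_EFinP; apply: measurable_funM; [exact: measurable_funX|exact: measurable_mollifierx].
  - by apply: measurable_funeM; apply/measurable_EFinP; exact: measurable_funX.
  - move=> y _; rewrite -EFinM lee_fin mulrC ler_wpM2r ?sqr_ge0//.
    by case/andP: (mollifier_bounds e01 (x - y)).
rewrite ge0_integralZl_EFin ?kbound_ge0//.
- by rewrite lte_mul_pinfty// lee_fin kbound_ge0.
- by move=> y _; rewrite lee_fin sqr_ge0.
- by apply/measurable_EFinP; exact: measurable_funX.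
Qed.

(** The kernel is at most [1 / e] and lives on an interval of length [3 e],
    which is part of the one of length [6 e] centred at [x]. *)
Lemma conv1_dist e (h : R -> R) x : (0 < e <= 1)%R -> measurable_fun [set: mR] h ->
  \int[mu]_y (h y ^+ 2)%:E < +oo ->
  `|conv1 e h x - h x|%:E <= 6%:E * davg h x (3 * e).
Proof.
move=> e01 mh hi; have e0 : (0 < e)%R by case/andP: e01.
have mk := measurable_mollifierx x e01.
have [ik _ ihk] := integrable_weight mh mk (fun y => mollifier_ge0 e01 _) (mollifier_integral e01 x) (sq_ker_lty x e01 mh hi).
have ick : mu.-integrable setT (EFin \o (fun y => h x * mollifier e (x - y))%R).
  by have := integrableZl measurableT (h x) ik; apply: eq_integrable.
have idk : mu.-integrable setT (EFin \o (fun y => h y * mollifier e (x - y) - h x * mollifier e (x - y))%R).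
  by have := integrableB measurableT ihk ick; apply: eq_integrable.
have -> : (conv1 e h x - h x = \int[mu]_y (h y * mollifier e (x - y) - h x * mollifier e (x - y)))%R.
  rewrite RintegralB// RintegralZl// /conv1; congr (_ - _)%R.
  by rewrite /Rintegral mollifier_integral// mulr1.
rewrite EFin_normr_Rintegral//.
apply: (le_trans (le_abse_integral _ measurableT (measurable_int _ idk))).
rewrite /davg /iavg (_ : lebesgue_measure _ = (6 * e)%:E); last first.
  rewrite lebesgue_measure_ball; last by rewrite mulr_ge0// ltW.
  by congr EFin; rewrite -mulr_natl; ring.
rewrite muleA inver gt_eqF ?mulr_gt0//= -EFinM (_ : 6 * (6 * e)^-1 = e^-1)%R; last by field; rewrite gt_eqF.
have mb : measurable (ball x (3 * e)%R : set mR) by apply: measurable_realfun.open_measurable; exact: ball_open.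
have mhx : measurable_fun [set: mR] (fun y => `|(h y - h x)%:E|).
  by apply: measurableT_comp => //; apply/measurable_EFinP; exact: measurable_funB.
rewrite -ge0_integralZl_EFin//; last 2 first.
- exact: measurable_funTS.
- by rewrite invr_ge0 ltW.
rewrite [leRHS]integral_mkcond; apply: ge0_le_integral => //.
- apply/measurable_EFinP; apply: measurableT_comp => //.
  by apply/measurable_EFinP; exact: (measurable_int _ idk).
- apply/(measurable_restrictT _ _).1 => //; apply: measurable_funeM; exact: measurable_funTS.
- move=> y _; rewrite patchE; case: ifPn => [_|/negP yb].
    rewrite -abse_EFin /= -mulrBl normrM mulrC -EFinM lee_fin ler_wpM2r//.
    rewrite ger0_norm ?mollifier_ge0// /mollifier ler_piMl//; first by rewrite invr_ge0 ltW.
    by case/andP: (kappa_bounds ((x - y) / e)).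
  rewrite (@mollifier_out _ _ e01) ?mulr0 ?subrr ?normr0//.
  have [xy|xy] := leP (x - y)%R 0%R; [by left|right].
  rewrite leNgt; apply/negP => h3; apply: yb; rewrite inE /ball /=.
  by rewrite gtr0_norm.
Qed.

Lemma sq_locally_integrable (h : R -> R) : measurable_fun [set: mR] h ->
  \int[mu]_y (h y ^+ 2)%:E < +oo -> locally_integrable setT h.
Proof.
move=> mh hi; split => //; first exact: openT.
move=> K _ cK; have mK : measurable (K : set mR) by exact: measurable_realfun.compact_measurable.
apply: (@le_lt_trans _ _ (\int[mu]_(y in K) (1 * 1 + 1 * h y ^+ 2)%:E)).
  apply: ge0_le_integral => //.
  - by apply/measurable_EFinP; apply: measurable_funTS; exact: measurableT_comp.
  - apply/measurable_EFinP; apply: measurable_funTS; apply: measurable_funD => //.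
    by apply: measurable_funM => //; exact: measurable_funX.
  - move=> y _; rewrite lee_fin; rewrite -[(h y ^+ 2)%R]real_normK ?num_real//.
    by have := normr_ge0 (h y); set a := `|h y|%R => a0; nra.
rewrite ge0_integral_lin2//; last by move=> ? _; exact: sqr_ge0.
  rewrite !mul1e lte_add_pinfty//.
    by rewrite integral_cst// mul1e; exact: compact_finite_measure.
  apply: le_lt_trans hi; apply: ge0_subset_integral => //.
    by apply/measurable_EFinP; exact: measurable_funX.
  by move=> ? _; rewrite lee_fin sqr_ge0.
by apply: measurable_funTS; exact: measurable_funX.
Qed.

Definition invS (n : nat) : R := (n.+1%:R^-1)%R.

Lemma invS01 n : (0 < invS n <= 1)%R.
Proof. by rewrite /invS invr_gt0 ltr0n/= invf_le1// ler1n. Qed.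

(** The averages of [|h - h x|] over intervals shrinking to [x] tend to 0 for
    almost every [x], by Lebesgue's differentiation theorem. *)
Lemma conv1_cvg (h : R -> R) : measurable_fun [set: mR] h ->
  \int[mu]_y (h y ^+ 2)%:E < +oo ->
  {ae mu, forall x, (conv1 (invS n) h x) @[n --> \oo] --> h x}.
Proof.
move=> mh hi; have [N [mN N0 sN]] := lebesgue_differentiation (sq_locally_integrable mh hi).
exists N; split => //; apply: subset_trans sN => x /=; apply: contra_not => hx.
have e3 : (3 * invS n)%R @[n --> \oo] --> (0 : R)^'+.
  move=> /= A [d /= d0 dA].
  have : (invS n @[n --> \oo] --> 0%R)%classic by exact: cvg_harmonic.
  move=> /cvgrPdist_lt/(_ (d / 3)%R); rewrite divr_gt0// => /(_ isT) H.
  suff : \forall n \near \oo, A (3 * invS n)%R by [].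
  near=> n; have en0 : (0 < invS n)%R by case/andP: (invS01 n).
  apply: dA => /=; last exact: mulr_gt0.
  rewrite sub0r normrN ger0_norm ?mulr_ge0//; last by rewrite ltW//; case/andP: (invS01 n).
  have : (`|0 - invS n| < d / 3)%R by near: n; exact: H.
  rewrite sub0r normrN ger0_norm; last by rewrite ltW//; case/andP: (invS01 n).
  by rewrite ltr_pdivlMr// mulrC.
have hx' : davg h x (3 * invS n)%R @[n --> \oo] --> 0 by exact: cvg_comp e3 hx.
apply/cvgrPdist_le => _/posnumP[eps].
have e6 : 0 < (eps%:num / 6)%:E by rewrite lte_fin.
move: hx' => /fine_cvgP[hfin /cvgrPdist_le/(_ (eps%:num / 6)%R)]; rewrite divr_gt0// => /(_ isT) H.
near=> n.
have dfin : davg h x (3 * invS n)%R \is a fin_num by near: n; exact: hfin.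
have dle : (`|0 - fine (davg h x (3 * invS n))| <= eps%:num / 6)%R by near: n; exact: H.
have := conv1_dist x (invS01 n) mh hi.
rewrite -(fineK dfin) -EFinM lee_fin distrC => /le_trans; apply.
move: dle; rewrite sub0r normrN ger0_norm; last by rewrite fine_ge0// davg_ge0.
by lra.
Unshelve. all: by end_near. Qed.

Lemma fatou_eventually (u : (\bar R)^nat) (c : \bar R) : c < limn_einf u ->
  \forall n \near \oo, c <= u n.
Proof.
rewrite limn_einf_lim => cu.
have [n cn] : exists n, c < einfs u n.
  apply/not_existsP => H; move: cu; rewrite ltNge => /negP; apply.
  apply: lime_le; first exact: is_cvg_einfs.
  by apply: nearW => n; rewrite leNgt; apply/negP; exact: H.
exists n => // m /= nm; apply: (le_trans (ltW cn)).
by apply: ereal_inf_lbound; exists m.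
Qed.

(** By [osc_split] it is enough that the integrals of [(h y + h x)^2] against
    the kernel have a lower limit of at least [4 int h^2]. By Jensen's
    inequality in [y] they are at least the integrals of [(conv1 h + h)^2], to
    which Fatou's lemma applies since [conv1 h] tends to [h] almost everywhere. *)
Lemma osc_cvg0 (h : R -> R) : measurable_fun [set: mR] h ->
  \int[mu]_y (h y ^+ 2)%:E < +oo -> osc (invS n) h @[n --> \oo] --> 0.
Proof.
move=> mh hi.
have mh2 : measurable_fun [set: mR] (fun x => h x ^+ 2)%R by exact: measurable_funX.
set I := \int[mu]_y (h y ^+ 2)%:E in hi.
have I0 : 0 <= I by apply: integral_ge0 => y _; rewrite lee_fin sqr_ge0.
have Ifin : I \is a fin_num by rewrite ge0_fin_numE.
pose W n := \int[mu]_x \int[mu]_y ((h y + h x) ^+ 2 * mollifier (invS n) (x - y))%:E.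
pose q n (x : mR) := ((conv1 (invS n) h x + h x) ^+ 2)%:E.
have mq n : measurable_fun setT (q n).
  apply/measurable_EFinP; apply: measurable_funX; apply: measurable_funD => //.
  exact: measurable_conv1 (invS01 n) mh.
have qW n : \int[mu]_x q n x <= W n.
  apply: ge0_le_integral => //.
  - by move=> x _; rewrite lee_fin sqr_ge0.
  - rewrite [X in measurable_fun _ X](_ : _ = fubini_F mu (fun z : mR * mR => ((h z.2 + h z.1) ^+ 2 * mollifier (invS n) (z.1 - z.2))%:E))//.
    apply: measurable_fun_fubini_tonelli_F; last by move=> z; rewrite lee_fin mulr_ge0 ?sqr_ge0 ?mollifier_ge0// invS01.
    apply/measurable_EFinP; apply: measurable_funM; last exact: measurable_mollifier2 (invS01 n).
    by apply: measurable_funX; apply: measurable_funD; exact: (measurableT_comp mh).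
  - move=> x _; have mk := measurable_mollifierx x (invS01 n).
    have k0 y := mollifier_ge0 (invS01 n) (x - y).
    have := @jensen_sq _ _ mu (fun y => h y + h x)%R (fun y => mollifier (invS n) (x - y))%R _ mk k0 (mollifier_integral (invS01 n) x).
    move=> /(_ (measurable_funD mh (measurable_cst _))); apply: le_trans; rewrite lee_fin.
    have [ik _ ihk] := integrable_weight mh mk k0 (mollifier_integral (invS01 n) x) (sq_ker_lty x (invS01 n) mh hi).
    have ick : mu.-integrable setT (EFin \o (fun y => h x * mollifier (invS n) (x - y))%R).
      by have := integrableZl measurableT (h x) ik; apply: eq_integrable.
    under eq_Rintegral do rewrite mulrDl.
    rewrite RintegralD// RintegralZl// (_ : \int[mu]_y mollifier (invS n) (x - y) = 1)%R ?mulr1//.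
    by rewrite /Rintegral mollifier_integral// invS01.
have oW n : osc (invS n) h + W n = 4%:E * I by apply: osc_split => //; exact: invS01.
have o0 n : 0 <= osc (invS n) h.
  by apply: integral_ge0 => x _; apply: integral_ge0 => y _; rewrite lee_fin mulr_ge0 ?sqr_ge0 ?mollifier_ge0// invS01.
have [N [mN N0 sN]] := conv1_cvg mh hi.
have mD : measurable (setT `\` N : set mR) by exact: measurableD.
have lim4 : 4%:E * I <= limn_einf (fun n => \int[mu]_(x in setT `\` N) q n x).
  apply: (le_trans _ (fatou mu mD (fun n => measurable_funTS (mq n)) _)); last by move=> n x _; rewrite lee_fin sqr_ge0.
  rewrite /I -ge0_integralZl_EFin//; last 2 first.
  - by move=> y _; rewrite lee_fin sqr_ge0.
  - exact/measurable_EFinP.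
  rewrite (ge0_negligible_integral (N := N))//; last 2 first.
  - by apply: measurable_funeM; exact/measurable_EFinP.
  - by move=> y _; rewrite mule_ge0// lee_fin ?sqr_ge0.
  rewrite le_eqVlt; apply/orP; left; apply/eqP; apply: eq_integral => x; rewrite inE => -[_ Nx].
  have hx : conv1 (invS n) h x @[n --> \oo] --> h x by apply: contrapT => H; apply: Nx; apply: sN.
  have qx : q n x @[n --> \oo] --> ((h x + h x) ^+ 2)%:E.
    apply: cvg_EFin; first by exact: nearW.
    have c1 : (conv1 (invS n) h x + h x)%R @[n --> \oo] --> (h x + h x)%R by apply: cvgD => //; exact: cvg_cst.
    rewrite (_ : fine \o _ = fun n => ((conv1 (invS n) h x + h x) * (conv1 (invS n) h x + h x))%R); last first.
      by apply/funext => n.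
    by rewrite expr2; apply: cvgM.
  by rewrite (cvg_limn_einf_sup qx).1 -EFinM; congr EFin; ring.
have ofin n : osc (invS n) h \is a fin_num.
  rewrite ge0_fin_numE//; apply: (@le_lt_trans _ _ (4%:E * I)).
    rewrite -(oW n) leeDl//; apply: integral_ge0 => x _; apply: integral_ge0 => y _.
    by rewrite lee_fin mulr_ge0 ?sqr_ge0 ?mollifier_ge0// invS01.
  by rewrite lte_mul_pinfty.
apply/fine_cvgP; split; first by exact: nearW.
apply/cvgrPdist_le => _/posnumP[eps].
have : 4%:E * I - eps%:num%:E < limn_einf (fun n => \int[mu]_(x in setT `\` N) q n x).
  apply: lt_le_trans lim4; rewrite -(fineK Ifin) -EFinM -EFinB lte_fin.
  by have e0 : (0 < eps%:num)%R by []; lra.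
move=> /fatou_eventually H; near=> n.
have Hn : 4%:E * I - eps%:num%:E <= \int[mu]_(x in setT `\` N) q n x by near: n; exact: H.
rewrite sub0r normrN ger0_norm ?fine_ge0//= -lee_fin fineK//.
have qle : \int[mu]_(x in setT `\` N) q n x <= W n.
  apply: le_trans (qW n); apply: ge0_subset_integral => //.
  by move=> x _; rewrite lee_fin sqr_ge0.
have := le_trans Hn qle; have := oW n.
rewrite -(fineK Ifin) -(fineK (ofin n)) -EFinM => oWn.
have Wfin : W n \is a fin_num.
  by move: oWn; case: (W n) => //.
rewrite -(fineK Wfin) in oWn *; case: oWn => oWn.
by rewrite -EFinB !lee_fin; move: oWn; clear; lra.
Unshelve. all: by end_near. Qed.

Lemma osc_le (e : R) (h : R -> R) : (0 < e <= 1)%R -> measurable_fun [set: mR] h ->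
  osc e h <= 4%:E * \int[mu]_y (h y ^+ 2)%:E.
Proof.
move=> e01 mh; rewrite -(osc_split e01 mh) leeDl//.
by apply: integral_ge0 => x _; apply: integral_ge0 => y _; rewrite lee_fin mulr_ge0 ?sqr_ge0 ?mollifier_ge0.
Qed.

Lemma osc_ge0 (e : R) (h : R -> R) : (0 < e <= 1)%R -> 0 <= osc e h.
Proof.
by move=> e01; apply: integral_ge0 => x _; apply: integral_ge0 => y _; rewrite lee_fin mulr_ge0 ?sqr_ge0 ?mollifier_ge0.
Qed.

End OneDim.

Section Planar.
Context {R : realType}.
Local Notation mR := (measurableTypeR R).
Local Notation P := (mR * mR)%type.
Local Notation mu := (@lebesgue_measure R).
Local Open Scope ereal_scope.

(** The measure [leb2] under a name to which sigma-finiteness is attached, as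
    Tonelli's theorem requires for integrals over pairs of points of the plane. *)
Definition planar : set P -> \bar R := mu \x mu.

HB.instance Definition _ := Measure.copy planar (mu \x mu).

Lemma planar_sigma_finite : sigma_finite setT planar.
Proof.
pose I (n : nat) : set mR := [set` `[(- n%:R)%R, (n%:R)%R]].
exists (fun n => I n `*` I n).
  apply/seteqP; split=> // -[x y] _.
  exists (Num.truncn (Num.max `|x| `|y|)%R).+1 => //=.
  have h : (Num.max `|x| `|y| < (Num.truncn (Num.max `|x| `|y|)).+1%:R)%R by exact: truncnS_gt.
  move: h; rewrite gt_max => /andP[hx hy].
  by split; rewrite /I /= in_itv/= -ler_norml ltW.
move=> n; have mI : measurable (I n) by exact: measurable_itv.
split; first exact: measurableX.
rewrite /planar product_measure1E//= lebesgue_measure_itv/=.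
by case: ifPn => _; rewrite ?mule0 ?ltry// -EFinM ltry.
Qed.

HB.instance Definition _ := Measure_isSigmaFinite.Build _ _ _ planar planar_sigma_finite.

Lemma planarE (D : set P) (f : P -> \bar R) : \int[leb2]_(x in D) f x = \int[planar]_(x in D) f x.
Proof. by []. Qed.

End Planar.

Section OscMeas.
Context {R : realType}.
Local Notation mR := (measurableTypeR R).
Local Notation P := (mR * mR)%type.
Local Notation mu := (@lebesgue_measure R).
Local Open Scope ereal_scope.

Variable e : R.
Hypothesis e01 : (0 < e <= 1)%R.

Let k0 s : (0 <= mollifier e s)%R. Proof. exact: mollifier_ge0. Qed.

Lemma measurable_mollifierB d (T : measurableType d) (f g : T -> R) :
  measurable_fun setT f -> measurable_fun setT g ->
  measurable_fun setT (fun x => mollifier e (f x - g x)%R).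
Proof. by move=> mf mg; apply: (measurableT_comp (measurable_mollifier e01)); exact: measurable_funB. Qed.

Lemma rho_integral (x : P) : \int[planar]_y (rho e (x - y))%:E = 1.
Proof.
rewrite (fubini_tonelli1 (fun y : P => (rho e (x - y))%:E)); last 2 first.
- apply/measurable_EFinP; apply: measurable_funM; apply: measurable_mollifierB => //.
- by move=> y; rewrite lee_fin mulr_ge0.
rewrite /fubini_F /= -(mollifier_integral e01 x.1); apply: eq_integral => y1 _.
under eq_integral do rewrite /rho/= EFinM.
rewrite ge0_integralZl_EFin//; first by rewrite mollifier_integral// mule1.
- by move=> y _; rewrite lee_fin.
- by apply/measurable_EFinP; exact: measurable_mollifierB.
Qed.

Variable f : P -> R.
Hypothesis mf : measurable_fun setT f.

Lemma measurable_comp2 d (T : measurableType d) (a b : T -> R) :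
  measurable_fun setT (a : T -> mR) -> measurable_fun setT (b : T -> mR) -> measurable_fun setT (fun x => f (a x, b x)).
Proof. by move=> ma mb; apply: (measurableT_comp mf); exact: measurable_fun_pair. Qed.

Lemma measurable_osc : measurable_fun [set: mR] (fun x => osc e (fun y => f (x, y))).
Proof.
pose g (w : (mR * mR) * mR) := ((f (w.1.1, w.2) - f (w.1.1, w.1.2)) ^+ 2 * mollifier e (w.1.2 - w.2))%R.
have g0 w : 0 <= (g w)%:E by rewrite lee_fin mulr_ge0// sqr_ge0.
have m11 : measurable_fun [set: (mR * mR) * mR] (fun w => w.1.1) by exact: (measurableT_comp measurable_fst).
have m12 : measurable_fun [set: (mR * mR) * mR] (fun w => w.1.2) by exact: (measurableT_comp measurable_snd).
have mg : measurable_fun setT (EFin \o g).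
  apply/measurable_EFinP; apply: measurable_funM; last exact: measurable_mollifierB.
  by apply: measurable_funX; apply: measurable_funB; exact: measurable_comp2.
have mG := measurable_fun_fubini_tonelli_F (m2 := mu) (EFin \o g) mg g0.
rewrite [X in measurable_fun _ X](_ : _ = fubini_F mu (fubini_F mu (EFin \o g)))//.
apply: measurable_fun_fubini_tonelli_F => // w; apply: integral_ge0 => y _; exact: g0.
Qed.

End OscMeas.

Section TwoDim.
Context {R : realType}.
Local Notation mR := (measurableTypeR R).
Local Notation P := (mR * mR)%type.
Local Notation mu := (@lebesgue_measure R).
Local Open Scope ereal_scope.

Variable e : R.
Hypothesis e01 : (0 < e <= 1)%R.
Variable f : P -> R.
Hypothesis mf : measurable_fun setT f.

Let k0 s : (0 <= mollifier e s)%R. Proof. exact: mollifier_ge0. Qed.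
Let r0 z : (0 <= rho e z)%R. Proof. exact: rho_ge0. Qed.

Definition osc2 : \bar R :=
  \int[planar]_x \int[planar]_y ((f y - f x) ^+ 2 * rho e (x - y))%:E.

(** Pass from [x] to [y] through the corner [(x.1, y.2)]; on each of the two
    legs the kernel in the other coordinate integrates to one. *)
Lemma osc2_le : osc2 <=
  2%:E * \int[mu]_y osc e (fun x => f (x, y)) + 2%:E * \int[mu]_x osc e (fun y => f (x, y)).
Proof.
pose B (w : P * P) := ((f w.2 - f (w.1.1, w.2.2)) ^+ 2 * rho e (w.1 - w.2))%R.
pose A (w : P * P) := ((f (w.1.1, w.2.2) - f w.1) ^+ 2 * rho e (w.1 - w.2))%R.
have m1 : measurable_fun [set: P * P] (fun w => w.1) by exact: measurable_fst.
have m2 : measurable_fun [set: P * P] (fun w => w.2) by exact: measurable_snd.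
have m11 : measurable_fun [set: P * P] (fun w => w.1.1) by exact: (measurableT_comp measurable_fst m1).
have m12 : measurable_fun [set: P * P] (fun w => w.1.2) by exact: (measurableT_comp measurable_snd m1).
have m21 : measurable_fun [set: P * P] (fun w => w.2.1) by exact: (measurableT_comp measurable_fst m2).
have m22 : measurable_fun [set: P * P] (fun w => w.2.2) by exact: (measurableT_comp measurable_snd m2).
have mrho : measurable_fun [set: P * P] (fun w => rho e (w.1 - w.2)%R).
  by apply: measurable_funM; exact: measurable_mollifierB.
have mf1 : measurable_fun [set: P * P] (fun w => f w.1) by exact: (measurableT_comp mf).
have mf2 : measurable_fun [set: P * P] (fun w => f w.2) by exact: (measurableT_comp mf).
have mf12 : measurable_fun [set: P * P] (fun w => f (w.1.1, w.2.2)) by exact: (measurable_comp2 mf).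
have mB : measurable_fun setT B by apply: measurable_funM => //; apply: measurable_funX; exact: measurable_funB.
have mA : measurable_fun setT A by apply: measurable_funM => //; apply: measurable_funX; exact: measurable_funB.
have B0 w : (0 <= B w)%R by rewrite mulr_ge0// sqr_ge0.
have A0 w : (0 <= A w)%R by rewrite mulr_ge0// sqr_ge0.
have mEB : measurable_fun setT (EFin \o B) by exact/measurable_EFinP.
have mEA : measurable_fun setT (EFin \o A) by exact/measurable_EFinP.
pose F (w : P * P) := ((f w.2 - f w.1) ^+ 2 * rho e (w.1 - w.2))%R.
have mF : measurable_fun setT F by apply: measurable_funM => //; apply: measurable_funX; exact: measurable_funB.
rewrite /osc2 -(@fubini_tonelli1 _ _ _ _ R planar planar (EFin \o F)); last 2 first.
- exact/measurable_EFinP.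
- by move=> w; rewrite lee_fin mulr_ge0// sqr_ge0.
apply: (@le_trans _ _ (\int[(planar) \x (planar)]_w (2 * B w + 2 * A w)%:E)).
  apply: ge0_le_integral => //.
  - by move=> w _; rewrite lee_fin mulr_ge0// sqr_ge0.
  - exact/measurable_EFinP.
  - by apply/measurable_EFinP; apply: measurable_funD; exact: measurable_funM.
  - move=> w _; rewrite lee_fin /F /A /B -subr_ge0.
    rewrite (_ : _ - _ = ((f w.2 - f (w.1.1, w.2.2)) - (f (w.1.1, w.2.2) - f w.1)) ^+ 2 * rho e (w.1 - w.2))%R.
      by rewrite mulr_ge0// sqr_ge0.
    ring.
rewrite ge0_integral_lin2//; apply: leeD; apply: lee_pmul => //.
- by apply: integral_ge0 => w _; rewrite lee_fin.
- pose Bk (w : mR * P) := ((f w.2 - f (w.1, w.2.2)) ^+ 2 * mollifier e (w.1 - w.2.1))%R.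
  have Bk0 w : (0 <= Bk w)%R by rewrite mulr_ge0// sqr_ge0.
  have n2 : measurable_fun [set: mR * P] (fun w => w.2) by exact: measurable_snd.
  have n21 : measurable_fun [set: mR * P] (fun w => w.2.1) by exact: (measurableT_comp measurable_fst n2).
  have n22 : measurable_fun [set: mR * P] (fun w => w.2.2) by exact: (measurableT_comp measurable_snd n2).
  have mBk : measurable_fun setT Bk.
    apply: measurable_funM; last exact: measurable_mollifierB.
    apply: measurable_funX; apply: measurable_funB; first exact: (measurableT_comp mf).
    exact: (measurable_comp2 mf).
  rewrite (@fubini_tonelli1 _ _ _ _ R planar planar (EFin \o B))//.
  rewrite (@fubini_tonelli1 _ _ _ _ R mu mu (fubini_F planar (EFin \o B))); last 2 first.
  + by apply: measurable_fun_fubini_tonelli_F => // w; rewrite lee_fin.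
  + by move=> w; apply: integral_ge0 => y _; rewrite lee_fin.
  have E x1 : fubini_F mu (fubini_F planar (EFin \o B)) x1 = \int[planar]_y (Bk (x1, y))%:E.
    rewrite /fubini_F (@fubini_tonelli _ _ _ _ R mu planar (fun w : mR * P => (B ((x1, w.1), w.2))%:E)); last 2 first.
    + apply/measurable_EFinP; apply: measurable_funM.
        apply: measurable_funX; apply: measurable_funB; first exact: (measurableT_comp mf).
        by apply: (measurable_comp2 mf).
      apply: measurable_funM; first exact: (measurable_mollifierB e01 (measurable_cst x1) n21).
      exact: (measurable_mollifierB e01 measurable_fst n22).
    + by move=> w; rewrite lee_fin.
    apply: eq_integral => y _; rewrite /B /Bk /rho /=.
    under eq_integral do rewrite mulrA EFinM.
    rewrite ge0_integralZl_EFin//.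
    + by rewrite mollifier_integral_x// mule1.
    + by move=> y1 _; rewrite lee_fin.
    + by apply/measurable_EFinP; exact: measurable_mollifierB.
    + by rewrite mulr_ge0// sqr_ge0.
  under eq_integral do rewrite E.
  (* The remaining variables are the two first coordinates and the common second
     one: the order of integration has to be exchanged once more. *)
  pose Bj (w : (mR * mR) * mR) := (Bk (w.1.1, (w.2, w.1.2)))%:E.
  have mBj : measurable_fun setT Bj.
    apply/measurable_EFinP; apply: (measurableT_comp mBk).
    have p1 : measurable_fun [set: P * mR] (fun w => w.1.1) by exact: (measurableT_comp measurable_fst).
    have p2 : measurable_fun [set: P * mR] (fun w => w.1.2) by exact: (measurableT_comp measurable_snd).
    by apply: measurable_fun_pair => //; apply: measurable_fun_pair.
  rewrite le_eqVlt; apply/orP; left; apply/eqP.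
  transitivity (\int[mu]_x1 \int[mu]_y2 fubini_F mu Bj (x1, y2)).
    apply: eq_integral => x1 _.
    rewrite (@fubini_tonelli2 _ _ _ _ R mu mu (fun y : P => (Bk (x1, y))%:E))//; last first.
      by move=> y; rewrite lee_fin.
    by apply/measurable_EFinP; apply: (measurableT_comp mBk); exact: measurable_fun_pair.
  transitivity (\int[mu]_y2 \int[mu]_x1 fubini_F mu Bj (x1, y2)).
    apply: (@fubini_tonelli _ _ _ _ R mu mu (fubini_F mu Bj)).
      by apply: measurable_fun_fubini_tonelli_F => // w; rewrite lee_fin.
    by move=> w; apply: integral_ge0 => y _; rewrite lee_fin.
  apply: eq_integral => y _; rewrite /osc; apply: eq_integral => x _.
  by rewrite /fubini_F; apply: eq_integral.
- by apply: integral_ge0 => w _; rewrite lee_fin.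
- rewrite (@fubini_tonelli1 _ _ _ _ R planar planar (EFin \o A))//.
  have E x : fubini_F (planar) (EFin \o A) x = \int[mu]_y2 ((f (x.1, y2) - f x) ^+ 2 * mollifier e (x.2 - y2))%:E.
    rewrite /fubini_F (@fubini_tonelli2 _ _ _ _ R mu mu (fun y : P => (EFin \o A) (x, y))); last 2 first.
    + by apply: (measurableT_comp mEA); exact: measurable_fun_pair.
    + by move=> y; rewrite lee_fin.
    apply: eq_integral => y2 _; rewrite /fubini_G /A /rho /=.
    under eq_integral do rewrite mulrCA EFinM muleC.
    rewrite ge0_integralZl_EFin//.
    + by rewrite mollifier_integral// mule1.
    + by move=> y1 _; rewrite lee_fin.
    + by apply/measurable_EFinP; exact: measurable_mollifierB.
    + by rewrite mulr_ge0// sqr_ge0.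
  under eq_integral do rewrite E.
  pose Ak (w : P * mR) := ((f (w.1.1, w.2) - f w.1) ^+ 2 * mollifier e (w.1.2 - w.2))%R.
  have q1 : measurable_fun [set: P * mR] (fun w => w.1.1) by exact: (measurableT_comp measurable_fst).
  have q2 : measurable_fun [set: P * mR] (fun w => w.1.2) by exact: (measurableT_comp measurable_snd).
  have mAk : measurable_fun setT (EFin \o Ak).
    apply/measurable_EFinP; apply: measurable_funM; last exact: measurable_mollifierB.
    apply: measurable_funX; apply: measurable_funB; first exact: (measurable_comp2 mf).
    exact: (measurableT_comp mf).
  have Ak0 w : 0 <= (Ak w)%:E by rewrite lee_fin mulr_ge0// sqr_ge0.
  rewrite le_eqVlt; apply/orP; left; apply/eqP.
  transitivity (\int[mu]_x1 \int[mu]_x2 fubini_F mu (EFin \o Ak) (x1, x2)).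
    apply: (@fubini_tonelli1 _ _ _ _ R mu mu (fubini_F mu (EFin \o Ak))).
      by apply: measurable_fun_fubini_tonelli_F.
    by move=> w; apply: integral_ge0 => y _; exact: Ak0.
  apply: eq_integral => x1 _; rewrite /osc; apply: eq_integral => x2 _.
  by rewrite /fubini_F; apply: eq_integral.
Qed.

End TwoDim.

Section ConvL2.
Context {R : realType}.
Local Notation mR := (measurableTypeR R).
Local Notation P := (mR * mR)%type.
Local Notation mu := (@lebesgue_measure R).
Local Open Scope ereal_scope.

(** Almost every slice of an L^2 function is in L^2, so that its oscillation
    tends to 0; the bound [osc_le] dominates. *)
Lemma int_osc_cvg0 (f : P -> R) : measurable_fun setT f ->
  \int[planar]_x (f x ^+ 2)%:E < +oo ->
  \int[mu]_x osc (invS n) (fun y => f (x, y)) @[n --> \oo] --> 0.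
Proof.
move=> mf fi.
have mf2 : measurable_fun setT (fun z => (f z ^+ 2)%:E).
  by apply/measurable_EFinP; exact: measurable_funX.
have f20 z : 0 <= (f z ^+ 2)%:E by rewrite lee_fin sqr_ge0.
have ms x : measurable_fun [set: mR] (fun y => f (x, y)).
  exact: (measurableT_comp mf (pair1_measurable x)).
pose G := fubini_F mu (fun z => (f z ^+ 2)%:E).
have mG : measurable_fun setT G by exact: measurable_fun_fubini_tonelli_F.
have G0 x : 0 <= G x by apply: integral_ge0.
have Gi : mu.-integrable setT G.
  apply/integrableP; split => //.
  under eq_integral do rewrite gee0_abs//.
  by rewrite -(@fubini_tonelli1 _ _ _ _ R mu mu (fun z => (f z ^+ 2)%:E)).
have G4 : mu.-integrable setT (fun x => 4%:E * G x) by exact: integrableZl.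
have [||_ _] := @dominated_convergence _ mR R mu setT measurableT
   (fun n x => osc (invS n) (fun y => f (x, y))) (cst 0) (fun x => 4%:E * G x)
   (fun n => measurable_osc (invS01 n) mf) (measurable_cst 0) _ G4 _.
- have [N [mN N0 sN]] := integrable_ae measurableT Gi.
  exists N; split => //; apply: subset_trans sN => x /=; apply: contra_not => Gx _.
  apply: osc_cvg0 => //.
  by move/(_ I): Gx; rewrite ge0_fin_numE.
- apply: aeW => x n _; rewrite gee0_abs ?osc_ge0 ?invS01//.
  exact: osc_le (invS01 n) (ms x).
by rewrite integral0.
Qed.

(** Jensen's inequality for the density [y |-> rho e (x - y)]. *)
Lemma convol_sq_le e (f : P -> R) : (0 < e <= 1)%R -> leb2.-integrable setT (EFin \o f) ->
  \int[leb2]_x ((convol (rho e) f x - f x) ^+ 2)%:E <= osc2 e f.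
Proof.
move=> e01 fi; have mf : measurable_fun setT f by apply/measurable_EFinP; exact: (measurable_int _ fi).
have c0 := C1_continuous (rho_C1 e01); have b0 := rho_bound e01.
have mrho : measurable_fun [set: P * P] (fun w => rho e (w.1 - w.2)%R).
  have m1 : measurable_fun [set: P * P] (fun w => w.1) by exact: measurable_fst.
  have m2 : measurable_fun [set: P * P] (fun w => w.2) by exact: measurable_snd.
  by apply: measurable_funM; apply: measurable_mollifierB => //;
    [exact: (measurableT_comp measurable_fst m1)|exact: (measurableT_comp measurable_fst m2)|
     exact: (measurableT_comp measurable_snd m1)|exact: (measurableT_comp measurable_snd m2)].
pose F (w : P * P) := ((f w.2 - f w.1) ^+ 2 * rho e (w.1 - w.2))%R.
have F0 w : 0 <= (F w)%:E by rewrite lee_fin mulr_ge0 ?sqr_ge0 ?rho_ge0.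
have mF : measurable_fun setT (EFin \o F).
  apply/measurable_EFinP; apply: measurable_funM => //; apply: measurable_funX; apply: measurable_funB.
    exact: (measurableT_comp mf).
  exact: (measurableT_comp mf).
have mc : measurable_fun setT (convol (rho e) f).
  by apply: continuous_measurable2; exact: C1_continuous (convol_C1 e01 fi).
rewrite planarE; apply: ge0_le_integral => //.
- by move=> x _; rewrite lee_fin sqr_ge0.
- by apply/measurable_EFinP; apply: measurable_funX; exact: measurable_funB.
- exact: (@measurable_fun_fubini_tonelli_F _ _ _ _ R planar (EFin \o F)).
move=> x _.
have mk : measurable_fun [set: P] (fun y : P => rho e (x - y)%R) by exact: continuous_shift2.
have k0 (y : P) : (0 <= rho e (x - y))%R by exact: rho_ge0.
have := @jensen_sq R _ _ planar (fun y => f y - f x)%R _ (measurable_funB mf (measurable_cst _)) mk k0 (rho_integral e01 x).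
apply: le_trans; rewrite lee_fin.
have ik : planar.-integrable setT (EFin \o (fun y : P => rho e (x - y)%R)).
  apply/integrableP; split; first exact/measurable_EFinP.
  under eq_integral do rewrite /= ger0_norm//.
  by rewrite rho_integral// ltry.
have ihk : planar.-integrable setT (EFin \o (fun y : P => f y * rho e (x - y))%R).
  exact: (convol_integrable x c0 b0 fi).
have ick : planar.-integrable setT (EFin \o (fun y => f x * rho e (x - y))%R).
  by have := integrableZl measurableT (f x) ik; apply: eq_integrable.
rewrite (_ : \int[planar]_y ((f y - f x) * rho e (x - y)) = convol (rho e) f x - f x)%R//.
under eq_Rintegral do rewrite mulrBl.
rewrite RintegralB// RintegralZl// (_ : \int[planar]_y rho e (x - y) = 1)%R ?mulr1//.
by rewrite /Rintegral rho_integral.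
Qed.

Lemma convol_cvg (f : P -> R) (d : R) : (0 < d)%R -> leb2.-integrable setT (EFin \o f) ->
  \int[leb2]_x (f x ^+ 2)%:E < +oo ->
  \forall n \near \oo, \int[leb2]_x ((convol (rho (invS n)) f x - f x) ^+ 2)%:E <= d%:E.
Proof.
move=> d0 fi f2; have mf : measurable_fun setT f by apply/measurable_EFinP; exact: (measurable_int _ fi).
have H1 := int_osc_cvg0 mf f2.
pose g (z : P) := f (z.2, z.1).
have mg : measurable_fun setT g by apply: (measurableT_comp mf); exact: measurable_swap.
have g2 : \int[planar]_x (g x ^+ 2)%:E < +oo.
  rewrite (@fubini_tonelli1 _ _ _ _ R mu mu (fun z => (g z ^+ 2)%:E)); last 2 first.
  - by apply/measurable_EFinP; exact: measurable_funX.
  - by move=> z; rewrite lee_fin sqr_ge0.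
  move: f2; rewrite planarE (@fubini_tonelli2 _ _ _ _ R mu mu (fun z => (f z ^+ 2)%:E))//.
  - by apply/measurable_EFinP; exact: measurable_funX.
  - by move=> z; rewrite lee_fin sqr_ge0.
have H2 := int_osc_cvg0 mg g2.
have d4 : (0 < d / 4)%R by rewrite divr_gt0.
have ev (u : (\bar R)^nat) : (forall n, 0 <= u n) -> u @ \oo --> 0 -> \forall n \near \oo, u n <= (d / 4)%:E.
  move=> u0 /fine_cvgP[ufin /cvgrPdist_le/(_ _ d4) H]; near=> n.
  have un : u n \is a fin_num by near: n; exact: ufin.
  rewrite -(fineK un) lee_fin.
  have : (`|0 - fine (u n)| <= d / 4)%R by near: n; exact: H.
  by rewrite sub0r normrN ger0_norm// fine_ge0.
have E1 : \forall n \near \oo, \int[mu]_x osc (invS n) (fun y => f (x, y)) <= (d / 4)%:E := ev _ (fun n => integral_ge0 _ (fun x _ => osc_ge0 _ (invS01 n))) H1.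
have E2 : \forall n \near \oo, \int[mu]_y osc (invS n) (fun x => f (x, y)) <= (d / 4)%:E := ev _ (fun n => integral_ge0 _ (fun x _ => osc_ge0 _ (invS01 n))) H2.
apply: filterS2 E1 E2 => n n1 n2.
apply: (le_trans (convol_sq_le (invS01 n) fi)).
apply: (le_trans (osc2_le (invS01 n) mf)).
have -> : d%:E = 2%:E * (d / 4)%:E + 2%:E * (d / 4)%:E by rewrite -!EFinM -EFinD; congr EFin; field.
have two0 : 0 <= 2%:E :> \bar R by rewrite lee_fin.
exact: leeD (lee_wpmul2l two0 n2) (lee_wpmul2l two0 n1).
Unshelve. all: by end_near. Qed.

End ConvL2.

(** * Rectangles, discs and smooth approximation *)

Section Geometry.
Context {R : realType}.
Local Notation mR := (measurableTypeR R).
Local Notation P := (mR * mR)%type.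
Local Notation mu := (@lebesgue_measure R).
Implicit Types (B : set (R * R)) (a b c d : R).

Definition rect a b c d : set (R * R) := `[a, b] `*` `[c, d].

Lemma rectP a b c d (x : R * R) :
  rect a b c d x <-> [/\ a <= x.1, x.1 <= b, c <= x.2 & x.2 <= d].
Proof.
by rewrite /rect /= !in_itv/=; split=> [[/andP[-> ->] /andP[-> ->]]|[-> -> -> ->]].
Qed.

Lemma measurable_rect a b c d : measurable (rect a b c d : set P).
Proof. by apply: measurableX; exact: measurable_itv. Qed.

Lemma compact_rect a b c d : compact (rect a b c d).
Proof. by apply: compact_setX; exact: segment_compact. Qed.

Lemma closed_rect a b c d : closed (rect a b c d).
Proof.
rewrite (_ : rect a b c d = (fst @^-1` `[a, b]) `&` (snd @^-1` `[c, d]))//.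
by apply: closedI; apply: closed_comp; [move=> x _; exact: cvg_fst|exact: itv_closed|
  move=> x _; exact: cvg_snd|exact: itv_closed].
Qed.

Lemma leb2_rect a b c d : a <= b -> c <= d ->
  leb2 (rect a b c d : set P) = ((b - a) * (d - c))%:E.
Proof.
move=> ab cd; rewrite /leb2 /= product_measure1E/=; [|exact: measurable_itv|exact: measurable_itv].
rewrite !lebesgue_measure_itv/= !lte_fin.
case: ltP => [_|h]; last by rewrite mul0e (_ : b = a) ?subrr ?mul0r//; lra.
case: ltP => [_|h]; last by rewrite mule0 (_ : d = c) ?subrr ?mulr0//; lra.
by rewrite -!EFinB -EFinM.
Qed.

Lemma leb2_rect_fin a b c d : (leb2 (rect a b c d : set P) < +oo)%E.
Proof.
rewrite /leb2 /= product_measure1E/=; [|exact: measurable_itv|exact: measurable_itv].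
rewrite !lebesgue_measure_itv/= !lte_fin.
by case: ifPn => _; case: ifPn => _; rewrite ?mul0e ?mule0 ?ltry// -!EFinB -EFinM ltry.
Qed.

Lemma continuous_disk_fun (z : R * R) :
  continuous (fun x : R * R => (x.1 - z.1) ^+ 2 + (x.2 - z.2) ^+ 2).
Proof.
move=> x; rewrite /continuous_at; apply: cvgD; rewrite expr2.
  by under eq_fun do rewrite expr2; apply: cvgM; (apply: cvgB; [exact: cvg_fst|exact: cvg_cst]).
by under eq_fun do rewrite expr2; apply: cvgM; (apply: cvgB; [exact: cvg_snd|exact: cvg_cst]).
Qed.

Lemma open_disk (z : R * R) r : open (disk z r).
Proof.
rewrite (_ : disk z r = (fun x : R * R => (x.1 - z.1) ^+ 2 + (x.2 - z.2) ^+ 2) @^-1` [set t | t < r ^+ 2])//.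
apply: open_comp; last exact: open_lt.
by move=> x _; exact: continuous_disk_fun.
Qed.

Lemma measurable_disk (z : R * R) r : measurable (disk z r : set P).
Proof. by apply: open_measurable2; exact: open_disk. Qed.

Lemma sub_disk_rect (z : R * R) r : 0 < r ->
  disk z r `<=` rect (z.1 - r) (z.1 + r) (z.2 - r) (z.2 + r).
Proof.
move=> r0 x; rewrite /disk /= => h; apply/rectP.
have h1 : `|x.1 - z.1| < r.
  rewrite -ltr_sqr ?nnegrE// ?ltW// real_normK ?num_real//.
  by apply: le_lt_trans h; rewrite lerDl sqr_ge0.
have h2 : `|x.2 - z.2| < r.
  rewrite -ltr_sqr ?nnegrE// ?ltW// real_normK ?num_real//.
  by apply: le_lt_trans h; rewrite lerDr sqr_ge0.
by move: h1 h2; rewrite !ltr_norml => /andP[? ?] /andP[? ?]; split; lra.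
Qed.

Lemma leb2_disk_fin (z : R * R) r : 0 < r -> (leb2 (disk z r : set P) < +oo)%E.
Proof.
move=> r0; apply: le_lt_trans (leb2_rect_fin (z.1 - r) (z.1 + r) (z.2 - r) (z.2 + r)).
by apply: le_measure; rewrite ?inE; [exact: measurable_disk|exact: measurable_rect|exact: sub_disk_rect].
Qed.

Lemma C1_C1c B (K : set (R * R)) u u1 u2 : C1 u u1 u2 -> compact K -> closed K -> K `<=` B ->
  (forall x, ~ K x -> u x = 0) -> C1c B u.
Proof.
move=> Cu cK clK KB uK.
have cl : closure [set x | u x != 0] `<=` K.
  rewrite [X in _ `<=` X](closure_id _).1//; apply: closureS.
  by move=> x /=; apply: contraNP => /uK ->.
split.
- by move=> x; exact: (C1_differentiable x Cu).
- move=> i; have [c1 c2 _] := Cu.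
  have [->|->] : i = 0 \/ i = 1.
    by case: i => -[|[|//]] p; [left|right]; apply: val_inj.
  - by rewrite (_ : (fun x => _) = u1)//; apply/funext => x; exact: C1_grad0 Cu.
  - by rewrite (_ : (fun x => _) = u2)//; apply/funext => x; exact: C1_grad1 Cu.
- by apply: subclosed_compact cK cl; exact: closed_closure.
- exact: subset_trans cl KB.
Qed.

Lemma C1_reflect u u1 u2 (x : R * R) (C : R) : C1 u u1 u2 ->
  (forall y h, `|u (h + y) - u y - (h.1 * u1 y + h.2 * u2 y)| <= C * `|h| ^+ 2) ->
  C1 (fun y : R * R => u (x - y)) (fun y => - u1 (x - y)) (fun y => - u2 (x - y)).
Proof.
move=> [c1 c2 _] hq.
have cr (f : R * R -> R) : continuous f -> continuous (fun y : R * R => - f (x - y)).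
  move=> cf; have c : continuous (f \o (fun y : R * R => x - y)).
    move=> y; apply: continuous_comp; last exact: cf.
    by apply: cvgB; [exact: cvg_cst|exact: cvg_id].
  by move=> y; apply: cvgN; exact: c.
apply: (@C1_quadratic R _ _ _ C); [exact: cr|exact: cr|move=> y h].
have := hq (x - y) (- h); rewrite normrN.
rewrite (_ : - h + (x - y) = x - (h + y)); last by rewrite opprD addrCA.
by rewrite (_ : (- h).1 * u1 (x - y) + (- h).2 * u2 (x - y) = h.1 * - u1 (x - y) + h.2 * - u2 (x - y))//=; ring.
Qed.

Lemma Lp2_restrict B f : measurable (B : set P) -> (leb2 (B : set P) < +oo)%E ->
  Lp_on B 2%:E f ->
  [/\ measurable_fun [set: P] (f \_ B), (\int[leb2]_x ((f \_ B) x ^+ 2)%:E < +oo)%E &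
      leb2.-integrable [set: P] (EFin \o (f \_ B))].
Proof.
move=> mB Bfin fL.
have mf : measurable_fun [set: P] (f \_ B).
  by move: fL; rewrite /Lp_on inE => /andP[]; rewrite inE.
have /integrableP[_ f2] := Lfun2_integrable_sqr fL.
have f2' : (\int[leb2]_x ((f \_ B) x ^+ 2)%:E < +oo)%E.
  apply: le_lt_trans f2; rewrite le_eqVlt; apply/orP; left; apply/eqP.
  by apply: eq_integral => x _; rewrite /= ger0_norm ?sqr_ge0.
split => //; apply/integrableP; split; first exact/measurable_EFinP.
have mfB : measurable_fun [set: P] (\1_B : P -> R) by [].
apply: (@le_lt_trans _ _ (\int[leb2]_x (1 * (f \_ B) x ^+ 2 + 1 * \1_B x)%:E)%E).
  apply: ge0_le_integral => //.
  - by apply/measurable_EFinP; exact: measurableT_comp.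
  - by apply/measurable_EFinP; apply: measurable_funD; apply: measurable_funM => //; exact: measurable_funX.
  - move=> x _ /=; rewrite lee_fin !mul1r /patch indicE; case: ifPn => xB.
      rewrite -[f x ^+ 2]real_normK ?num_real//.
      by have := normr_ge0 (f x); set a := `|f x| => a0 /=; nra.
    by rewrite normr0 expr0n.
rewrite ge0_integral_lin2//; last 2 first.
- exact: measurable_funX.
- by move=> x _; exact: sqr_ge0.
by rewrite !mul1e lte_add_pinfty// integral_indic// setIT.
Qed.

(** The kernel [y |-> rho e (x - y)] lives in the square of side [3 e] with
    upper right corner [x]; when this square is contained in [B] it is itself a
    test function for the weak gradient. *)
Lemma weak_gradient_convol B v g (e : R) (x : R * R) : 0 < e <= 1 ->
  measurable (B : set P) -> (leb2 (B : set P) < +oo)%E -> Lp_on B 2%:E v ->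
  L2_weak_gradient B v g ->
  rect (x.1 - 3 * e) x.1 (x.2 - 3 * e) x.2 `<=` B ->
  convol (drho1 e) (v \_ B) x = convol (rho e) ((fun y => g y 0 0) \_ B) x /\
  convol (drho2 e) (v \_ B) x = convol (rho e) ((fun y => g y 1 0) \_ B) x.
Proof.
move=> e01 mB Bfin vL vg KB.
have [mv v2 vi] := Lp2_restrict mB Bfin vL.
have CR := @C1_reflect (rho e) (drho1 e) (drho2 e) x _ (rho_C1 e01) (rho_remainder e01).
have phiB : C1c B (fun y => rho e (x - y)).
  apply: (@C1_C1c B _ _ _ _ CR _ _ KB) => [||y yK]; [exact: compact_rect|exact: closed_rect|].
  have [|-> _ _//] := @rho_out _ _ e01 (x - y).
  by move=> /= -[/andP[? ?] /andP[? ?]]; apply: yK; apply/rectP; split; lra.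
have conE (f k : R * R -> R) : convol k (f \_ B) x = \int[leb2]_(y in B) (f y * k (x - y)).
  rewrite /convol [RHS]Rintegral_mkcond; apply: eq_Rintegral => y _.
  by rewrite /patch; case: ifPn => //; rewrite mul0r.
have neg (k : R * R -> R) (M : R) : continuous k -> (forall z, `|k z| <= M) ->
    \int[leb2]_(y in B) (v y * (- k (x - y))) = - \int[leb2]_(y in B) (v y * k (x - y)).
  move=> ck bk; rewrite -mulN1r -RintegralZl//; first by apply: eq_Rintegral => y _; rewrite mulN1r mulrN.
  have := convol_integrable x ck bk vi.
  have -> : EFin \o (fun y : P => (v \_ B) y * k (x - y)) = (EFin \o (fun y : P => v y * k (x - y))) \_ B.
    by apply/funext => y; rewrite /patch /=; case: ifPn => //; rewrite mul0r.
  by move=> /(integrable_mkcond _ mB).2.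
split.
- have [_ /(_ _ phiB)] := vg 0.
  under eq_Rintegral do rewrite (C1_grad0 _ CR).
  rewrite (neg _ _ (drho1_continuous e01) (drho1_bound e01)) => /oppr_inj E.
  by rewrite !conE.
- have [_ /(_ _ phiB)] := vg 1.
  under eq_Rintegral do rewrite (C1_grad1 _ CR).
  rewrite (neg _ _ (drho2_continuous e01) (drho2_bound e01)) => /oppr_inj E.
  by rewrite !conE.
Qed.

(** Mollify [v] and [g], extended by zero. At points of [K] the kernel sees only
    points of [B], so that the gradient of the mollification of [v] is the
    mollification of [g]. *)
Lemma C1_approximation B v g (K : set (R * R)) (m d : R) :
  measurable (B : set P) -> (leb2 (B : set P) < +oo)%E -> Lp_on B 2%:E v ->
  L2_weak_gradient B v g -> measurable (K : set P) -> 0 < m ->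
  (forall x, K x -> rect (x.1 - m) x.1 (x.2 - m) x.2 `<=` B) -> 0 < d ->
  exists u u1 u2, [/\ C1 u u1 u2,
    (\int[leb2]_(x in K) ((u x - v x) ^+ 2)%:E <= d%:E)%E,
    (\int[leb2]_(x in K) ((u1 x - g x 0 0) ^+ 2)%:E <= d%:E)%E &
    (\int[leb2]_(x in K) ((u2 x - g x 1 0) ^+ 2)%:E <= d%:E)%E].
Proof.
move=> mB Bfin vL vg mK m0 KB d0.
have [mv v2 vi] := Lp2_restrict mB Bfin vL.
have [mg0 g02 g0i] := Lp2_restrict mB Bfin (vg 0).1.
have [mg1 g12 g1i] := Lp2_restrict mB Bfin (vg 1).1.
have Ev := convol_cvg d0 vi v2.
have E0 := convol_cvg d0 g0i g02.
have E1 := convol_cvg d0 g1i g12.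
have Em : \forall n \near \oo, 3 * invS n <= m :> R.
  have : (invS n @[n --> \oo] --> (0 : R))%classic by exact: cvg_harmonic.
  have m3 : 0 < m / 3 by rewrite divr_gt0.
  move=> /cvgrPdist_le/(_ _ m3); apply: filterS => n.
  have /andP[e0 _] := invS01 (R := R) n.
  by rewrite sub0r normrN ger0_norm; [rewrite ler_pdivlMr// mulrC|exact: ltW].
have [n [En [Ev' [E0' E1']]]] := filter_ex (filterI Em (filterI Ev (filterI E0 E1))).
have e01 := invS01 (R := R) n; have CV := convol_C1 e01 vi.
exists (convol (rho (invS n)) (v \_ B)), (convol (drho1 (invS n)) (v \_ B)), (convol (drho2 (invS n)) (v \_ B)).
have e0 : 0 < invS n :> R by case/andP: e01.
have KB' x : K x -> rect (x.1 - 3 * invS n) x.1 (x.2 - 3 * invS n) x.2 `<=` B.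
  move=> /KB H y /rectP[y1 y2 y3 y4]; apply: H; apply/rectP.
  by move: y1 y2 y3 y4 En; clear=> *; split; lra.
have KinB x : K x -> B x.
  by move=> /KB'; apply; apply/rectP; move: e0; clear=> *; split; lra.
have onK (h f : R * R -> R) : leb2.-integrable [set: P] (EFin \o f \_ B) ->
    (forall x, K x -> h x = convol (rho (invS n)) (f \_ B) x) ->
    (\int[leb2]_x ((convol (rho (invS n)) (f \_ B) x - (f \_ B) x) ^+ 2)%:E <= d%:E)%E ->
    (\int[leb2]_(x in K) ((h x - f x) ^+ 2)%:E <= d%:E)%E.
  move=> fi hK; apply: le_trans.
  apply: (@le_trans _ _ (\int[leb2]_(x in K) ((convol (rho (invS n)) (f \_ B) x - (f \_ B) x) ^+ 2)%:E)%E).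
    rewrite le_eqVlt; apply/orP; left; apply/eqP; apply: eq_integral => x; rewrite inE => Kx.
    rewrite hK// (_ : (f \_ B) x = f x)//.
    by rewrite patchE mem_set//; exact: KinB.
  apply: ge0_subset_integral => //.
    apply/measurable_EFinP; apply: measurable_funX; apply: measurable_funB.
      by apply: continuous_measurable2; exact: C1_continuous (convol_C1 e01 fi).
    by apply/measurable_EFinP; exact: (measurable_int _ fi).
  by move=> x _; rewrite lee_fin sqr_ge0.
split => //.
- exact: onK Ev'.
- apply: onK E0' => // x Kx.
  by have [] := weak_gradient_convol e01 mB Bfin vL vg (KB' x Kx).
- apply: onK E1' => // x Kx.
  by have [] := weak_gradient_convol e01 mB Bfin vL vg (KB' x Kx).
Qed.

End Geometry.

(** * Restriction to lines *)

Section Lines.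
Context {R : realType}.
Local Notation mR := (measurableTypeR R).
Local Notation P := (mR * mR)%type.
Local Notation mu := (@lebesgue_measure R).
Local Open Scope ereal_scope.

Lemma continuous_abs_measurable (f : R -> R) : continuous f ->
  measurable_fun [set: mR] (fun t => `|f t|%:E).
Proof.
by move=> cf; apply/measurable_EFinP; apply: measurableT_comp => //; exact: continuous_measurable_fun.
Qed.

Lemma derive_osc (f f' : R -> R) (a b x y : R) :
  (forall t, is_derive t (1%R : R) f (f' t)) -> continuous f' ->
  (a <= x <= b)%R -> (a <= y <= b)%R ->
  (f x - f y)%:E <= \int[mu]_(t in `[a, b]) `|f' t|%:E.
Proof.
move=> df cf' /andP[ax xb] /andP[ay yb].
have sub (p q : R) : (p < q)%R -> (a <= p)%R -> (q <= b)%R ->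
    `|(f q - f p)%:E| <= \int[mu]_(t in `[a, b]) `|f' t|%:E.
  move=> pq ap qb; rewrite -(FTC2_everywhere pq df cf').
  have mf' : measurable_fun (`[p, q]%classic : set mR) (fun t : mR => (f' t)%:E).
    by apply: measurable_funTS; apply/measurable_EFinP; exact: continuous_measurable_fun.
  apply: (le_trans (le_abse_integral mu (measurable_itv _) mf')).
  apply: ge0_subset_integral => //.
  - by apply: measurable_funTS; exact: continuous_abs_measurable.
  - by move=> t /=; rewrite !in_itv/= => /andP[? ?]; apply/andP; split; lra.
have [xy|yx|->] := ltgtP x y.
- apply: le_trans (sub _ _ xy ax yb); rewrite lee_fin.
  by rewrite distrC ler_norm.
- by apply: le_trans (sub _ _ yx ay xb); rewrite lee_fin ler_norm.
- by rewrite subrr; exact: integral_ge0.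
Qed.

(** The value at [y] is at most the value at [t] plus the oscillation; average
    over [t]. *)
Lemma line_sup (F F' : R -> R) (a b y : R) : (a < b)%R -> (a <= y <= b)%R ->
  (forall t, is_derive t (1%R : R) F (F' t)) -> continuous F' -> (forall t, 0 <= F t)%R ->
  ((b - a) * F y)%:E <= \int[mu]_(t in `[a, b]) (F t)%:E + (b - a)%:E * \int[mu]_(t in `[a, b]) `|F' t|%:E.
Proof.
move=> ab yab dF cF' F0; have cF := is_derive_continuous dF.
set c := \int[mu]_(t in `[a, b]) `|F' t|%:E.
have c0 : 0 <= c by exact: integral_ge0.
have [cfin|] := ltP c +oo; last first.
  rewrite leye_eq => /eqP ->; rewrite gt0_muley ?lte_fin ?subr_gt0//.
  rewrite addey ?leey// gt_eqF//; apply: (@lt_le_trans _ _ 0); first exact: ltNy0.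
  by apply: integral_ge0 => t _; rewrite lee_fin.
have cf : c \is a fin_num by rewrite ge0_fin_numE.
rewrite -(fineK cf).
have mF : measurable_fun [set: mR] F by exact: continuous_measurable_fun.
have mI : measurable (`[a, b]%classic : set mR) by exact: measurable_itv.
have -> : ((b - a) * F y)%:E = \int[mu]_(t in `[a, b]) (F y)%:E.
  by rewrite integral_cst//= lebesgue_measure_itv/= lte_fin ab -EFinB -EFinM mulrC.
have -> : \int[mu]_(t in `[a, b]) (F t)%:E + (b - a)%:E * (fine c)%:E =
   \int[mu]_(t in `[a, b]) ((F t)%:E + (fine c)%:E).
  rewrite ge0_integralD//.
  - by congr (_ + _); rewrite integral_cst//= lebesgue_measure_itv/= lte_fin ab -EFinB muleC.
  - by move=> t _; rewrite lee_fin.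
  - by apply: measurable_funTS; exact/measurable_EFinP.
  - by move=> t _; rewrite lee_fin fine_ge0.
apply: ge0_le_integral => //.
- by move=> t _; rewrite lee_fin.
- by apply: emeasurable_funD => //; apply: measurable_funTS; exact/measurable_EFinP.
- move=> t; rewrite /= in_itv/= => tab; rewrite fineK//.
  have := derive_osc dF cF' yab tab; rewrite -/c -(fineK cf) -EFinD !lee_fin; lra.
Qed.

Lemma exists_small_value (H : mR -> \bar R) (a b E m : R) : (a < b)%R -> measurable_fun setT H ->
  (forall x, 0 <= H x) -> \int[mu]_(x in `[a, b]) H x <= E%:E -> (0 <= m)%R ->
  (E < m * (b - a))%R -> exists x, (a <= x <= b)%R /\ H x <= m%:E.
Proof.
move=> ab mH H0 HE m0 Em; apply: contrapT => no.
have : (m * (b - a))%:E <= E%:E.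
  apply: le_trans HE.
  rewrite (_ : (m * (b - a))%:E = \int[mu]_(x in `[a, b]) m%:E); last first.
    by rewrite integral_cst//= lebesgue_measure_itv/= lte_fin ab -EFinB -EFinM.
  apply: ge0_le_integral => //; first exact: measurable_funTS.
  move=> x; rewrite /= in_itv/= => xab; rewrite leNgt; apply/negP => Hx.
  by apply: no; exists x; split=> //; exact: ltW.
by rewrite lee_fin leNgt Em.
Qed.

Lemma tonelli_rect (f : P -> \bar R) (a b c d : R) : measurable_fun setT f -> (forall x, 0 <= f x) ->
  \int[leb2]_(x in rect a b c d) f x = \int[mu]_(x1 in `[a, b]) \int[mu]_(x2 in `[c, d]) f (x1, x2) /\
  \int[leb2]_(x in rect a b c d) f x = \int[mu]_(x2 in `[c, d]) \int[mu]_(x1 in `[a, b]) f (x1, x2).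
Proof.
move=> mf f0.
have mfr : measurable_fun setT (f \_ (rect a b c d)).
  apply/(measurable_restrictT _ _).1; first exact: measurable_rect.
  exact: measurable_funTS.
have fr0 x : 0 <= (f \_ (rect a b c d)) x by rewrite patchE; case: ifP.
have mI (p q : R) : measurable (`[p, q]%classic : set mR) by exact: measurable_itv.
have prE x1 x2 : (f \_ (rect a b c d)) (x1, x2) =
   if (x1 \in `[a, b]%classic) && (x2 \in `[c, d]%classic) then f (x1, x2) else 0.
  rewrite patchE; congr (if _ then _ else _).
  by apply/idP/andP; rewrite !inE /rect.
split; rewrite planarE integral_mkcond.
- rewrite (@fubini_tonelli1 _ _ _ _ R mu mu (f \_ (rect a b c d))); [|exact: mfr|exact: fr0].
  rewrite [RHS]integral_mkcond; apply: eq_integral => x1 _.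
  rewrite /fubini_F patchE; case: ifPn => h.
    by rewrite [RHS]integral_mkcond; apply: eq_integral => x2 _; rewrite prE h patchE.
  by rewrite (eq_integral (cst 0)) ?integral0// => x2 _; rewrite prE (negbTE h).
- rewrite (@fubini_tonelli2 _ _ _ _ R mu mu (f \_ (rect a b c d))); [|exact: mfr|exact: fr0].
  rewrite [RHS]integral_mkcond; apply: eq_integral => x2 _.
  rewrite /fubini_G patchE; case: ifPn => h.
    by rewrite [RHS]integral_mkcond; apply: eq_integral => x1 _; rewrite prE h andbT patchE.
  by rewrite (eq_integral (cst 0)) ?integral0// => x1 _; rewrite prE (negbTE h) andbF.
Qed.

End Lines.

(** * Elliptic matrices *)

Section Algebra2.
Context {R : realType}.
Implicit Types (a : 'M[R]_2).

(** The bilinear form of a symmetric matrix at the vectors [(p, q)] and [(p',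
    q')]. *)
Definition bil a (p q p' q' : R) : R :=
  a 0 0 * p * p' + a 0 1 * (p * q' + q * p') + a 1 1 * q * q'.

Definition elliptic (nu Lam : R) a : Prop :=
  forall p q : R, nu * (p ^+ 2 + q ^+ 2) <= bil a p q p q <= Lam * (p ^+ 2 + q ^+ 2).

Lemma dotE (y z : 'cV[R]_2) : dot y z = y 0 0 * z 0 0 + y 1 0 * z 1 0.
Proof.
rewrite /dot !big_ord_recl big_ord0 addr0.
by rewrite (_ : lift ord0 ord0 = 1)//; apply: val_inj.
Qed.

Lemma dot_bil a (z w : 'cV[R]_2) : a^T = a ->
  dot (a *m z) w = bil a (z 0 0) (z 1 0) (w 0 0) (w 1 0).
Proof.
move=> aT; have a10 : a 1 0 = a 0 1 by rewrite -{1}aT mxE.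
have mE i : (a *m z) i 0 = a i 0 * z 0 0 + a i 1 * z 1 0.
  rewrite mxE !big_ord_recl big_ord0 addr0.
  by rewrite (_ : lift ord0 ord0 = 1)//; apply: val_inj.
by rewrite dotE !mE a10 /bil; ring.
Qed.

Lemma elliptic_of_dot nu Lam a : a^T = a ->
  (forall z : 'cV[R]_2, nu * dot z z <= dot (a *m z) z <= Lam * dot z z) -> elliptic nu Lam a.
Proof.
move=> aT H p q; pose z : 'cV[R]_2 := \col_i (if i == 0 then p else q).
have := H z; rewrite dot_bil// dotE.
have z0 : z 0 0 = p by rewrite mxE.
have z1 : z 1 0 = q by rewrite mxE.
by rewrite z0 z1 !expr2.
Qed.

Section Elliptic.
Variables (nu Lam : R) (a : 'M[R]_2).
Hypotheses (nu0 : 0 < nu) (ell : elliptic nu Lam a).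

Let bil_ge0 p q : 0 <= bil a p q p q.
Proof.
have /andP[h _] := ell p q; apply: le_trans h.
by rewrite mulr_ge0 ?addr_ge0 ?sqr_ge0// ltW.
Qed.

(** The form is nonnegative at [z - tau z'] and at [z + tau z']. *)
Lemma bil_young (tau p q p' q' : R) : 0 < tau ->
  `|bil a p q p' q'| <= Lam / 2 * ((p ^+ 2 + q ^+ 2) / tau + tau * (p' ^+ 2 + q' ^+ 2)).
Proof.
move=> t0; have /andP[_ h1] := ell p q; have /andP[_ h2] := ell p' q'.
have h3 := bil_ge0 (p - tau * p') (q - tau * q').
have h4 := bil_ge0 (p + tau * p') (q + tau * q').
have ti0 : 0 < tau^-1 by rewrite invr_gt0.
have e1 : bil a p q p q / tau <= Lam * ((p ^+ 2 + q ^+ 2) / tau).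
  by rewrite mulrA; apply: ler_wpM2r => //; exact: ltW.
have e2 : tau * bil a p' q' p' q' <= Lam * (tau * (p' ^+ 2 + q' ^+ 2)).
  by rewrite mulrCA; apply: ler_wpM2l => //; exact: ltW.
have e3 : 0 <= bil a p q p q / tau - 2 * bil a p q p' q' + tau * bil a p' q' p' q'.
  rewrite (_ : _ + _ = bil a (p - tau * p') (q - tau * q') (p - tau * p') (q - tau * q') / tau).
    by rewrite divr_ge0// ltW.
  by rewrite /bil; field; rewrite gt_eqF.
have e4 : 0 <= bil a p q p q / tau + 2 * bil a p q p' q' + tau * bil a p' q' p' q'.
  rewrite (_ : _ + _ = bil a (p + tau * p') (q + tau * q') (p + tau * p') (q + tau * q') / tau).
    by rewrite divr_ge0// ltW.
  by rewrite /bil; field; rewrite gt_eqF.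
rewrite ler_norml; apply/andP; split; lra.
Qed.

(** The difference of the two sides is the determinant of [a] times [(p q' - q
    p')^2]. *)
Lemma bil_cauchy p q p' q' :
  bil a p q p' q' ^+ 2 <= bil a p q p q * bil a p' q' p' q'.
Proof.
have /andP[h1 _] := ell 1 0; have /andP[h2 _] := ell (- a 0 1) (a 0 0).
have a0 : 0 < a 0 0.
  move: h1; rewrite /bil expr1n expr0n/= !(mulr0, mulr1, addr0, mul0r); exact: lt_le_trans.
have det0 : 0 <= a 0 0 * a 1 1 - a 0 1 ^+ 2.
  rewrite -(pmulr_rge0 _ a0).
  have : 0 <= bil a (- a 0 1) (a 0 0) (- a 0 1) (a 0 0) by exact: bil_ge0.
  rewrite (_ : bil _ _ _ _ _ = a 0 0 * (a 0 0 * a 1 1 - a 0 1 ^+ 2))//.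
  by rewrite /bil; ring.
rewrite -subr_ge0 (_ : _ - _ = (a 0 0 * a 1 1 - a 0 1 ^+ 2) * (p * q' - q * p') ^+ 2).
  by rewrite mulr_ge0// sqr_ge0.
by rewrite /bil; ring.
Qed.

(** This is the weak inequality tested with [e^2 theta(u)], read at one point:
    [t] is [theta(u)], [dt] is [theta'(u)], [w] is [u_+], and [(p, q)], [(e1,
    e2)] are the gradients of [u] and of the cut-off [e]. The cross term is
    absorbed by the Cauchy--Schwarz inequality for the form of [a] and [t^2 <=
    dt w^2]. *)
Lemma caccioppoli_pointwise (e t dt w p q e1 e2 : R) :
  0 <= dt -> t ^+ 2 <= dt * w ^+ 2 ->
  nu / 2 * (e ^+ 2 * dt * (p ^+ 2 + q ^+ 2)) <=
  bil a p q (e ^+ 2 * (dt * p) + t * (2 * e * e1)) (e ^+ 2 * (dt * q) + t * (2 * e * e2))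
  + 2 * Lam * (w ^+ 2 * (e1 ^+ 2 + e2 ^+ 2)).
Proof.
move=> dt0 tw.
have /andP[h1 _] := ell p q; have /andP[_ h2] := ell e1 e2.
have cs := bil_cauchy p q e1 e2.
have qu0 := bil_ge0 p q; have qe0 := bil_ge0 e1 e2.
rewrite (_ : bil a p q _ _ = e ^+ 2 * dt * bil a p q p q + 2 * e * t * bil a p q e1 e2); last by rewrite /bil; ring.
set Q1 := bil a p q p q in h1 cs qu0 *; set Q2 := bil a e1 e2 e1 e2 in h2 cs qe0 *.
set A := bil a p q e1 e2 in cs *.
have X0 : 0 <= e ^+ 2 * dt * Q1 by apply: mulr_ge0 => //; apply: mulr_ge0 => //; exact: sqr_ge0.
have Y0 : 0 <= w ^+ 2 * Q2 by apply: mulr_ge0 => //; exact: sqr_ge0.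
have key : - (2 * e * t * A) <= e ^+ 2 * dt * Q1 / 2 + 2 * (w ^+ 2 * Q2).
  apply: (le_trans (ler_norm _)); rewrite normrN.
  rewrite -ler_sqr ?nnegrE//; last by apply: addr_ge0; [apply: divr_ge0|apply: mulr_ge0].
  rewrite real_normK ?num_real//.
  apply: (@le_trans _ _ (4 * ((e ^+ 2 * dt * Q1 / 2) * (2 * (w ^+ 2 * Q2))))).
    rewrite (_ : (2 * e * t * A) ^+ 2 = 4 * e ^+ 2 * (t ^+ 2 * A ^+ 2)); last ring.
    rewrite [leRHS](_ : _ = 4 * e ^+ 2 * ((dt * w ^+ 2) * (Q1 * Q2))); last by field.
    by apply: ler_wpM2l; [apply: mulr_ge0 => //; exact: sqr_ge0|apply: ler_pM; rewrite ?sqr_ge0].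
  set X := _ / 2; set Y := 2 * (w ^+ 2 * Q2).
  by rewrite -subr_ge0 (_ : _ - _ = (X - Y) ^+ 2) ?sqr_ge0//; ring.
have k2 : e ^+ 2 * dt * (nu * (p ^+ 2 + q ^+ 2)) <= e ^+ 2 * dt * Q1.
  by apply: ler_wpM2l => //; apply: mulr_ge0 => //; exact: sqr_ge0.
have k3 : w ^+ 2 * Q2 <= w ^+ 2 * (Lam * (e1 ^+ 2 + e2 ^+ 2)).
  by apply: ler_wpM2l => //; rewrite sqr_ge0.
lra.
Qed.

End Elliptic.
End Algebra2.

(** * The weak inequality for a smooth approximation *)

Section Energy.
Context {R : realType}.
Local Notation mR := (measurableTypeR R).
Local Notation P := (mR * mR)%type.

Lemma measurable_on_sub (B Q : set (R * R)) (f : R * R -> R) :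
  measurable (B : set P) -> measurable (Q : set P) -> Q `<=` B ->
  measurable_fun [set: P] (f \_ B) -> measurable_fun (Q : set P) (f : P -> mR).
Proof.
move=> mB mQ QB mf; apply: (measurable_funS mB QB).
exact/(measurable_restrictT f mB).
Qed.

Lemma Lp2_integrable_on (B Q : set (R * R)) f : measurable (B : set P) -> (leb2 (B : set P) < +oo)%E ->
  measurable (Q : set P) -> Q `<=` B -> Lp_on B 2%:E f ->
  leb2.-integrable (Q : set P) (EFin \o (fun x => f x ^+ 2)).
Proof.
move=> mB Bfin mQ QB fL; have [mf f2 fi] := Lp2_restrict mB Bfin fL.
have mfQ := measurable_on_sub mB mQ QB mf.
apply/integrableP; split; first by apply/measurable_EFinP; exact: measurable_funX.
apply: le_lt_trans f2.
apply: (@le_trans _ _ (\int[leb2]_(x in (Q : set P)) ((f \_ B) x ^+ 2)%:E)%E).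
  rewrite le_eqVlt; apply/orP; left; apply/eqP; apply: eq_integral => x; rewrite inE => Qx.
  by rewrite /= ger0_norm ?sqr_ge0// patchE mem_set//; exact: QB.
apply: ge0_subset_integral => //.
  by apply/measurable_EFinP; exact: measurable_funX.
by move=> x _; rewrite lee_fin sqr_ge0.
Qed.

Lemma continuous_bounded_rect (f : R * R -> R) (a b c d : R) : continuous f ->
  exists2 M : R, 0 <= M & forall x, rect a b c d x -> `|f x| <= M.
Proof.
move=> cf; have : bounded_set (f @` rect a b c d).
  apply: compact_bounded; apply: continuous_compact; last exact: compact_rect.
  exact: continuous_subspaceT.
move=> [M [Mr H]]; exists (`|M| + 1); first by rewrite addr_ge0.
move=> x Qx; apply: (H (`|M| + 1)); last by exists x.
by apply: (le_lt_trans (ler_norm _)); rewrite ltrDl.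
Qed.

Lemma continuous_integrable_rect (f : R * R -> R) (a b c d : R) : continuous f ->
  leb2.-integrable (rect a b c d : set P) (EFin \o f).
Proof.
move=> cf; have [M M0 fM] := continuous_bounded_rect a b c d cf.
have mQ := measurable_rect a b c d.
apply/integrableP; split.
  by apply/measurable_EFinP; apply: measurable_funTS; exact: continuous_measurable2.
apply: (@le_lt_trans _ _ (\int[leb2]_(x in (rect a b c d : set P)) M%:E)%E).
  apply: ge0_le_integral => //.
  - apply/measurable_EFinP; apply: measurable_funTS; apply: measurableT_comp => //.
    exact: continuous_measurable2.
by rewrite integral_cst// lte_mul_pinfty ?lee_fin//; exact: leb2_rect_fin.
Qed.

Lemma integrable_sq_rect (f : R * R -> R) (a b c d : R) : continuous f ->
  leb2.-integrable (rect a b c d : set P) (EFin \o (fun x => f x ^+ 2)).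
Proof.
move=> cf; apply: (@continuous_integrable_rect (fun x => f x ^+ 2)) => x.
by apply: (@continuous_comp _ _ _ f (fun t => t ^+ 2)); [exact: cf|exact: exprn_continuous].
Qed.

(** The weak inequality for [g] becomes one for the smooth vector field [(u1,
    u2)] at the cost of [a (grad u - g) . grad phi], which Young's inequality
    splits with weight [tau]: the first part is small if the field is close to
    [g] on the scale [tau], the second one if [tau] is small. [Pf] is the
    quantity to be estimated, and [Sf] collects the terms of lower order. *)
Lemma energy (B : set (R * R)) (nu Lam : R) (a : R * R -> 'M[R]_2) (g : R * R -> 'cV[R]_2)
    (qa qb qc qd : R) (phi phi1 phi2 u1 u2 : R * R -> R) (tau : R) (Pf Sf : R * R -> R) :
  let Q := rect qa qb qc qd in
  measurable (B : set P) -> (leb2 (B : set P) < +oo)%E -> Q `<=` B ->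
  0 < nu -> bounded_elliptic B nu Lam a -> (forall i, Lp_on B 2%:E (fun x => g x i 0)) ->
  \int[leb2]_(x in B) dot (a x *m g x) (grad phi x) <= 0 ->
  C1 phi phi1 phi2 -> (forall x, ~ Q x -> phi x = 0) ->
  continuous u1 -> continuous u2 -> 0 < tau -> 0 <= Lam ->
  measurable_fun [set: P] (Pf : P -> mR) -> measurable_fun (Q : set P) (Sf : P -> mR) ->
  (forall x, 0 <= Pf x) -> (forall x, 0 <= Sf x) ->
  (forall x, Q x -> elliptic nu Lam (a x) ->
     Pf x <= bil (a x) (u1 x) (u2 x) (phi1 x) (phi2 x) + Sf x) ->
  (\int[leb2]_(x in Q) (Pf x)%:E <=
   \int[leb2]_(x in Q) (Sf x + Lam / 2 * (((u1 x - g x 0 0) ^+ 2 + (u2 x - g x 1 0) ^+ 2) / tau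
      + tau * (phi1 x ^+ 2 + phi2 x ^+ 2)))%:E)%E.
Proof.
move=> Q mB Bfin QB nu0 [aL asym aell] gL hle Cphi phiQ c1 c2 tau0 Lam0 mP mS P0 S0 PS.
have mQ : measurable (Q : set P) by exact: measurable_rect.
have [cp1 cp2 _] := Cphi.
(* Symmetry and ellipticity hold off a null set, which is removed from the
   domain of integration. *)
have [N [mN N0 sN]] : {ae leb2, forall x, B x -> (a x)^T = a x /\ elliptic nu Lam (a x)}.
  have [N1 [mN1 N10 sN1]] := asym; have [N2 [mN2 N20 sN2]] := aell.
  exists (N1 `|` N2); split; [exact: measurableU|by rewrite null_set_setU|].
  move=> x /= nx; apply: contrapT => /not_orP[n1 n2]; apply: nx => Bx.
  have s1 : (a x)^T = a x by apply: contrapT => s; apply: n1; apply: sN1 => /(_ Bx).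
  split => //; apply: elliptic_of_dot => //.
  by apply: contrapT => s; apply: n2; apply: sN2 => /(_ Bx).
have good x : Q x -> ~ N x -> (a x)^T = a x /\ elliptic nu Lam (a x).
  move=> Qx Nx; suff : B x -> (a x)^T = a x /\ elliptic nu Lam (a x) by apply; exact: QB.
  by apply: contrapT => s; apply: Nx; apply: sN.
have mD : measurable (Q `\` N : set P) by exact: measurableD.
have mg i : measurable_fun (Q : set P) (fun x : P => g x i 0 : mR).
  by have [m _ _] := Lp2_restrict mB Bfin (gL i); exact: measurable_on_sub m.
have ma i j : measurable_fun (Q : set P) (fun x : P => a x i j : mR).
  have := aL i j; rewrite /Lp_on inE => /andP[]; rewrite inE /= => m _.
  exact: measurable_on_sub m.
have mcont (f : R * R -> R) : continuous f -> measurable_fun (Q : set P) (f : P -> mR).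
  by move=> cf; apply: measurable_funTS; exact: continuous_measurable2.
pose h (x : P) := (a x 0 0 * g x 0 0 + a x 0 1 * g x 1 0) * phi1 x
   + (a x 1 0 * g x 0 0 + a x 1 1 * g x 1 0) * phi2 x.
have hE x : dot (a x *m g x) (grad phi x) = h x.
  have mE i : (a x *m g x) i 0 = a x i 0 * g x 0 0 + a x i 1 * g x 1 0.
    rewrite mxE !big_ord_recl big_ord0 addr0.
    by rewrite (_ : lift ord0 ord0 = 1)//; apply: val_inj.
  by rewrite dotE !mE (C1_grad0 _ Cphi) (C1_grad1 _ Cphi).
have mh : measurable_fun (Q : set P) (h : P -> mR).
  by apply: measurable_funD; (apply: measurable_funM; last exact: mcont);
    apply: measurable_funD; apply: measurable_funM; first [exact: ma|exact: mg].
have phi0 x : ~ Q x -> phi1 x = 0 /\ phi2 x = 0.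
  move=> Qx; apply: (C1_near0 Cphi).
  have : nbhs x (~` Q).
    by apply: open_nbhs_nbhs; split => //; apply: closed_openC; exact: closed_rect.
  by apply: filterS => y; exact: phiQ.
have hQ : \int[leb2]_(x in B) dot (a x *m g x) (grad phi x) = \int[leb2]_(x in Q) h x.
  rewrite Rintegral_mkcond [RHS]Rintegral_mkcond; apply: eq_Rintegral => x _.
  rewrite /patch; case: ifPn => xB; case: ifPn => xQ //.
  - move: xQ; rewrite notin_setE => /phi0[p1 p2].
    by rewrite hE /h p1 p2 !mulr0 addr0.
  - by move: xB; rewrite notin_setE => nB; exfalso; apply: nB; apply: QB; rewrite inE in xQ.
have hbil x : Q x -> ~ N x -> h x = bil (a x) (g x 0 0) (g x 1 0) (phi1 x) (phi2 x).
  by move=> Qx /(good x Qx)[s _]; rewrite -hE dot_bil// (C1_grad0 _ Cphi) (C1_grad1 _ Cphi).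
have ig i := Lp2_integrable_on mB Bfin mQ QB (gL i).
have ip1 := integrable_sq_rect qa qb qc qd cp1.
have ip2 := integrable_sq_rect qa qb qc qd cp2.
have ib : leb2.-integrable (Q : set P)
    (fun x => (Lam / 2)%:E * (((g x 0 0 ^+ 2)%:E + (g x 1 0 ^+ 2)%:E) + ((phi1 x ^+ 2)%:E + (phi2 x ^+ 2)%:E)))%E.
  apply: integrableZl => //; apply: integrableD => //; apply: integrableD => //; [exact: (ig 0)|exact: (ig 1)].
have ihD : leb2.-integrable (Q `\` N : set P) (EFin \o h).
  apply: (@le_integrable _ _ _ leb2 _ mD _ _ _ _ (integrableS mQ mD (@subDsetl _ Q N) ib)).
    by apply/measurable_EFinP; exact: measurable_funS mh.
  move=> x [Qx Nx]; rewrite /= lee_fin hbil//.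
  have [_ el] := good x Qx Nx.
  apply: le_trans (ler_norm _).
  by have := bil_young nu0 el (g x 0 0) (g x 1 0) (phi1 x) (phi2 x) ltr01; rewrite divr1 mul1r.
have ihQ : leb2.-integrable (Q : set P) (EFin \o h).
  by apply/(negligible_integrable mN mQ _ N0); first exact/measurable_EFinP.
have h0 : (\int[leb2]_(x in (Q `\` N : set P)) (h x)%:E <= 0)%E.
  rewrite -(negligible_integral mN mQ ihQ N0).
  rewrite -(fineK (integrable_fin_num mQ ihQ)) lee_fin.
  by move: hle; rewrite hQ.
pose T (x : R * R) := Sf x + Lam / 2 * (((u1 x - g x 0 0) ^+ 2 + (u2 x - g x 1 0) ^+ 2) / tau
      + tau * (phi1 x ^+ 2 + phi2 x ^+ 2)).
rewrite -[X in (_ <= X)%E]/(\int[leb2]_(x in (Q : set P)) (T x)%:E)%E.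
have T0 x : 0 <= T x.
  rewrite /T addr_ge0// mulr_ge0 ?divr_ge0// addr_ge0//.
    by rewrite divr_ge0 ?addr_ge0 ?sqr_ge0// ltW.
  by rewrite mulr_ge0 ?addr_ge0 ?sqr_ge0// ltW.
have mT : measurable_fun (Q : set P) (T : P -> mR).
  apply: measurable_funD => //; apply: measurable_funM => //; apply: measurable_funD; apply: measurable_funM => //.
    by apply: measurable_funD; apply: measurable_funX; apply: measurable_funB; first [exact: mcont|exact: mg].
  by apply: measurable_funD; apply: measurable_funX; exact: mcont.
have PhT x : Q x -> ~ N x -> Pf x <= h x + T x.
  move=> Qx Nx; have [_ el] := good x Qx Nx.
  have := PS x Qx el; rewrite hbil// /T => p1.
  have := bil_young nu0 el (u1 x - g x 0 0) (u2 x - g x 1 0) (phi1 x) (phi2 x) tau0.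
  move=> /(le_trans (ler_norm _)); set Y := Lam / 2 * _.
  rewrite (_ : bil (a x) (u1 x - _) _ _ _ = bil (a x) (u1 x) (u2 x) (phi1 x) (phi2 x) - bil (a x) (g x 0 0) (g x 1 0) (phi1 x) (phi2 x)).
    lra.
  by rewrite /bil; ring.
rewrite (ge0_negligible_integral mN mQ _ _ N0)//; last 2 first.
- by apply: measurable_funTS; exact/measurable_EFinP.
- by move=> x _; rewrite lee_fin.
apply: (@le_trans _ _ (\int[leb2]_(x in (Q `\` N : set P)) (T x)%:E)%E); last first.
  apply: ge0_subset_integral => //; first exact/measurable_EFinP.
  by move=> x _; rewrite lee_fin.
have [Tfin|] := ltP (\int[leb2]_(x in (Q `\` N : set P)) (T x)%:E)%E +oo%E; last first.
  by rewrite leye_eq => /eqP ->; rewrite leey.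
have mTD : measurable_fun (Q `\` N : set P) (EFin \o T).
  by apply/measurable_EFinP; exact: measurable_funS mT.
have iT : leb2.-integrable (Q `\` N : set P) (EFin \o T).
  apply/integrableP; split => //.
  by under eq_integral do rewrite /= ger0_norm//.
apply: (@le_trans _ _ (\int[leb2]_(x in (Q `\` N : set P)) ((EFin \o h) x + (EFin \o T) x))%E).
  apply: ge0_le_integral => //.
  - by move=> x _; rewrite lee_fin.
  - by apply: measurable_funTS; exact/measurable_EFinP.
  - apply: emeasurable_funD => //; exact: measurable_int ihD.
  - by move=> x [Qx Nx]; rewrite /= -EFinD lee_fin; exact: PhT.
by rewrite integralD// -[leRHS]add0e leeD2r.
Qed.

End Energy.

(** * Bounds of integrals and cut-off functions *)

Section IntBound.
Context {R : realType}.
Local Notation mR := (measurableTypeR R).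
Local Notation P := (mR * mR)%type.
Variable D : set P.
Hypothesis mD : measurable D.
Implicit Types (f g : R * R -> R).

(** Bundling measurability, positivity and the bound lets an integral estimate
    be deduced from a pointwise one in a single step. *)
Definition int_bound f (A : R) : Prop :=
  [/\ measurable_fun D (f : P -> mR), forall x, D x -> 0 <= f x &
      (\int[leb2]_(x in D) (f x)%:E <= A%:E)%E].

Lemma int_bound_add f g A B : int_bound f A -> int_bound g B ->
  int_bound (fun x => f x + g x) (A + B).
Proof.
move=> [mf f0 fA] [mg g0 gB]; split.
- exact: measurable_funD.
- by move=> x Dx; rewrite addr_ge0 ?f0 ?g0.
- under eq_integral do rewrite EFinD.
  rewrite ge0_integralD//.
  + by rewrite EFinD; exact: leeD.
  + exact/measurable_EFinP.
  + exact/measurable_EFinP.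
Qed.

Lemma int_bound_scale (a : R) f A : 0 <= a -> int_bound f A -> int_bound (fun x => a * f x) (a * A).
Proof.
move=> a0 [mf f0 fA]; split.
- exact: measurable_funM.
- by move=> x Dx; rewrite mulr_ge0 ?f0.
- under eq_integral do rewrite EFinM.
  rewrite ge0_integralZl_EFin//.
  + by rewrite EFinM lee_wpmul2l.
  + exact/measurable_EFinP.
Qed.

Lemma int_bound_le f g A : int_bound g A -> measurable_fun D (f : P -> mR) ->
  (forall x, D x -> 0 <= f x) -> (forall x, D x -> f x <= g x) -> int_bound f A.
Proof.
move=> [mg g0 gA] mf f0 fg; split => //; apply: le_trans gA.
apply: ge0_le_integral => //.
- exact/measurable_EFinP.
- exact/measurable_EFinP.
Qed.

Lemma int_bound_weak f A B : A <= B -> int_bound f A -> int_bound f B.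
Proof. by move=> AB [mf f0 fA]; split => //; apply: le_trans fA _; rewrite lee_fin. Qed.

Lemma int_bound_ge0 f A : int_bound f A -> 0 <= A.
Proof.
move=> [mf f0 fA]; rewrite -lee_fin; apply: le_trans fA.
by apply: integral_ge0 => x Dx; rewrite lee_fin f0.
Qed.

End IntBound.

Section IntBoundSub.
Context {R : realType}.
Local Notation mR := (measurableTypeR R).
Local Notation P := (mR * mR)%type.

Lemma int_bound_sub (D D' : set P) (f : R * R -> R) A : measurable D -> measurable D' ->
  D' `<=` D -> int_bound D f A -> int_bound D' f A.
Proof.
move=> mD mD' DD [mf f0 fA]; split; first exact: measurable_funS mf.
  by move=> x /DD/f0.
apply: le_trans fA; apply: ge0_subset_integral => //; first exact/measurable_EFinP.
Qed.

Lemma int_bound_cst (a b c d A : R) : a <= b -> c <= d -> 0 <= A ->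
  int_bound (rect a b c d) (fun=> A) (A * ((b - a) * (d - c))).
Proof.
move=> ab cd A0; split => //.
by rewrite integral_cst ?leb2_rect//; exact: measurable_rect.
Qed.

End IntBoundSub.

Section Cutoff.
Context {R : realType}.
Variable s : R.
Hypothesis s0 : 0 < s.

Definition bump (t : R) : R := sqpos (1 - (t / s) ^+ 2).
Definition dbump (t : R) : R := 2 * pos (1 - (t / s) ^+ 2) * (- 2 * t / s ^+ 2).

Lemma bump_derive t : is_derive t (1 : R) bump (dbump t).
Proof.
apply: is_diff_is_derive.
have /is_derive_is_diff d1 : is_derive t (1 : R) (fun t => 1 - (t / s) ^+ 2) (- 2 * t / s ^+ 2).
  apply: (@is_derive_quadratic R _ _ (s^-1 ^+ 2)) => h.
  rewrite (_ : _ - _ - _ = - (s^-1 ^+ 2 * h ^+ 2)); last by field; rewrite gt_eqF.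
  have h0 : 0 <= s^-1 ^+ 2 * h ^+ 2 by apply: mulr_ge0; exact: sqr_ge0.
  by rewrite normrN real_normK ?num_real// ger0_norm.
have /is_derive_is_diff d2 := sqpos_derive (1 - (t / s) ^+ 2).
rewrite -[bump]/(sqpos \o (fun t => 1 - (t / s) ^+ 2)).
by apply: is_diff_eq; apply/funext => h /=; rewrite /dbump; ring.
Qed.

Lemma dbump_continuous : continuous dbump.
Proof.
have c1 : continuous (fun t : R => 1 - (t / s) ^+ 2).
  move=> t; rewrite /continuous_at expr2; under eq_fun do rewrite expr2.
  by apply: cvgB; [exact: cvg_cst|apply: cvgM; (apply: cvgM; [exact: cvg_id|exact: cvg_cst])].
have c2 : continuous (pos \o (fun t : R => 1 - (t / s) ^+ 2)).
  by move=> t; apply: continuous_comp; [exact: c1|exact: pos_continuous].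
move=> t; apply: cvgM; first by apply: cvgM; [exact: cvg_cst|exact: c2].
by apply: cvgM; [apply: cvgM; [exact: cvg_cst|exact: cvg_id]|exact: cvg_cst].
Qed.

Lemma bump_bounds t : 0 <= bump t <= 1.
Proof.
rewrite /bump /sqpos sqr_ge0/=; have h := sqr_ge0 (t / s).
by case: (posP (1 - (t / s) ^+ 2)) => -[h1 ->]; [rewrite expr0n|rewrite expr_le1//; lra].
Qed.

Lemma bump_out t : s <= `|t| -> bump t = 0 /\ dbump t = 0.
Proof.
move=> ts; rewrite /bump /dbump /sqpos.
have -> : pos (1 - (t / s) ^+ 2) = 0.
  have h : 1 <= (t / s) ^+ 2.
    rewrite -[(t / s) ^+ 2]real_normK ?num_real// normrM normfV (gtr0_norm s0).
    by rewrite exprn_ege1// ler_pdivlMr// mul1r.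
  by case: (posP (1 - (t / s) ^+ 2)) => -[h1 ->] //; lra.
by rewrite expr0n mulr0 mul0r.
Qed.

Lemma dbump_bound t : `|dbump t| <= 4 / s.
Proof.
have [ts|ts] := leP s `|t|.
  by rewrite (bump_out ts).2 normr0 divr_ge0// ltW.
rewrite /dbump !normrM.
have p1 : `|pos (1 - (t / s) ^+ 2)| <= 1.
  rewrite ger0_norm ?pos_ge0//; have h := sqr_ge0 (t / s).
  by case: (posP (1 - (t / s) ^+ 2)) => -[h1 ->]; lra.
rewrite normfV (ger0_norm (exprn_ge0 2 (ltW s0))) normrN !normr_nat.
have t1 : `|t| / s ^+ 2 <= 1 / s.
  rewrite expr2 invfM mulrA; apply: ler_wpM2r; first by rewrite invr_ge0 ltW.
    by rewrite ler_pdivrMr// mul1r ltW.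
have n0 := normr_ge0 (pos (1 - (t / s) ^+ 2)).
have m0 : 0 <= `|t| / s ^+ 2 by rewrite divr_ge0// sqr_ge0.
rewrite (_ : 2 * _ * _ = 4 * (`|pos (1 - (t / s) ^+ 2)| * (`|t| / s ^+ 2))); last by ring.
apply: ler_wpM2l => //; apply: le_trans (ler_piMl m0 p1) _.
by rewrite -[s^-1]mul1r.
Qed.

Lemma bump_lower t : `|t| <= 3 / 4 * s -> 49 / 256 <= bump t.
Proof.
move=> ts; rewrite /bump /sqpos.
have h : (t / s) ^+ 2 <= 9 / 16.
  rewrite -[(t / s) ^+ 2]real_normK ?num_real// normrM normfV (gtr0_norm s0).
  rewrite (_ : 9 / 16 = (3 / 4) ^+ 2); last by field.
  rewrite ler_sqr ?nnegrE//; first by rewrite ler_pdivrMr.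
  by apply: divr_ge0 => //; exact: ltW.
case: (posP (1 - (t / s) ^+ 2)) => -[h1 ->]; first lra.
by nra.
Qed.

Variable z : R * R.
Definition eta (x : R * R) : R := bump (x.1 - z.1) * bump (x.2 - z.2).
Definition eta1 (x : R * R) : R := dbump (x.1 - z.1) * bump (x.2 - z.2).
Definition eta2 (x : R * R) : R := bump (x.1 - z.1) * dbump (x.2 - z.2).

Lemma C1_ext (u u1 u2 v1 v2 : R * R -> R) : C1 u u1 u2 -> u1 =1 v1 -> u2 =1 v2 -> C1 u v1 v2.
Proof. by move=> Cu /funext <- /funext <-. Qed.

Lemma is_derive_sub (a t : R) : is_derive t (1 : R) (fun t => t - a) 1.
Proof. by apply: is_derive_eq; rewrite subr0. Qed.

Lemma eta_C1 : C1 eta eta1 eta2.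
Proof.
have cc : continuous (fun _ : R => 1 : R) by exact: cst_continuous.
have b1 := C1_comp (C1_comp C1_fst (is_derive_sub z.1) cc) bump_derive dbump_continuous.
have b2 := C1_comp (C1_comp C1_snd (is_derive_sub z.2) cc) bump_derive dbump_continuous.
apply: C1_ext (C1_mul b1 b2) _ _ => x /=; rewrite /eta1 /eta2; ring.
Qed.

Lemma eta_bounds x : 0 <= eta x <= 1.
Proof.
rewrite /eta; have /andP[a0 a1] := bump_bounds (x.1 - z.1); have /andP[c0 c1] := bump_bounds (x.2 - z.2).
by rewrite mulr_ge0//= mulr_ile1.
Qed.

Lemma eta1_bound x : eta1 x ^+ 2 <= 16 / s ^+ 2.
Proof.
rewrite /eta1 -real_normK ?num_real// normrM (_ : 16 / s ^+ 2 = (4 / s) ^+ 2); last by field; rewrite gt_eqF.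
have /andP[c0 c1] := bump_bounds (x.2 - z.2).
have s4 : 0 <= 4 / s by apply: divr_ge0 => //; exact: ltW.
rewrite ler_sqr ?nnegrE// ?mulr_ge0// (ger0_norm c0).
by apply: le_trans (dbump_bound (x.1 - z.1)); rewrite ler_piMr.
Qed.

Lemma eta2_bound x : eta2 x ^+ 2 <= 16 / s ^+ 2.
Proof.
rewrite /eta2 -real_normK ?num_real// normrM (_ : 16 / s ^+ 2 = (4 / s) ^+ 2); last by field; rewrite gt_eqF.
have /andP[c0 c1] := bump_bounds (x.1 - z.1).
have s4 : 0 <= 4 / s by apply: divr_ge0 => //; exact: ltW.
rewrite ler_sqr ?nnegrE// ?mulr_ge0// (ger0_norm c0).
by apply: le_trans (dbump_bound (x.2 - z.2)); rewrite ler_piMl.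
Qed.

Lemma eta_out x : ~ rect (z.1 - s) (z.1 + s) (z.2 - s) (z.2 + s) x -> eta x = 0.
Proof.
move=> xQ; rewrite /eta.
have [h1|h1] := leP s `|x.1 - z.1|; first by rewrite (bump_out h1).1 mul0r.
have [h2|h2] := leP s `|x.2 - z.2|; first by rewrite (bump_out h2).1 mulr0.
exfalso; apply: xQ; apply/rectP; move: h1 h2; rewrite !ltr_norml => /andP[? ?] /andP[? ?].
by split; lra.
Qed.

Lemma eta_lower x : rect (z.1 - 3 / 4 * s) (z.1 + 3 / 4 * s) (z.2 - 3 / 4 * s) (z.2 + 3 / 4 * s) x ->
  1 / 1000 <= eta x ^+ 2.
Proof.
move=> /rectP[? ? ? ?].
(* [49 / 256] is [(1 - (3 / 4)^2)^2], the least value of the bump on the smaller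
   interval. *)
have b1 : 49 / 256 <= bump (x.1 - z.1) by apply: bump_lower; rewrite ler_norml; apply/andP; split; lra.
have b2 : 49 / 256 <= bump (x.2 - z.2) by apply: bump_lower; rewrite ler_norml; apply/andP; split; lra.
have q0 : 0 <= 49 / 256 :> R by lra.
have h : (49 / 256) ^+ 2 <= eta x by rewrite /eta expr2; exact: ler_pM.
have h2 : ((49 / 256) ^+ 2) ^+ 2 <= eta x ^+ 2.
  have q1 := sqr_ge0 (49 / 256 : R).
  by apply: (lerXn2r _ _ _ h); rewrite nnegrE; [exact: q1|exact: le_trans q1 h].
by apply: le_trans h2; lra.
Qed.

End Cutoff.

(** Squares come first, so that they are not split by [mulr_ge0]. *)
Ltac nneg := repeat first [assumption | by [] | exact: sqr_ge0 | apply: addr_ge0 | apply: divr_ge0 | apply: mulr_ge0 | exact: ltW].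

(** * Lines on which a function is small *)

Section Nearby.
Context {R : realType}.
Local Notation mR := (measurableTypeR R).
Local Notation P := (mR * mR)%type.
Local Notation mu := (@lebesgue_measure R).

Lemma near_lt (f : R * R -> R) (x : R * R) (c : R) : continuous f -> f x < c -> \forall y \near x, f y < c.
Proof.
move=> cf fx; have : nbhs (f x) [set y | y < c] by apply: open_nbhs_nbhs; split => //; exact: open_lt.
by move=> /cf.
Qed.

Lemma near_gt (f : R * R -> R) (x : R * R) (c : R) : continuous f -> c < f x -> \forall y \near x, c < f y.
Proof.
move=> cf fx; have : nbhs (f x) [set y | c < y] by apply: open_nbhs_nbhs; split => //; exact: open_gt.
by move=> /cf.
Qed.

Lemma continuous_line1 (f : R * R -> R) (x : R) : continuous f -> continuous (fun y : R => f (x, y)).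
Proof.
move=> cf t; apply: (@cvg_comp R (R * R)%type R (fun y => (x, y)) f (nbhs t) (nbhs (x, t)) _ _ (cf (x, t))).
exact: (@cvg_pair R R R (nbhs t) (nbhs x) (nbhs t) _ _ _ (fun=> x) id (cvg_cst x) cvg_id).
Qed.

Lemma continuous_line2 (f : R * R -> R) (y : R) : continuous f -> continuous (fun x : R => f (x, y)).
Proof.
move=> cf t; apply: (@cvg_comp R (R * R)%type R (fun x => (x, y)) f (nbhs t) (nbhs (t, y)) _ _ (cf (t, y))).
exact: (@cvg_pair R R R (nbhs t) (nbhs t) (nbhs y) _ _ _ id (fun=> y) cvg_id (cvg_cst y)).
Qed.

Lemma measurable_partial_integral (f : P -> \bar R) (c d : R) : measurable_fun [set: P] f ->
  (forall x, (0 <= f x)%E) ->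
  measurable_fun [set: mR] (fun x : mR => \int[mu]_(t in `[c, d]) f (x, t))%E /\
  measurable_fun [set: mR] (fun x : mR => \int[mu]_(t in `[c, d]) f (t, x))%E.
Proof.
move=> mf f0; have mI : measurable (`[c, d]%classic : set mR) by exact: measurable_itv.
split.
- pose S : set P := [set: mR] `*` `[c, d]%classic.
  have mS : measurable S by exact: measurableX.
  have mfS : measurable_fun [set: P] (f \_ S).
    by apply/(measurable_restrictT _ _).1; [exact: mS|exact: measurable_funTS].
  have fS0 x : (0 <= (f \_ S) x)%E by rewrite patchE; case: ifP.
  have := @measurable_fun_fubini_tonelli_F _ _ _ _ R mu (f \_ S) mfS fS0.
  congr measurable_fun; apply/funext => x; rewrite /fubini_F [RHS]integral_mkcond.
  apply: eq_integral => t _; rewrite !patchE; congr (if _ then _ else _).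
  by apply/idP/idP; rewrite !inE /S /=; [case|].
- pose S : set P := `[c, d]%classic `*` [set: mR].
  have mS : measurable S by exact: measurableX.
  have mfS : measurable_fun [set: P] (f \_ S).
    by apply/(measurable_restrictT _ _).1; [exact: mS|exact: measurable_funTS].
  have fS0 x : (0 <= (f \_ S) x)%E by rewrite patchE; case: ifP.
  have := @measurable_fun_fubini_tonelli_G _ _ _ _ R mu (f \_ S) mfS fS0.
  congr measurable_fun; apply/funext => x; rewrite /fubini_G [RHS]integral_mkcond.
  apply: eq_integral => t _; rewrite !patchE; congr (if _ then _ else _).
  by apply/idP/idP; rewrite !inE /S /=; [case|].
Qed.

End Nearby.

Section GoodLine.
Context {R : realType}.
Local Notation mR := (measurableTypeR R).
Local Notation P := (mR * mR)%type.
Local Notation mu := (@lebesgue_measure R).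

(** By Fubini some line meets at most the average share of the integral, and on
    that line the integral of [G + |G'|] controls the supremum. *)
Lemma good_line (G G' : R -> R -> R) (a b c d p q E m : R) : p < q -> a <= p -> q <= b -> c < d ->
  (forall x t, is_derive t (1 : R) (G x) (G' x t)) -> (forall x, continuous (G' x)) ->
  (forall x t, 0 <= G x t) ->
  measurable_fun [set: mR] (fun x : mR => \int[mu]_(t in `[c, d]) (G x t + `|G' x t|)%:E)%E ->
  (\int[mu]_(x in `[a, b]) \int[mu]_(t in `[c, d]) (G x t + `|G' x t|)%:E <= E%:E)%E ->
  0 <= m -> E * (1 + (d - c)) < m * (q - p) * (d - c) ->
  exists x, p <= x <= q /\ forall y, c <= y <= d -> G x y <= m.
Proof.
move=> pq ap qb cd dG cG' G0 mH HE m0 Em.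
pose H (x : mR) := (\int[mu]_(t in `[c, d]) (G x t + `|G' x t|)%:E)%E.
have H0 x : (0 <= H x)%E by apply: integral_ge0 => t _; rewrite lee_fin addr_ge0.
have dc0 : 0 < d - c by rewrite subr_gt0.
have dc1 : 0 < 1 + (d - c) by rewrite addr_gt0.
pose m' := m * (d - c) / (1 + (d - c)).
have m'0 : 0 <= m' by rewrite divr_ge0 ?mulr_ge0// ltW.
have HE' : (\int[mu]_(x in `[p, q]) H x <= E%:E)%E.
  apply: le_trans HE; apply: ge0_subset_integral => //; first exact: measurable_funTS.
  by move=> x /=; rewrite !in_itv/= => /andP[? ?]; apply/andP; split; lra.
have Em' : E < m' * (q - p).
  by rewrite /m' mulrAC ltr_pdivlMr// mulrAC.
have [x [xpq Hx]] := exists_small_value pq mH H0 HE' m'0 Em'.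
exists x; split => // y ycd.
have := line_sup cd ycd (dG x) (cG' x) (G0 x).
have mI : measurable (`[c, d]%classic : set mR) by exact: measurable_itv.
have mG : measurable_fun (`[c, d]%classic : set mR) (fun t : mR => (G x t)%:E).
  apply: measurable_funTS; apply/measurable_EFinP; apply: continuous_measurable_fun.
  exact: is_derive_continuous (dG x).
have mG' : measurable_fun (`[c, d]%classic : set mR) (fun t : mR => `|G' x t|%:E).
  by apply: measurable_funTS; exact: continuous_abs_measurable.
have HxE : H x = (\int[mu]_(t in `[c, d]) (G x t)%:E + \int[mu]_(t in `[c, d]) `|G' x t|%:E)%E.
  rewrite -ge0_integralD//; last by move=> t _; rewrite lee_fin.
set I := (\int[mu]_(t in `[c, d]) (G x t)%:E)%E in HxE *.
set I' := (\int[mu]_(t in `[c, d]) `|G' x t|%:E)%E in HxE *.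
have I0 : (0 <= I)%E by apply: integral_ge0 => t _; rewrite lee_fin.
have I'0 : (0 <= I')%E by apply: integral_ge0 => t _; rewrite lee_fin.
have IH : (I + I' <= m'%:E)%E by rewrite -HxE.
have If : I \is a fin_num.
  by rewrite ge0_fin_numE//; apply: le_lt_trans (ltry m'); apply: le_trans IH; rewrite leeDl.
have I'f : I' \is a fin_num.
  by rewrite ge0_fin_numE//; apply: le_lt_trans (ltry m'); apply: le_trans IH; rewrite leeDr.
move: I0 I'0 IH; rewrite -(fineK If) -(fineK I'f) -!EFinM -!EFinD !lee_fin.
move=> I0 I'0 IH h.
rewrite -(ler_pM2l dc0); apply: (le_trans h).
have : (1 + (d - c)) * (fine I + fine I') <= m * (d - c).
  have -> : m * (d - c) = (1 + (d - c)) * m' by rewrite /m'; field; rewrite gt_eqF.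
  by apply: ler_wpM2l => //; exact: ltW.
have := mulr_ge0 (ltW dc0) I0; nra.
Qed.

End GoodLine.

(** * The estimate for a smooth approximation *)

(** The function [u] approximates a subsolution with weak gradient [g] on the
    square of half-side [s].  Its data are the error [tau^2] of the gradient, the
    bound [X] for the integral of [u_+^2], and a bound [M] for that of
    [u^2 + |grad u|^2], which enters with a factor [tau] only. *)
Section LocalEstimate.
Context {R : realType}.
Local Notation mR := (measurableTypeR R).
Local Notation P := (mR * mR)%type.
Variables (B : set (R * R)) (nu Lam : R) (a : R * R -> 'M[R]_2) (g : R * R -> 'cV[R]_2).
Hypothesis mB : measurable (B : set P).
Hypothesis Bfin : (leb2 (B : set P) < +oo)%E.
Hypotheses (nu0 : 0 < nu) (nuLam : nu <= Lam).
Hypothesis ea : bounded_elliptic B nu Lam a.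
Hypothesis gL : forall i, Lp_on B 2%:E (fun x => g x i 0).
Hypothesis sub : forall phi, C1c B phi -> (forall x, 0 <= phi x) ->
      \int[leb2]_(x in B) dot (a x *m g x) (grad phi x) <= 0.
Variables (z : R * R) (s : R).
Hypothesis s0 : 0 < s.

Definition square (h : R) : set (R * R) := rect (z.1 - h) (z.1 + h) (z.2 - h) (z.2 + h).
Hypothesis QB : square s `<=` B.
Variables (u u1 u2 : R * R -> R).
Hypothesis Cu : C1 u u1 u2.
Variables (tau X M k : R).
Hypotheses (tau0 : 0 < tau) (k0 : 0 < k).
Hypothesis gerr : int_bound (square s) (fun x => (u1 x - g x 0 0) ^+ 2 + (u2 x - g x 1 0) ^+ 2) (tau ^+ 2).
Hypothesis uX : int_bound (square s) (fun x => sqpos (u x)) X.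
Hypothesis uM : int_bound (square s) (fun x => u x ^+ 2 + u1 x ^+ 2 + u2 x ^+ 2) M.

Let Lam0 : 0 <= Lam. Proof. by apply: le_trans nuLam; exact: ltW. Qed.
Let cu : continuous u := C1_continuous Cu.
Let cu1 : continuous u1. Proof. by case: Cu. Qed.
Let cu2 : continuous u2. Proof. by case: Cu. Qed.
Let mc (f : R * R -> R) : continuous f -> measurable_fun [set: P] (f : P -> mR).
Proof. exact: continuous_measurable2. Qed.

Lemma measurable_square h : measurable (square h : set P).
Proof. exact: measurable_rect. Qed.

Lemma square_sub h h' : h <= h' -> square h `<=` square h'.
Proof. by move=> hh x /rectP[? ? ? ?]; apply/rectP; split; lra. Qed.

(** For [phi = eta^2 theta(u)] one has [|grad phi|^2 <= 2 |grad u|^2 + 256 / s^2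
    u^2]. *)
Definition cutoff_const : R := 256 / s ^+ 2 + 2.
Lemma cutoff_const_ge2 : 2 <= cutoff_const.
Proof. by rewrite /cutoff_const lerDr; apply: divr_ge0; [exact: ler0n|exact: sqr_ge0]. Qed.

(** The right-hand side of Caccioppoli's inequality up to constants; it reduces
    to [X] as [tau] tends to 0. *)
Definition energy_budget : R := X + tau * (1 + M).

(** The test functions of this section satisfy [|grad phi|^2 <= C (u^2 + |grad
    u|^2)], so that the error in [energy] is of order [tau]. *)
Lemma energy_bound (phi phi1 phi2 Pf Sf : R * R -> R) (C S : R) :
  C1 phi phi1 phi2 -> (forall x, ~ square s x -> phi x = 0) -> (forall x, 0 <= phi x) ->
  (forall x, square s x -> phi1 x ^+ 2 + phi2 x ^+ 2 <= C * (u x ^+ 2 + u1 x ^+ 2 + u2 x ^+ 2)) ->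
  0 <= C -> measurable_fun [set: P] (Pf : P -> mR) -> (forall x, 0 <= Pf x) ->
  int_bound (square s) Sf S -> (forall x, 0 <= Sf x) ->
  (forall x, square s x -> elliptic nu Lam (a x) ->
     Pf x <= bil (a x) (u1 x) (u2 x) (phi1 x) (phi2 x) + Sf x) ->
  int_bound (square s) Pf (S + Lam / 2 * (tau * (1 + C * M))).
Proof.
move=> Cphi phiQ phi0 phiC C00 mPf Pf0 SfS Sf0 PS.
have mQ := measurable_square s.
have Cc : C1c B phi.
  by apply: (C1_C1c Cphi) phiQ => //; [exact: compact_rect|exact: closed_rect].
have [cp1 cp2 _] := Cphi.
have iphi : int_bound (square s) (fun x => phi1 x ^+ 2 + phi2 x ^+ 2) (C * M).
  apply: (int_bound_le mQ (int_bound_scale mQ C00 uM)) => //.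
    by apply: measurable_funTS; apply: measurable_funD; apply: measurable_funX; exact: mc.
  by move=> x _; rewrite addr_ge0 ?sqr_ge0.
have it : 0 <= tau^-1 by rewrite invr_ge0 ltW.
have L2 : 0 <= Lam / 2 by rewrite divr_ge0.
have ir := int_bound_add mQ SfS (int_bound_scale mQ L2 (int_bound_add mQ
  (int_bound_scale mQ it gerr) (int_bound_scale mQ (ltW tau0) iphi))).
have [mS _ _] := SfS; have [_ _ ir3] := ir.
split; [exact: measurable_funTS|by []|].
have := @energy R B nu Lam a g _ _ _ _ phi phi1 phi2 u1 u2 tau Pf Sf mB Bfin QB nu0 ea gL
  (sub Cc phi0) Cphi phiQ cu1 cu2 tau0 Lam0 mPf mS Pf0 Sf0 PS.
move=> /le_trans; apply; rewrite -/(square s).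
under eq_integral do rewrite [X in _ * (X + _)]mulrC.
apply: (le_trans ir3); rewrite lee_fin le_eqVlt; apply/orP; left; apply/eqP.
by field; rewrite gt_eqF.
Qed.

(** Test with [eta^2 theta(u)]. *)
Lemma caccioppoli : int_bound (square (3 / 4 * s)) (fun x => dtheta k (u x) * (u1 x ^+ 2 + u2 x ^+ 2))
   (2000 * cutoff_const * (Lam / nu) * energy_budget).
Proof.
have mQ := measurable_square s.
have Ceta := eta_C1 s0 z.
have Cth := C1_comp Cu (fun t => theta_derive t k0) (@dtheta_continuous R k).
pose e x := eta s z x; pose e1 x := eta1 s z x; pose e2 x := eta2 s z x.
pose t x := theta k (u x); pose dt x := dtheta k (u x).
pose phi1 x := e x ^+ 2 * (dt x * u1 x) + t x * (2 * e x * e1 x).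
pose phi2 x := e x ^+ 2 * (dt x * u2 x) + t x * (2 * e x * e2 x).
have Cphi : C1 (fun x => e x * e x * t x) phi1 phi2.
  apply: C1_ext (C1_mul (C1_mul Ceta Ceta) Cth) _ _ => x; rewrite /phi1 /phi2 /e /e1 /e2 /t /dt /=; ring.
have ebd x : 0 <= e x <= 1 by exact: eta_bounds.
have mdt : measurable_fun [set: P] (dt : P -> mR).
  rewrite -[dt]/(dtheta k \o u); apply: mc => x.
  by apply: continuous_comp; [exact: cu|exact: dtheta_continuous].
have esq x : 0 <= e x ^+ 2 <= 1.
  by have /andP[h1 h2] := ebd x; rewrite sqr_ge0/= expr_le1.
have dbd x : 0 <= dt x <= 1 by exact: dtheta_bounds.
have t0 x : 0 <= t x by exact: theta_ge0.
have tp x : t x <= pos (u x) by exact: theta_le_pos.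
have pu (y : R) : sqpos y <= y ^+ 2.
  by rewrite /sqpos; case: (posP y) => -[h ->]; rewrite ?expr0n ?sqr_ge0.
have tu x : t x ^+ 2 <= u x ^+ 2.
  by apply: le_trans (pu (u x)); rewrite /sqpos ler_sqr ?nnegrE ?pos_ge0.
have sq x i (ei : R) : ei ^+ 2 <= 16 / s ^+ 2 ->
   (e x ^+ 2 * (dt x * i) + t x * (2 * e x * ei)) ^+ 2 <= 2 * i ^+ 2 + 128 / s ^+ 2 * u x ^+ 2.
  move=> ei2.
  set A := e x ^+ 2 * (dt x * i); set A' := t x * (2 * e x * ei).
  have h : (A + A') ^+ 2 <= 2 * A ^+ 2 + 2 * A' ^+ 2 by have := sqr_ge0 (A - A'); rewrite !expr2; lra.
  apply: (le_trans h); apply: lerD.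
    apply: ler_wpM2l => //; rewrite /A mulrA exprMn -[leRHS]mul1r.
    apply: ler_wpM2r; first exact: sqr_ge0.
    have /andP[h1 h2] := esq x; have /andP[h3 h4] := dbd x.
    have h5 : 0 <= e x ^+ 2 * dt x by rewrite mulr_ge0.
    have h6 : e x ^+ 2 * dt x <= 1 by rewrite mulr_ile1.
    by rewrite expr_le1.
  have A'E : A' ^+ 2 = 4 * (e x ^+ 2 * (t x ^+ 2 * ei ^+ 2)) by rewrite /A'; ring.
  have h1 : t x ^+ 2 * ei ^+ 2 <= u x ^+ 2 * (16 / s ^+ 2) by apply: ler_pM; rewrite ?sqr_ge0.
  have h2 : e x ^+ 2 * (t x ^+ 2 * ei ^+ 2) <= t x ^+ 2 * ei ^+ 2.
    by have /andP[? ?] := esq x; rewrite ler_piMl// mulr_ge0 ?sqr_ge0.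
  by rewrite A'E; lra.
have mS : int_bound (square s) (fun x => 2 * Lam * (pos (u x) ^+ 2 * (e1 x ^+ 2 + e2 x ^+ 2))) (2 * Lam * (32 / s ^+ 2) * X).
  have h : 0 <= 2 * Lam * (32 / s ^+ 2) by nneg.
  have [ce1 ce2 _] := Ceta.
  apply: (int_bound_le mQ (int_bound_scale mQ h uX)).
  - apply: measurable_funTS; apply: measurable_funM => //; apply: measurable_funM.
      apply: measurable_funX; apply: mc => x; apply: continuous_comp; [exact: cu|exact: pos_continuous].
    by apply: measurable_funD; apply: measurable_funX; exact: mc.
  - by move=> x _; nneg.
  - move=> x _; rewrite -[leRHS]mulrA -/(sqpos (u x)); apply: ler_wpM2l; first by rewrite mulr_ge0.
    rewrite mulrC; apply: ler_wpM2r; first exact: sqr_ge0.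
    have := eta1_bound s0 z x; have := eta2_bound s0 z x; rewrite -/(e1 x) -/(e2 x); lra.
have e0Q x : ~ square s x -> e x = 0 by move=> xQ; exact: eta_out.
have main := @energy_bound _ phi1 phi2 (fun x => nu / 2 * (e x ^+ 2 * dt x * (u1 x ^+ 2 + u2 x ^+ 2))) _ cutoff_const _ Cphi _ _ _ _ _ _ mS _ _.
have {main} : int_bound (square s) (fun x => nu / 2 * (e x ^+ 2 * dt x * (u1 x ^+ 2 + u2 x ^+ 2)))
   (2 * Lam * (32 / s ^+ 2) * X + Lam / 2 * (tau * (1 + cutoff_const * M))).
  apply: main.
  - by move=> x /e0Q ->; rewrite !mul0r.
  - by move=> x; have /andP[? _] := ebd x; have := t0 x => ?; nneg.
  - move=> x _; have := sq x (u1 x) _ (eta1_bound s0 z x); have := sq x (u2 x) _ (eta2_bound s0 z x).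
    rewrite -/(e1 x) -/(e2 x) -/(phi1 x) -/(phi2 x) /cutoff_const.
    have w0 : 0 <= 256 / s ^+ 2 by apply: divr_ge0; [exact: ler0n|exact: sqr_ge0].
    have := mulr_ge0 w0 (sqr_ge0 (u1 x)); have := mulr_ge0 w0 (sqr_ge0 (u2 x)); have := sqr_ge0 (u x).
    lra.
  - by apply: le_trans cutoff_const_ge2.
  - have [ce1 ce2 _] := Ceta.
    apply: measurable_funM => //; apply: measurable_funM.
      apply: measurable_funM; first by apply: measurable_funX; apply: mc; exact: C1_continuous Ceta.
      exact: mdt.
    by apply: measurable_funD; apply: measurable_funX; exact: mc.
  - move=> x; have /andP[? _] := esq x; have /andP[? _] := dbd x.
    by nneg.
  - by move=> x; nneg.
  - move=> x _ el; rewrite /phi1 /phi2.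
    by apply: (caccioppoli_pointwise nu0 el); [have /andP[] := dbd x|exact: theta_sq_le].
move=> main.
have mQ' := measurable_square (3 / 4 * s).
have QQ : square (3 / 4 * s) `<=` square s by apply: square_sub; have := s0; lra.
have M0 : 0 <= M := int_bound_ge0 uM.
have X0 : 0 <= X := int_bound_ge0 uX.
have n2 : 0 <= 2000 / nu by apply: divr_ge0; [exact: ler0n|exact: ltW].
apply: (int_bound_weak _ (int_bound_le mQ' (int_bound_scale mQ' n2 (int_bound_sub mQ mQ' QQ main)) _ _ _)).
- rewrite (_ : 2000 * cutoff_const * (Lam / nu) * energy_budget = 2000 / nu * (Lam * (cutoff_const * energy_budget))); last by ring.
  apply: ler_wpM2l => //.
  rewrite (_ : _ + _ = Lam * ((64 / s ^+ 2) * X + (tau * (1 + cutoff_const * M)) / 2)); last by field; rewrite gt_eqF.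
  apply: ler_wpM2l => //; rewrite /energy_budget /cutoff_const.
  have w0 : 0 <= 1 / s ^+ 2 by rewrite divr_ge0 ?sqr_ge0.
  have w1 := mulr_ge0 w0 X0; have w2 := mulr_ge0 w0 (ltW tau0).
  have w3 := mulr_ge0 w0 (mulr_ge0 (ltW tau0) M0); have w4 := mulr_ge0 (ltW tau0) M0.
  have := tau0; nra.
- apply: measurable_funTS; apply: measurable_funM.
    exact: mdt.
  by apply: measurable_funD; apply: measurable_funX; exact: mc.
- by move=> x _; have /andP[? _] := dbd x; nneg.
- move=> x /(eta_lower s0) el.
  rewrite (_ : 2000 / nu * _ = 1000 * e x ^+ 2 * (dt x * (u1 x ^+ 2 + u2 x ^+ 2))); last by field; rewrite gt_eqF.
  rewrite -[leLHS]mul1r; apply: ler_wpM2r.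
    by have /andP[? _] := dbd x; nneg.
  by rewrite -/(e x) in el; lra.
Qed.

Definition gradient_const : R := 3 + 2000 * cutoff_const.
Definition sqtheta (x : R * R) := theta k (u x) * theta k (u x).
Definition sqtheta1 (x : R * R) := 2 * theta k (u x) * (dtheta k (u x) * u1 x).
Definition sqtheta2 (x : R * R) := 2 * theta k (u x) * (dtheta k (u x) * u2 x).

Lemma sqtheta_C1 : C1 sqtheta sqtheta1 sqtheta2.
Proof.
have Cth := C1_comp Cu (fun t => theta_derive t k0) (@dtheta_continuous R k).
by apply: C1_ext (C1_mul Cth Cth) _ _ => x; rewrite /sqtheta1 /sqtheta2 /=; ring.
Qed.

(** [2 theta theta' |grad u| <= kap u_+^2 + theta' |grad u|^2 / kap], and by
    Caccioppoli's inequality the last term is of order [(Lam / nu) / kap]. The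
    two terms balance when [kap] is the square root of [Lam / nu]; this is where
    the exponent of the theorem is decided. *)
Lemma sqtheta_bound (kap : R) : 1 <= kap -> kap ^+ 2 = Lam / nu ->
  int_bound (square (3 / 4 * s)) (fun x => sqtheta x + `|sqtheta1 x| + `|sqtheta2 x|) (gradient_const * kap * energy_budget).
Proof.
move=> kap1 kapE.
have mQ' := measurable_square (3 / 4 * s).
have mQ := measurable_square s.
have QQ : square (3 / 4 * s) `<=` square s by apply: square_sub; have := s0; lra.
have kap0 : 0 < kap by apply: lt_le_trans kap1.
have n1 : 0 <= 1 + 2 * kap by have := kap0; lra.
have n2 : 0 <= kap^-1 by rewrite invr_ge0 ltW.
have M0 : 0 <= M := int_bound_ge0 uM.
have X0 : 0 <= X := int_bound_ge0 uX.
have [cF1 cF2 _] := sqtheta_C1.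
have ib := int_bound_add mQ' (int_bound_scale mQ' n1 (int_bound_sub mQ mQ' QQ uX))
  (int_bound_scale mQ' n2 caccioppoli).
apply: (int_bound_weak _ (int_bound_le mQ' ib _ _ _)).
- rewrite -kapE (_ : kap^-1 * _ = 2000 * cutoff_const * (kap * energy_budget)); last by field; rewrite gt_eqF.
  rewrite /gradient_const (_ : _ * kap * energy_budget = 3 * (kap * energy_budget) + 2000 * cutoff_const * (kap * energy_budget)); last by ring.
  rewrite lerD2r; apply: (@le_trans _ _ (3 * kap * X)).
    by apply: ler_wpM2r => //; have := kap1; lra.
  rewrite -mulrA; apply: ler_wpM2l => //; apply: ler_wpM2l; first exact: ltW.
  by rewrite /energy_budget lerDl mulr_ge0 ?addr_ge0// ltW.
- apply: measurable_funTS; apply: measurable_funD.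
    apply: measurable_funD; first by apply: mc; exact: C1_continuous sqtheta_C1.
    by apply: measurableT_comp => //; exact: mc.
  by apply: measurableT_comp => //; exact: mc.
- by move=> x _; rewrite addr_ge0// addr_ge0// /sqtheta -expr2 sqr_ge0.
- move=> x _; have /andP[d0 d1] := dtheta_bounds (u x) k0.
  have t0 := theta_ge0 (u x) k0; have tp := theta_le_pos (u x) k0.
  have tsq : theta k (u x) ^+ 2 <= sqpos (u x) by rewrite /sqpos ler_sqr ?nnegrE ?pos_ge0.
  have key (i : R) : `|2 * theta k (u x) * (dtheta k (u x) * i)| <= kap * sqpos (u x) + kap^-1 * (dtheta k (u x) * i ^+ 2).
    have h1 : kap * theta k (u x) ^+ 2 <= kap * sqpos (u x) by apply: ler_wpM2l => //; exact: ltW.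
    have h2 : kap^-1 * (dtheta k (u x) ^+ 2 * i ^+ 2) <= kap^-1 * (dtheta k (u x) * i ^+ 2).
      apply: ler_wpM2l => //; apply: ler_wpM2r; first exact: sqr_ge0.
      by rewrite expr2 ler_piMl.
    have h3 : 0 <= kap * (theta k (u x) - kap^-1 * (dtheta k (u x) * i)) ^+ 2.
      by apply: mulr_ge0; [exact: ltW|exact: sqr_ge0].
    have h4 : 0 <= kap * (theta k (u x) + kap^-1 * (dtheta k (u x) * i)) ^+ 2.
      by apply: mulr_ge0; [exact: ltW|exact: sqr_ge0].
    have e3 : kap * (theta k (u x) - kap^-1 * (dtheta k (u x) * i)) ^+ 2 =
       kap * theta k (u x) ^+ 2 - 2 * theta k (u x) * (dtheta k (u x) * i) + kap^-1 * (dtheta k (u x) ^+ 2 * i ^+ 2).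
      by field; rewrite gt_eqF.
    have e4 : kap * (theta k (u x) + kap^-1 * (dtheta k (u x) * i)) ^+ 2 =
       kap * theta k (u x) ^+ 2 + 2 * theta k (u x) * (dtheta k (u x) * i) + kap^-1 * (dtheta k (u x) ^+ 2 * i ^+ 2).
      by field; rewrite gt_eqF.
    by rewrite ler_norml; apply/andP; split; lra.
  have := key (u1 x); have := key (u2 x); rewrite -/(sqtheta1 x) -/(sqtheta2 x).
  by rewrite /sqtheta -expr2 mulrDr mulrDr; lra.
Qed.

(** The lines are chosen between the squares of half-sides [s / 2] and [3 / 4
    s], so that the rectangle contains the smaller square. On them [theta(u)^2
    <= k^2 / 8], which is less than [theta(k)^2 = k^2 / 4]. *)
Lemma good_lines (kap : R) : 1 <= kap -> kap ^+ 2 = Lam / nu ->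
  gradient_const * kap * energy_budget * (1 + 3 / 2 * s) < k ^+ 2 / 8 * (s / 4) * (3 / 2 * s) ->
  exists a1 a2 b1 b2, [/\ z.1 - 3 / 4 * s <= a1 <= z.1 - s / 2,
     z.1 + s / 2 <= a2 <= z.1 + 3 / 4 * s, z.2 - 3 / 4 * s <= b1 <= z.2 - s / 2,
     z.2 + s / 2 <= b2 <= z.2 + 3 / 4 * s &
     forall x, rect a1 a2 b1 b2 x -> [\/ x.1 = a1, x.1 = a2, x.2 = b1 | x.2 = b2] -> u x < k].
Proof.
move=> kap1 kapE kY; have S0 := s0.
have [mF F0 FE] := sqtheta_bound kap1 kapE; set E := gradient_const * kap * energy_budget in FE kY.
have CF := sqtheta_C1; have [cF1 cF2 _] := CF; have cF := C1_continuous CF.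
have Fge x : 0 <= sqtheta x by rewrite /sqtheta -expr2 sqr_ge0.
have mEab (f1 f2 : R * R -> R) : continuous f1 -> continuous f2 ->
    measurable_fun [set: P] (fun x : P => (f1 x + `|f2 x|)%:E).
  move=> c1 c2; apply/measurable_EFinP; apply: measurable_funD; first exact: mc.
  by apply: measurableT_comp => //; exact: mc.
pose f1 (x : P) := (sqtheta x + `|sqtheta1 x|)%:E; pose f2 (x : P) := (sqtheta x + `|sqtheta2 x|)%:E.
have mf1 : measurable_fun [set: P] f1 by exact: mEab.
have mf2 : measurable_fun [set: P] f2 by exact: mEab.
have f10 x : (0 <= f1 x)%E by rewrite lee_fin addr_ge0.
have f20 x : (0 <= f2 x)%E by rewrite lee_fin addr_ge0.
set h := 3 / 4 * s in FE *.
have mQ' : measurable (square h : set P) by exact: measurable_square.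
have le1 : (\int[leb2]_(x in square h) f1 x <= E%:E)%E.
  apply: le_trans FE; apply: ge0_le_integral => //; first exact: measurable_funTS.
    exact/measurable_EFinP.
  by move=> x _; rewrite lee_fin lerDl.
have le2 : (\int[leb2]_(x in square h) f2 x <= E%:E)%E.
  apply: le_trans FE; apply: ge0_le_integral => //; first exact: measurable_funTS.
    exact/measurable_EFinP.
  by move=> x _; rewrite lee_fin addrAC lerDl.
have [T1 _] := tonelli_rect (z.1 - h) (z.1 + h) (z.2 - h) (z.2 + h) mf2 f20.
have [_ T2] := tonelli_rect (z.1 - h) (z.1 + h) (z.2 - h) (z.2 + h) mf1 f10.
move: le1; rewrite /square T2 => le1; move: le2; rewrite /square T1 => le2.
have verti p q : p < q -> z.1 - h <= p -> q <= z.1 + h -> q - p = s / 4 ->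
    exists x, p <= x <= q /\ forall y, z.2 - h <= y <= z.2 + h -> sqtheta (x, y) <= k ^+ 2 / 8.
  move=> pq hp hq qp.
  apply: (@good_line R (fun x y => sqtheta (x, y)) (fun x y => sqtheta2 (x, y))
    (z.1 - h) (z.1 + h) (z.2 - h) (z.2 + h) p q E (k ^+ 2 / 8) pq hp hq).
  - by rewrite /h; lra.
  - by move=> x t; exact: C1_derive2 CF.
  - by move=> x; exact: continuous_line1.
  - by move=> x t; exact: Fge.
  - exact: (measurable_partial_integral _ _ mf2 f20).1.
  - exact: le2.
  - by rewrite divr_ge0 ?sqr_ge0.
  - by rewrite qp (_ : z.2 + h - (z.2 - h) = 3 / 2 * s)//; rewrite /h; field.
have horiz p q : p < q -> z.2 - h <= p -> q <= z.2 + h -> q - p = s / 4 ->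
    exists y, p <= y <= q /\ forall x, z.1 - h <= x <= z.1 + h -> sqtheta (x, y) <= k ^+ 2 / 8.
  move=> pq hp hq qp.
  apply: (@good_line R (fun y x => sqtheta (x, y)) (fun y x => sqtheta1 (x, y))
    (z.2 - h) (z.2 + h) (z.1 - h) (z.1 + h) p q E (k ^+ 2 / 8) pq hp hq).
  - by rewrite /h; lra.
  - by move=> x t; exact: C1_derive1 CF.
  - by move=> y; exact: continuous_line2.
  - by move=> x t; exact: Fge.
  - exact: (measurable_partial_integral _ _ mf1 f10).2.
  - exact: le1.
  - by rewrite divr_ge0 ?sqr_ge0.
  - by rewrite qp (_ : z.1 + h - (z.1 - h) = 3 / 2 * s)//; rewrite /h; field.
have arith c : [/\ c - h < c - s / 2, c + s / 2 < c + h, c - s / 2 <= c + h & c - h <= c + s / 2] /\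
    (c - s / 2 - (c - h) = s / 4 /\ c + h - (c + s / 2) = s / 4).
  by rewrite /h; split; split; lra.
have [[p1 p2 p3 p4] [p5 p6]] := arith z.1; have [[q1 q2 q3 q4] [q5 q6]] := arith z.2.
have [a1 [a1P Fa1]] := verti _ _ p1 (lexx _) p3 p5.
have [a2 [a2P Fa2]] := verti _ _ p2 p4 (lexx _) p6.
have [b1 [b1P Fb1]] := horiz _ _ q1 (lexx _) q3 q5.
have [b2 [b2P Fb2]] := horiz _ _ q2 q4 (lexx _) q6.
exists a1, a2, b1, b2; split => // x /rectP[x1 x2 x3 x4] bx.
have Fx : sqtheta x <= k ^+ 2 / 8.
  move: a1P a2P b1P b2P => /andP[a3 a4] /andP[a5 a6] /andP[b3 b4] /andP[b5 b6].
  move: x1 x2 x3 x4 bx; case: x => x y /= x1 x2 x3 x4.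
  have yh : z.2 - h <= y <= z.2 + h by rewrite (le_trans b3 x3) (le_trans x4 b6).
  have xh : z.1 - h <= x <= z.1 + h by rewrite (le_trans a3 x1) (le_trans x2 a6).
  by case=> ->; [exact: Fa1|exact: Fa2|exact: Fb1|exact: Fb2].
rewrite ltNge; apply/negP => ku.
have := theta_mono k0 ku; rewrite theta_at// => tk.
have : (k / 2) ^+ 2 <= sqtheta x by rewrite /sqtheta -expr2 ler_sqr ?nnegrE ?theta_ge0// divr_ge0// ltW.
by rewrite expr_div_n; have := exprn_gt0 2 k0; lra.
Qed.

Section Inside.
Variables (a1 a2 b1 b2 : R).
Hypotheses (a12 : a1 < a2) (b12 : b1 < b2).
Hypothesis RQ : rect a1 a2 b1 b2 `<=` square s.
Hypothesis bd : forall x, rect a1 a2 b1 b2 x -> [\/ x.1 = a1, x.1 = a2, x.2 = b1 | x.2 = b2] -> u x < k.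
Let A := rect a1 a2 b1 b2.
Definition excess (x : R * R) := theta k (u x - k).
Definition dexcess (x : R * R) := dtheta k (u x - k).

Lemma excess_C1 : C1 excess (fun x => dexcess x * u1 x) (fun x => dexcess x * u2 x).
Proof.
apply: (C1_comp Cu (f := fun t => theta k (t - k)) (f' := fun t => dtheta k (t - k))).
  by move=> t; apply: is_derive_shift_comp; exact: theta_derive.
move=> t; apply: (continuous_comp (f := fun t => t - k)); last exact: dtheta_continuous.
by apply: cvgB; [exact: cvg_id|exact: cvg_cst].
Qed.

(** Near every boundary point of the rectangle [u < k], so that the excess
    vanishes there. *)
Lemma excess_restrict_C1 : C1 (excess \_ A) ((fun x => dexcess x * u1 x) \_ A) ((fun x => dexcess x * u2 x) \_ A).
Proof.
apply: C1_local excess_C1 _ => x.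
have near_u : u x < k -> \near x, excess x = 0.
  move=> ux; have := near_lt cu ux.
  apply: filterS => y uy; rewrite /excess.
  by have [[_ -> _]|[/andP[? _] _ _]|[? _ _]] := theta_cases (u y - k) k0 => //; have := k0; lra.
have c1 : continuous (fst : R * R -> R) by exact: (C1_continuous C1_fst).
have c2 : continuous (snd : R * R -> R) by exact: (C1_continuous C1_snd).
have [xA|nxA] := pselect (A x); last first.
  by apply: Or33; apply: open_nbhs_nbhs; split => //; apply: closed_openC; exact: closed_rect.
have [x1 x2 x3 x4] := (rectP _ _ _ _ _).1 xA.
have [e|n1] := eqVneq x.1 a1; first by apply: Or32; apply: near_u; apply: bd => //; exact: Or41.
have [e|n2] := eqVneq x.1 a2; first by apply: Or32; apply: near_u; apply: bd => //; exact: Or42.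
have [e|n3] := eqVneq x.2 b1; first by apply: Or32; apply: near_u; apply: bd => //; exact: Or43.
have [e|n4] := eqVneq x.2 b2; first by apply: Or32; apply: near_u; apply: bd => //; exact: Or44.
apply: Or31.
have h1 : \near x, a1 < x.1 by apply: near_gt; [exact: c1|rewrite lt_neqAle eq_sym n1].
have h2 : \near x, x.1 < a2 by apply: near_lt; [exact: c1|rewrite lt_neqAle n2].
have h3 : \near x, b1 < x.2 by apply: near_gt; [exact: c2|rewrite lt_neqAle eq_sym n3].
have h4 : \near x, x.2 < b2 by apply: near_lt; [exact: c2|rewrite lt_neqAle n4].
near=> y; apply/rectP; split; apply: ltW; near: y; [exact: h1|exact: h2|exact: h3|exact: h4].
Unshelve. all: by end_near.
Qed.

(** The maximum principle: tested with the excess, which has no boundary values,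
    the weak inequality leaves nothing but the error of approximation. *)
Lemma inside_energy : int_bound A (fun x => dexcess x * u1 x ^+ 2) (Lam / nu * (tau * (1 + M))).
Proof.
have mA : measurable (A : set P) by exact: measurable_rect.
have mQ := measurable_square s.
have dbd x : 0 <= dexcess x <= 1 by exact: dtheta_bounds.
have mdp : measurable_fun [set: P] (dexcess : P -> mR).
  rewrite -[dexcess]/(dtheta k \o (fun x => u x - k)); apply: mc => x.
  apply: (continuous_comp (f := fun x => u x - k)); last exact: dtheta_continuous.
  by apply: cvgB; [exact: cu|exact: cvg_cst].
pose Pf (x : R * R) := nu * (dexcess x * (u1 x ^+ 2 + u2 x ^+ 2)).
have Pf0 x : 0 <= Pf x.
  by have /andP[? _] := dbd x; rewrite /Pf; nneg.
have mPf : measurable_fun [set: P] (Pf : P -> mR).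
  apply: measurable_funM => //; apply: measurable_funM => //.
  by apply: measurable_funD; apply: measurable_funX; exact: mc.
have zero : int_bound (square s) (fun=> 0) 0.
  by split => //; rewrite integral0.
have main : int_bound (square s) (Pf \_ A) (0 + Lam / 2 * (tau * (1 + 1 * M))).
  apply: (energy_bound excess_restrict_C1 _ _ _ _ _ _ zero) => //.
  - move=> x nQ; rewrite patchE; case: ifPn => // /set_mem /RQ //.
  - by move=> x; rewrite patchE; case: ifPn => // _; exact: theta_ge0.
  - move=> x _; rewrite !patchE mul1r; case: ifPn => _; last first.
      by rewrite expr0n/= addr0 -addrA addr_ge0 ?addr_ge0 ?sqr_ge0.
    have /andP[h0 h1] := dbd x.
    have h i : (dexcess x * i) ^+ 2 <= i ^+ 2.
      by rewrite exprMn -[leRHS]mul1r; apply: ler_wpM2r; rewrite ?sqr_ge0// expr_le1.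
    by have := h (u1 x); have := h (u2 x); have := sqr_ge0 (u x); lra.
  - exact/(measurable_restrictT _ _).1/measurable_funTS.
  - by move=> x; rewrite patchE; case: ifP.
  - move=> x _ el; rewrite !patchE addr0; case: ifPn => _; last by rewrite /bil !mulr0 !addr0 mulr0 addr0.
    have /andP[h0 h1] := dbd x; have /andP[el1 _] := el (u1 x) (u2 x).
    rewrite (_ : bil _ _ _ _ _ = dexcess x * bil (a x) (u1 x) (u2 x) (u1 x) (u2 x)); last by rewrite /bil; ring.
    by rewrite /Pf mulrCA; apply: ler_wpM2l.
have M0 : 0 <= M := int_bound_ge0 uM.
have ni : 0 <= nu^-1 by rewrite invr_ge0 ltW.
apply: (int_bound_weak _ (int_bound_le mA (int_bound_scale mA ni (int_bound_sub mQ mA RQ main)) _ _ _)).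
- rewrite add0r mul1r (_ : nu^-1 * _ = Lam / nu * (tau * (1 + M)) / 2); last by field; rewrite gt_eqF.
  have : 0 <= Lam / nu * (tau * (1 + M)) by have := ltW tau0 => ?; nneg.
  lra.
- by apply: measurable_funTS; apply: measurable_funM => //; apply: measurable_funX; exact: mc.
- by move=> x _; have /andP[? _] := dbd x; nneg.
- move=> x Ax; rewrite patchE mem_set// /Pf mulKf ?gt_eqF//.
  by have /andP[? _] := dbd x; apply: ler_wpM2l => //; rewrite lerDl sqr_ge0.
Qed.

(** The excess vanishes on the left side, so on every horizontal line it is at
    most the integral of [theta' |u1|], and [2 theta' |u1| <= sg + theta' u1^2 /
    sg]. *)
Lemma inside_poincare (sg : R) : 0 < sg ->
  int_bound A excess ((a2 - a1) / 2 * (sg * ((a2 - a1) * (b2 - b1)) + Lam / nu * (tau * (1 + M)) / sg)).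
Proof.
move=> sg0.
have mA : measurable (A : set P) by exact: measurable_rect.
have dbd x : 0 <= dexcess x <= 1 by exact: dtheta_bounds.
have Cpsi := excess_C1; have [cp1 cp2 _] := Cpsi; have cp := C1_continuous Cpsi.
pose f (x : P) := `|dexcess x * u1 x|%:E.
have mf : measurable_fun [set: P] f.
  by apply/measurable_EFinP; apply: measurableT_comp => //; exact: (mc cp1).
have mpsi : measurable_fun [set: P] (fun x : P => (excess x)%:E) by apply/measurable_EFinP; exact: mc.
have psi0 x : 0 <= excess x by exact: theta_ge0.
have a21 : 0 <= a2 - a1 by rewrite subr_ge0 ltW.
have b21 : 0 <= b2 - b1 by rewrite subr_ge0 ltW.
have isg : 0 <= sg^-1 by rewrite invr_ge0 ltW.
have fA : int_bound A (fun x => `|dexcess x * u1 x|)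
    (1 / 2 * (sg * ((a2 - a1) * (b2 - b1)) + sg^-1 * (Lam / nu * (tau * (1 + M))))).
  have ib := int_bound_scale mA (ltac:(by rewrite divr_ge0) : 0 <= (1 / 2 : R)) (int_bound_add mA
    (int_bound_cst (ltW a12) (ltW b12) (ltW sg0)) (int_bound_scale mA isg inside_energy)).
  apply: (int_bound_le mA ib) => //; first by apply: measurable_funTS; exact/measurable_EFinP.
  move=> x _; have /andP[d0 d1] := dbd x; rewrite normrM (ger0_norm d0) -[u1 x ^+ 2]real_normK ?num_real//.
  set w := `|u1 x|.
  have h : 0 <= sg^-1 * (sg - w) ^+ 2 by apply: mulr_ge0 => //; exact: sqr_ge0.
  have e : sg^-1 * (sg - w) ^+ 2 = sg - 2 * w + sg^-1 * w ^+ 2 by field; rewrite gt_eqF.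
  have h2 : 0 <= dexcess x * (sg^-1 * (sg - w) ^+ 2) by exact: mulr_ge0.
  have h3 : dexcess x * sg <= sg by rewrite ler_piMl// ltW.
  rewrite e in h2; lra.
have [_ T1] := tonelli_rect a1 a2 b1 b2 mf (fun x => ltac:(by rewrite lee_fin)).
have [_ T2] := tonelli_rect a1 a2 b1 b2 mpsi (fun x => ltac:(by rewrite lee_fin)).
split; [exact: measurable_funTS (mc cp)|by []|].
apply: (@le_trans _ _ ((a2 - a1)%:E * \int[leb2]_(x in A) f x)%E); last first.
  have [_ _ h] := fA.
  apply: (@le_trans _ _ ((a2 - a1)%:E * (1 / 2 * (sg * ((a2 - a1) * (b2 - b1)) + sg^-1 * (Lam / nu * (tau * (1 + M)))))%:E)%E).
    by apply: lee_wpmul2l.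
  rewrite -EFinM lee_fin le_eqVlt; apply/orP; left; apply/eqP.
  by set N := sg^-1; set D := nu^-1; field.
rewrite /A T1 T2 -ge0_integralZl//; last first.
- by move=> y _; apply: integral_ge0 => t _; rewrite lee_fin.
- by apply: measurable_funTS; apply: (measurable_partial_integral _ _ mf _).2 => x; rewrite lee_fin.
apply: ge0_le_integral => //.
- by move=> y _; apply: integral_ge0 => t _; rewrite lee_fin.
- by apply: measurable_funTS; apply: (measurable_partial_integral _ _ mpsi _).2 => x; rewrite lee_fin.
- apply: measurable_funTS; apply: measurable_funeM.
  by apply: (measurable_partial_integral _ _ mf _).2 => x; rewrite lee_fin.
move=> y; rewrite /= in_itv/= => yb.
set J := (\int[lebesgue_measure]_(x1 in `[a1, a2]) f (x1, y))%E.
have py (x : R) : a1 <= x <= a2 -> ((excess (x, y))%:E <= J)%E.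
  move=> xa.
  have -> : excess (x, y) = excess (x, y) - excess (a1, y).
    have ux : u (a1, y) < k.
      apply: bd; last exact: Or41.
      by apply/rectP; move: yb => /andP[? ?]; split => //=; exact: ltW.
    rewrite [X in _ - X](_ : _ = 0) ?subr0//; rewrite /excess.
    by have [[_ -> _]|[/andP[? _] _ _]|[? _ _]] := theta_cases (u (a1, y) - k) k0 => //; have := k0; lra.
  have xa1 : a1 <= a1 <= a2 by rewrite lexx ltW.
  have h := @derive_osc R (fun t => excess (t, y)) (fun t => dexcess (t, y) * u1 (t, y)) _ _ _ _
    (fun t => C1_derive1 t y Cpsi) (@continuous_line2 R _ y cp1) xa xa1.
  apply: (le_trans h); rewrite /J.
  exact: lexx.
apply: (@le_trans _ _ (\int[lebesgue_measure]_(x1 in `[a1, a2]) J)%E); last first.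
  by rewrite integral_cst//= lebesgue_measure_itv/= lte_fin a12 -EFinB muleC.
apply: ge0_le_integral => //.
- by move=> x _; rewrite lee_fin.
- by apply: measurable_funTS; apply/measurable_EFinP; apply: continuous_measurable_fun; exact: continuous_line2.
Qed.

End Inside.

Lemma local_truncation_bound (kap sg : R) : 1 <= kap -> kap ^+ 2 = Lam / nu -> 0 < sg ->
  gradient_const * kap * energy_budget * (1 + 3 / 2 * s) < k ^+ 2 / 8 * (s / 4) * (3 / 2 * s) ->
  int_bound (square (s / 2)) (fun x => theta k (u x - k))
    (s * (4 * s ^+ 2 * sg + Lam / nu * (tau * (1 + M)) / sg)).
Proof.
move=> kap1 kapE sg0 /(good_lines kap1 kapE)[a1 [a2 [b1 [b2 []]]]].
move=> /andP[A1 A2] /andP[A3 A4] /andP[A5 A6] /andP[A7 A8] bd; have S0 := s0.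
have a12 : a1 < a2 by lra.
have b12 : b1 < b2 by lra.
have RQ : rect a1 a2 b1 b2 `<=` square s.
  by move=> x /rectP[x1 x2 x3 x4]; apply/rectP; split; lra.
have QR : square (s / 2) `<=` rect a1 a2 b1 b2.
  by move=> x /rectP[x1 x2 x3 x4]; apply/rectP; split; lra.
have mR : measurable (rect a1 a2 b1 b2 : set P) by exact: measurable_rect.
have mQ := measurable_square (s / 2).
have := int_bound_sub mR mQ QR (inside_poincare a12 b12 RQ bd sg0).
apply: int_bound_weak; have M0 : 0 <= M := int_bound_ge0 uM.
have w0 : 0 <= Lam / nu * (tau * (1 + M)) / sg by have := ltW tau0 => ?; nneg.
have h1 : (a2 - a1) / 2 <= s by lra.
have h2 : sg * ((a2 - a1) * (b2 - b1)) <= 4 * s ^+ 2 * sg.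
  rewrite mulrC; apply: ler_wpM2r; first exact: ltW.
  rewrite (_ : 4 * s ^+ 2 = (2 * s) * (2 * s)); last by ring.
  by apply: ler_pM; lra.
apply: ler_pM => //; first lra.
- by apply: addr_ge0 => //; rewrite !mulr_ge0// ?subr_ge0 ltW.
- by rewrite lerD2r.
Qed.

End LocalEstimate.

(** * The estimate for subsolutions on squares *)

Section LocalBound.
Context {R : realType}.
Local Notation mR := (measurableTypeR R).
Local Notation P := (mR * mR)%type.

Lemma Lp2_int_bound (B Q : set (R * R)) f : measurable (B : set P) -> (leb2 (B : set P) < +oo)%E ->
  measurable (Q : set P) -> Q `<=` B -> Lp_on B 2%:E f ->
  exists A, int_bound (Q : set P) (fun x => f x ^+ 2) A.
Proof.
move=> mB Bfin mQ QB fL.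
have i := Lp2_integrable_on mB Bfin mQ QB fL.
exists (fine (\int[leb2]_(x in (Q : set P)) (f x ^+ 2)%:E)); split.
- by apply/measurable_EFinP; exact: measurable_int i.
- by move=> x _; exact: sqr_ge0.
- by rewrite fineK//; exact: integrable_fin_num i.
Qed.

(** [sup_const s * kap * V < k ^+ 2] is the hypothesis of [good_lines] for an
    energy budget of [2 * V]; being strict, it leaves room for the error terms. *)
Definition sup_const (s : R) : R := 2 * gradient_const s * (1 + 3 / 2 * s) * (64 / (3 * s ^+ 2)).

Lemma sqpos_le (x y : R) : sqpos x <= 2 * sqpos y + 2 * (x - y) ^+ 2.
Proof.
rewrite /sqpos; case: (posP x) => -[hx ->]; case: (posP y) => -[hy ->]; rewrite ?expr0n/=.
- by have := sqr_ge0 (x - y); lra.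
- by have := sqr_ge0 (x - y); have := sqr_ge0 y; lra.
- by have := sqr_ge0 (x - y); nra.
- by have := sqr_ge0 (x - 2 * y); nra.
Qed.

Lemma ge0_integral_eq0 (D : set P) (f : R * R -> R) : measurable D -> measurable_fun D (f : P -> mR) ->
  (forall x, D x -> 0 <= f x) -> (\int[leb2]_(x in D) (f x)%:E = 0)%E ->
  {ae leb2, forall x, D x -> f x = 0}.
Proof.
move=> mD mf f0 If.
have mE : measurable_fun D (EFin \o f) by exact/measurable_EFinP.
have := (ae_eq_integral_abs leb2 mD mE).1.
have -> : (\int[leb2]_(x in D) `|(EFin \o f) x| = 0)%E.
  by rewrite -[RHS]If; apply: eq_integral => x; rewrite inE => Dx; rewrite gee0_abs// lee_fin f0.
move=> /(_ erefl); apply: filterS => x h Dx.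
by have [] := h Dx.
Qed.

(** For a small parameter [sg], approximate with [tau = sg^2]. All errors are
    then of order [sg]: in the energy through [tau / sg], and in replacing [u]
    by [v] because [2 |u - v| <= sg + (u - v)^2 / sg]. As [sg] tends to 0 the
    integral of [theta(v - k)] is seen to vanish. *)
Lemma local_bound (B : set (R * R)) (nu Lam : R) (a : R * R -> 'M[R]_2) (v : R * R -> R)
    (g : R * R -> 'cV[R]_2) (z : R * R) (s m V k kap : R) :
  measurable (B : set P) -> (leb2 (B : set P) < +oo)%E -> 0 < nu -> nu <= Lam ->
  bounded_elliptic B nu Lam a -> Lp_on B 2%:E v -> L2_weak_gradient B v g ->
  (forall phi, C1c B phi -> (forall x, 0 <= phi x) ->
      \int[leb2]_(x in B) dot (a x *m g x) (grad phi x) <= 0) ->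
  0 < s -> 0 < m -> (forall x, square z s x -> rect (x.1 - m) x.1 (x.2 - m) x.2 `<=` B) ->
  int_bound B (fun x => sqpos (v x)) V ->
  0 < k -> 1 <= kap -> kap ^+ 2 = Lam / nu -> sup_const s * kap * V < k ^+ 2 ->
  {ae leb2, forall x : P, square z (s / 2) x -> v x <= k}.
Proof.
move=> mB Bfin nu0 nuLam ea vL wg sub s0 m0 mQB vV k0 kap1 kapE kV.
have mQ : measurable (square z s : set P) by exact: measurable_square.
have mQ2 : measurable (square z (s / 2) : set P) by exact: measurable_square.
have QQ : square z (s / 2) `<=` square z s by apply: square_sub; lra.
have QB : square z s `<=` B.
  by move=> x /mQB; apply; apply/rectP; move: m0; clear=> *; split; lra.
have gL i : Lp_on B 2%:E (fun x => g x i 0) by have [] := wg i.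
have [N0 vN] := Lp2_int_bound mB Bfin mQ QB vL.
have [N1 gN1] := Lp2_int_bound mB Bfin mQ QB (gL 0).
have [N2 gN2] := Lp2_int_bound mB Bfin mQ QB (gL 1).
pose N := N0 + N1 + N2; pose M := 2 * N + 4.
have iN := int_bound_add mQ (int_bound_add mQ vN gN1) gN2.
have N_ge0 : 0 <= N := int_bound_ge0 iN.
have M0 : 0 <= M by rewrite /M; lra.
have V0 : 0 <= V := int_bound_ge0 vV.
have kap0 : 0 < kap by apply: lt_le_trans kap1.
have lam0 : 0 <= Lam / nu by rewrite -kapE sqr_ge0.
have K10 : 0 < gradient_const s.
  apply: ltr_pwDl; first by rewrite ltr0n.
  by apply: mulr_ge0; [exact: ler0n|apply: le_trans (cutoff_const_ge2 s); exact: ler0n].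
have ss0 : 0 < s ^+ 2 by rewrite exprn_gt0.
have K20 : 0 < sup_const s.
  by rewrite /sup_const !mulr_gt0 ?invr_gt0 ?mulr_gt0//; lra.
(* The strict inequality assumed on [k] leaves this much room for [sg]. *)
pose del := (k ^+ 2 - sup_const s * kap * V) / (1 + sup_const s * kap * (2 + M)).
have M2 : 0 < 2 + M by apply: ltr_pwDl.
have KK : 0 < sup_const s * kap by exact: mulr_gt0.
have KM : 0 < sup_const s * kap * (2 + M) by exact: mulr_gt0.
have den0 : 0 < 1 + sup_const s * kap * (2 + M).
  by apply: ltr_pwDl; [exact: ltr01|exact: ltW KM].
have del0 : 0 < del by apply: divr_gt0 den0; rewrite subr_gt0.
pose C := s * (4 * s ^+ 2 + Lam / nu * (1 + M)) + s ^+ 2 + 1.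
have C_gt0 : 0 < C.
  have M1 : 0 <= 1 + M by apply: addr_ge0.
  by have := ltW s0 => ?; have := ltW ss0 => ?; apply: ltr_wpDl; [nneg|exact: ltr01].
have mv : measurable_fun (square z s : set P) (v : P -> mR).
  by have [mv _ _] := Lp2_restrict mB Bfin vL; exact: measurable_on_sub mv.
have mth : measurable_fun (square z (s / 2) : set P) ((fun x => theta k (v x - k)) : P -> mR).
  apply: (measurable_funS mQ QQ).
  apply: (measurableT_comp (f := theta k)); last exact: measurable_funB.
  by apply: continuous_measurable_fun; exact: is_derive_continuous (fun t => theta_derive t k0).
have th0 x : 0 <= theta k (v x - k) by exact: theta_ge0.
have main (sg : R) : 0 < sg -> sg <= 1 -> sg <= del ->
    int_bound (square z (s / 2)) (fun x => theta k (v x - k)) (sg * C).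
  move=> sg0 sg1 sgdel.
  pose tau := sg ^+ 2; have tau0 : 0 < tau by rewrite exprn_gt0.
  have tau_sg : tau <= sg by rewrite /tau expr2 ler_piMl// ltW.
  (* The two components of the gradient share the error [tau ^+ 2]. *)
  pose d := tau ^+ 2 / 2; have d0 : 0 < d by rewrite divr_gt0 ?exprn_gt0.
  have d1 : d <= 1 / 2.
    by rewrite /d; apply: ler_wpM2r => //; rewrite expr_le1 ?(ltW tau0)// (le_trans tau_sg).
  have [u [u1 [u2 [Cu e0 e1 e2]]]] := C1_approximation mB Bfin vL wg mQ m0 mQB d0.
  have cu := C1_continuous Cu; have [cu1 cu2 _] := Cu.
  have mu (f : R * R -> R) : continuous f -> measurable_fun (square z s : set P) (f : P -> mR).
    by move=> cf; apply: measurable_funTS; exact: continuous_measurable2.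
  have mg i : measurable_fun (square z s : set P) (fun x : P => g x i 0 : mR).
    by have [mg _ _] := Lp2_restrict mB Bfin (gL i); exact: measurable_on_sub mg.
  have b0 : int_bound (square z s) (fun x => (u x - v x) ^+ 2) d.
    split => //; last by move=> x _; exact: sqr_ge0.
    by apply: measurable_funX; apply: measurable_funB => //; exact: mu.
  have b1 : int_bound (square z s) (fun x => (u1 x - g x 0 0) ^+ 2) d.
    split => //; last by move=> x _; exact: sqr_ge0.
    by apply: measurable_funX; apply: measurable_funB; [exact: mu|exact: mg].
  have b2 : int_bound (square z s) (fun x => (u2 x - g x 1 0) ^+ 2) d.
    split => //; last by move=> x _; exact: sqr_ge0.
    by apply: measurable_funX; apply: measurable_funB; [exact: mu|exact: mg].
  have gerr : int_bound (square z s) (fun x => (u1 x - g x 0 0) ^+ 2 + (u2 x - g x 1 0) ^+ 2) (tau ^+ 2).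
    by apply: int_bound_weak (int_bound_add mQ b1 b2); rewrite /d; clear; lra.
  have uX : int_bound (square z s) (fun x => sqpos (u x)) (2 * V + tau ^+ 2).
    apply: (int_bound_weak _ (int_bound_le mQ (int_bound_add mQ
      (int_bound_scale mQ (ler0n R 2) (int_bound_sub mB mQ QB vV)) (int_bound_scale mQ (ler0n R 2) b0)) _ _ _)).
    - by rewrite /d; clear; lra.
    - apply: measurable_funX; apply: (mu (pos \o u)) => x.
      by apply: continuous_comp; [exact: cu|exact: pos_continuous].
    - by move=> x _; exact: sqr_ge0.
    - by move=> x _; exact: sqpos_le.
  have uM : int_bound (square z s) (fun x => u x ^+ 2 + u1 x ^+ 2 + u2 x ^+ 2) M.
    apply: (int_bound_weak _ (int_bound_le mQ (int_bound_add mQ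
      (int_bound_scale mQ (ler0n R 2) iN)
      (int_bound_scale mQ (ler0n R 2) (int_bound_add mQ (int_bound_add mQ b0 b1) b2))) _ _ _)).
    - by rewrite /M /N; move: d1; clear; lra.
    - by apply: measurable_funD; [apply: measurable_funD|]; apply: measurable_funX; exact: mu.
    - by move=> x _; nneg.
    - move=> x _; have h (p q : R) : p ^+ 2 <= 2 * q ^+ 2 + 2 * (p - q) ^+ 2.
        by have := sqr_ge0 (p - 2 * q); clear; nra.
      by have := h (u x) (v x); have := h (u1 x) (g x 0 0); have := h (u2 x) (g x 1 0); clear; lra.
  have cond : gradient_const s * kap * energy_budget tau (2 * V + tau ^+ 2) M * (1 + 3 / 2 * s) < k ^+ 2 / 8 * (s / 4) * (3 / 2 * s).
    have Yle : energy_budget tau (2 * V + tau ^+ 2) M <= 2 * V + sg * (2 + M).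
      have t2 : tau ^+ 2 <= tau by rewrite expr2 ler_piMl ?(ltW tau0)// (le_trans tau_sg).
      have t3 : tau * (1 + M) <= sg * (1 + M) by apply: ler_wpM2r tau_sg; exact: addr_ge0.
      by rewrite /energy_budget; move: t2 t3 tau_sg; clear; lra.
    have dE : sup_const s * kap * V + del * (1 + sup_const s * kap * (2 + M)) = k ^+ 2.
      by rewrite /del divfK; [ring|rewrite gt_eqF].
    have h1 : sg * (sup_const s * kap * (2 + M)) <= del * (sup_const s * kap * (2 + M)).
      by apply: ler_wpM2r sgdel; exact: ltW.
    have h2 : sup_const s * kap * (2 * V + sg * (2 + M)) < 2 * k ^+ 2.
      have := mulr_ge0 (mulr_ge0 (ltW KK) (ltW sg0)) (addr_ge0 (ler0n R 2) M0); by rewrite -dE; move: h1 del0; clear; lra.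
    have h3 : gradient_const s * kap * (2 * V + sg * (2 + M)) * (1 + 3 / 2 * s) < 3 / 64 * s ^+ 2 * k ^+ 2.
      have q0 : 0 < 3 / 128 * s ^+ 2 by rewrite mulr_gt0.
      have := h2; rewrite -(ltr_pM2l q0) => h4.
      rewrite (_ : gradient_const s * kap * _ * _ = 3 / 128 * s ^+ 2 * (sup_const s * kap * (2 * V + sg * (2 + M)))).
        by apply: (lt_le_trans h4); clear; lra.
      by rewrite /sup_const; field; rewrite gt_eqF.
    rewrite (_ : k ^+ 2 / 8 * _ * _ = 3 / 64 * s ^+ 2 * k ^+ 2); last by field.
    apply: le_lt_trans h3; apply: ler_wpM2r; first by move: s0; clear; lra.
    by apply: ler_wpM2l Yle; apply: mulr_ge0; exact: ltW.
  have tb := local_truncation_bound mB Bfin nu0 nuLam ea gL sub s0 QB Cu tau0 k0 gerr uX uM kap1 kapE sg0 cond.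
  have isg : 0 <= sg^-1 by rewrite invr_ge0 ltW.
  have half0 : 0 <= (1 / 2 : R) by rewrite divr_ge0.
  have zs (c : R) : c - s / 2 <= c + s / 2 by move: s0; clear; lra.
  have ib := int_bound_add mQ2 tb (int_bound_scale mQ2 half0 (int_bound_add mQ2
     (int_bound_cst (zs z.1) (zs z.2) (ltW sg0)) (int_bound_scale mQ2 isg (int_bound_sub mQ mQ2 QQ b0)))).
  apply: (int_bound_weak _ (int_bound_le mQ2 ib mth _ _)) => //.
  - rewrite (_ : Lam / nu * (tau * (1 + M)) / sg = sg * (Lam / nu * (1 + M))); last first.
      by rewrite /tau; field; rewrite !gt_eqF.
    rewrite (_ : sg^-1 * d = sg * (tau / 2)); last by rewrite /d /tau; field; rewrite gt_eqF.
    have t1 : sg * (tau / 2) <= sg * 1.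
      by apply: ler_wpM2l; [exact: ltW|move: tau_sg sg1; clear; lra].
    have t2 : 0 <= sg * s ^+ 2 by rewrite mulr_ge0// ltW.
    by rewrite /C; move: t1 t2 sg0; clear; lra.
  - move=> x _.
    have h1 := theta_lip (v x - k) (u x - k) k0.
    have h2 := le_trans (ler_norm _) h1.
    rewrite (_ : v x - k - (u x - k) = - (u x - v x)) in h2; last by ring.
    rewrite normrN in h2; rewrite -[(u x - v x) ^+ 2]real_normK ?num_real//.
    set w := `|u x - v x| in h2 *.
    have h : 0 <= sg^-1 * (sg - w) ^+ 2 by apply: mulr_ge0 => //; exact: sqr_ge0.
    have e : sg^-1 * (sg - w) ^+ 2 = sg - 2 * w + sg^-1 * w ^+ 2 by field; rewrite gt_eqF.
    by rewrite e in h; move: h h2; clear; lra.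
have I0 : (\int[leb2]_(x in (square z (s / 2) : set P)) (theta k (v x - k))%:E = 0)%E.
  apply/eqP; rewrite eq_le; apply/andP; split; last by apply: integral_ge0 => x _; rewrite lee_fin.
  apply/lee_addgt0Pr => e e0; rewrite add0e.
  pose sg := Num.min (Num.min 1 del) (e / C).
  have eC : 0 < e / C by rewrite divr_gt0.
  have sg0 : 0 < sg by rewrite /sg !lt_min ltr01 del0 eC.
  have [|||_ _ h] := main sg => //; rewrite /sg ?ge_min ?lexx ?orbT//.
  apply: (le_trans h); rewrite lee_fin -ler_pdivlMr//.
  by rewrite /sg ge_min lexx orbT.
have := ge0_integral_eq0 mQ2 mth (fun x _ => th0 x) I0.
apply: filterS => x h Qx; rewrite leNgt; apply/negP => kv.
have : 0 < theta k (v x - k) by apply: theta_gt0; rewrite ?subr_gt0.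
by rewrite h// ltxx.
Qed.

End LocalBound.

(** * The estimate on discs *)

Section SupEstimate.
Context {R : realType}.
Local Notation mR := (measurableTypeR R).
Local Notation P := (mR * mR)%type.

Lemma leb2_disk_gt0 (x0 : R * R) (r : R) : 0 < r -> (0 < leb2 (disk x0 r : set P))%E.
Proof.
move=> r0.
have sub : rect (x0.1 - r / 2) (x0.1 + r / 2) (x0.2 - r / 2) (x0.2 + r / 2) `<=` disk x0 r.
  move=> x /rectP[h1 h2 h3 h4]; rewrite /disk /=.
  have a1 : (x.1 - x0.1) ^+ 2 <= (r / 2) ^+ 2.
    by rewrite -[_ ^+ 2]real_normK ?num_real// ler_sqr ?nnegrE ?normr_ge0 ?divr_ge0 ?(ltW r0)// ler_norml; apply/andP; split; lra.
  have a2 : (x.2 - x0.2) ^+ 2 <= (r / 2) ^+ 2.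
    by rewrite -[_ ^+ 2]real_normK ?num_real// ler_sqr ?nnegrE ?normr_ge0 ?divr_ge0 ?(ltW r0)// ler_norml; apply/andP; split; lra.
  have : 0 < r ^+ 2 by rewrite exprn_gt0.
  by rewrite expr_div_n in a1 a2; lra.
apply: (@lt_le_trans _ _ (leb2 (rect (x0.1 - r / 2) (x0.1 + r / 2) (x0.2 - r / 2) (x0.2 + r / 2) : set P))).
  by rewrite leb2_rect; [rewrite lte_fin mulr_gt0//; lra|lra|lra].
by apply: le_measure => //; rewrite inE; [exact: measurable_rect|exact: measurable_disk].
Qed.

Definition node (x0 : R * R) (s : R) (ij : int * int) : R * R :=
  (x0.1 + ij.1%:~R * s, x0.2 + ij.2%:~R * s).

Lemma node_cover (x0 : R * R) (s : R) (y : R * R) : 0 < s -> exists ij, square (node x0 s ij) (s / 2) y.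
Proof.
move=> s0; pose i (a b : R) := Num.floor ((a - b) / s + 1 / 2).
have iP (a b : R) : b + (i a b)%:~R * s - s / 2 <= a /\ a <= b + (i a b)%:~R * s + s / 2.
  have := floor_itv ((a - b) / s + 1 / 2); rewrite -/(i a b) intrD => /andP[h1 h2].
  set n : R := (i a b)%:~R in h1 h2 *.
  have e : a - b = (a - b) / s * s by rewrite divfK ?gt_eqF.
  set w := (a - b) / s in h1 h2 e.
  have h3 : (n - 1 / 2) * s <= w * s by apply: ler_wpM2r; [exact: ltW|lra].
  have h4 : w * s <= (n + 1 / 2) * s by apply: ler_wpM2r; [exact: ltW|rewrite mulr1z in h2; lra].
  by split; lra.
exists (i y.1 x0.1, i y.2 x0.2); apply/rectP => /=.
by have [? ?] := iP y.1 x0.1; have [? ?] := iP y.2 x0.2.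
Qed.

(** [|p + q|^2 <= 2 |p|^2 + 2 |q|^2] with [|p| < r / 2] and [|q|^2 <= r^2 / 8]. *)
Lemma disk_margin (x0 z w y : R * R) (r : R) : 0 < r -> disk x0 (r / 2) y ->
  `|w.1 - y.1| <= r / 4 -> `|w.2 - y.2| <= r / 4 -> disk x0 r w.
Proof.
move=> r0; rewrite /disk /= => yd w1 w2.
have sq (t : R) : `|t| <= r / 4 -> t ^+ 2 <= r ^+ 2 / 16.
  move=> h; rewrite -real_normK ?num_real// (_ : r ^+ 2 / 16 = (r / 4) ^+ 2); last by field.
  by rewrite ler_sqr ?nnegrE// divr_ge0// ltW.
have := sq _ w1; have := sq _ w2.
have := sqr_ge0 (2 * y.1 - x0.1 - w.1); have := sqr_ge0 (2 * y.2 - x0.2 - w.2).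
have r2 : 0 < r ^+ 2 by rewrite exprn_gt0.
move: yd; rewrite expr_div_n; nra.
Qed.

(** The squares of half-side [r / 16] around the nodes of a grid of mesh [r / 8]
    cover the plane; those that meet the smaller disc have room for
    [local_bound] in the larger one. There are countably many of them. *)
Lemma ess_sup_bound (x0 : R * R) (r nu Lam : R) (a : R * R -> 'M[R]_2) (v : R * R -> R) (V k kap : R) :
  0 < r -> 0 < nu -> nu <= Lam -> bounded_elliptic (disk x0 r) nu Lam a -> W12 (disk x0 r) v ->
  subsolution (disk x0 r) a v -> int_bound (disk x0 r : set P) (fun x => sqpos (v x)) V ->
  0 < k -> 1 <= kap -> kap ^+ 2 = Lam / nu -> sup_const (r / 8) * kap * V < k ^+ 2 ->
  (ess_sup_on (disk x0 (r / 2)) v <= k%:E)%E.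
Proof.
move=> r0 nu0 nuLam ea [vL _] [g wg sub] vV k0 kap1 kapE kV.
have s0 : 0 < r / 8 by rewrite divr_gt0.
have m0 : 0 < r / 16 by rewrite divr_gt0.
apply/ess_supP.
pose z n := if unpickle n is Some ij then node x0 (r / 8) ij else x0.
have loc n : {ae leb2, forall x : P, disk x0 (r / 2) x -> square (z n) (r / 8 / 2) x -> v x <= k}.
  have [[y [yd yz]]|no] := pselect (exists y, disk x0 (r / 2) y /\ square (z n) (r / 8 / 2) y); last first.
    by apply: aeW => x /= xd xz; exfalso; apply: no; exists x.
  have inside x : square (z n) (r / 8) x -> rect (x.1 - r / 16) x.1 (x.2 - r / 16) x.2 `<=` disk x0 r.
    move=> /rectP[h1 h2 h3 h4] w /rectP[w1 w2 w3 w4]; have [y1 y2 y3 y4] := (rectP _ _ _ _ _).1 yz.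
    by apply: (disk_margin x0 r0 yd); rewrite ler_norml; apply/andP;
      move: h1 h2 h3 h4 w1 w2 w3 w4 y1 y2 y3 y4 r0; clear=> *; split; lra.
  have := local_bound (measurable_disk x0 r) (leb2_disk_fin x0 r0) nu0 nuLam ea vL wg sub s0 m0 inside vV k0 kap1 kapE kV.
  by apply: filterS => x h _; exact: h.
have := ae_foralln loc; apply: filterS => x h; rewrite /patch; case: ifPn => [|_]; last exact: leNye.
rewrite inE => xd; rewrite /= lee_fin.
have [ij xij] := node_cover x0 x s0.
by apply: (h (pickle ij)) => //; rewrite /z pickleK.
Qed.

(** The bound is the square root of [sup_const * kap * int v_+^2] with [kap] the
    square root of [Lam / nu], whence the fourth root; the area [b] turns the
    integral into an average. *)
Lemma sup_estimate_quarter (x0 : R * R) (r : R) : 0 < r -> exists c : R, sup_estimate x0 r c (4^-1).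
Proof.
move=> r0; have Bfin := leb2_disk_fin x0 r0; have Bpos := leb2_disk_gt0 x0 r0.
set B := disk x0 r in Bfin Bpos.
have mB : measurable (B : set P) by exact: measurable_disk.
pose b := fine (leb2 (B : set P)).
have b0 : 0 < b by rewrite fine_gt0// Bpos.
exists (Num.sqrt (sup_const (r / 8) * b)) => nu Lam a v nu0 nuLam ea vW sub.
have vL : Lp_on B 2%:E v by have [] := vW.
have [A vA] := Lp2_int_bound mB Bfin mB (@subset_refl _ B) vL.
have [mv _ _] := Lp2_restrict mB Bfin vL.
have iA : int_bound (B : set P) (fun x => sqpos (v x)) A.
  apply: (int_bound_le mB vA).
  - apply: (measurableT_comp (f := (sqpos : mR -> mR))); last exact: measurable_on_sub mv.
    by apply: continuous_measurable_fun; exact: is_derive_continuous sqpos_derive.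
  - by move=> x _; exact: sqr_ge0.
  - by move=> x _; rewrite /sqpos; case: (posP (v x)) => -[h ->]; rewrite ?expr0n ?sqr_ge0.
pose V := \int[leb2]_(x in B) sqpos (v x).
have vV : int_bound (B : set P) (fun x => sqpos (v x)) V.
  have [m1 p1 l1] := iA; split => //; rewrite /V /Rintegral fineK//.
  rewrite ge0_fin_numE; first exact: le_lt_trans l1 (ltry _).
  by apply: integral_ge0 => x _; rewrite lee_fin sqr_ge0.
have V0 : 0 <= V := int_bound_ge0 vV.
have lam0 : 0 <= Lam / nu by rewrite divr_ge0 ?(ltW nu0)// (le_trans (ltW nu0)).
pose kap := Num.sqrt (Lam / nu).
have kapE : kap ^+ 2 = Lam / nu by rewrite /kap sqr_sqrtr.
have kap1 : 1 <= kap by rewrite /kap -[1]sqrtr1 ler_wsqrtr// ler_pdivlMr// mul1r.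
have K0 : 0 <= sup_const (r / 8).
  have s0 : 0 <= r / 8 by rewrite divr_ge0// ltW.
  have k1 : 0 <= gradient_const (r / 8).
    apply: addr_ge0; first exact: ler0n.
    by apply: mulr_ge0; [exact: ler0n|apply: le_trans (cutoff_const_ge2 _); exact: ler0n].
  rewrite /sup_const; set s := r / 8 in s0 k1 *; set q := gradient_const s in k1 *.
  apply: mulr_ge0; first by apply: mulr_ge0; [apply: mulr_ge0|lra].
  by apply: divr_ge0; [exact: ler0n|apply: mulr_ge0 => //; exact: sqr_ge0].
pose T := Num.sqrt (sup_const (r / 8) * kap * V).
have T0 : 0 <= T by exact: sqrtr_ge0.
have Tsq : T ^+ 2 = sup_const (r / 8) * kap * V.
  by rewrite sqr_sqrtr// mulr_ge0// mulr_ge0// (le_trans _ kap1).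
have -> : Num.sqrt (sup_const (r / 8) * b) * (Lam / nu) `^ 4^-1 * Num.sqrt (average B (fun x => Num.max (v x) 0 ^+ 2)) = T.
  have -> : (Lam / nu) `^ 4^-1 = Num.sqrt kap.
    rewrite (_ : 4^-1 = 2^-1 * 2^-1 :> R); last by field.
    by rewrite powRrM !powR12_sqrt// powR_ge0.
  rewrite /average -/(B) -[fine _]/b -[\int[_]_(x in _) _]/V.
  rewrite -sqrtrM; last by rewrite mulr_ge0// ltW.
  rewrite -sqrtrM; last by rewrite mulr_ge0 ?(le_trans _ kap1)// mulr_ge0// ltW.
  by rewrite /T; congr Num.sqrt; field; rewrite gt_eqF.
apply/lee_addgt0Pr => e e0; rewrite -EFinD.
apply: (ess_sup_bound r0 nu0 nuLam ea vW sub vV _ kap1 kapE); first by rewrite ltr_wpDl.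
by rewrite -Tsq ltr_sqr ?nnegrE ?addr_ge0 ?(ltW e0)// ltrDl.
Qed.

End SupEstimate.

(** * Integration by parts for smooth functions *)

Section BoundedLp.
Context {R : realType}.
Local Notation mR := (measurableTypeR R).
Local Notation P := (mR * mR)%type.
Variables (x0 : R * R) (r : R).
Hypothesis r0 : 0 < r.
Let B := disk x0 r.
Let mB : measurable (B : set P). Proof. exact: measurable_disk. Qed.
Let Bfin : (leb2 (B : set P) < +oo)%E. Proof. exact: leb2_disk_fin. Qed.

Lemma continuous_bounded_disk (f : R * R -> R) : continuous f ->
  exists2 C : R, 0 <= C & forall x, `|(f \_ B) x| <= C.
Proof.
move=> cf; have [C C0 fC] := continuous_bounded_rect (x0.1 - r) (x0.1 + r) (x0.2 - r) (x0.2 + r) cf.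
exists C => // x; rewrite patchE; case: ifPn; last by rewrite normr0.
by rewrite inE => xB; apply: fC; exact: sub_disk_rect.
Qed.

Lemma restrict_continuous_measurable (f : R * R -> R) : continuous f -> measurable_fun [set: P] (f \_ B : P -> mR).
Proof.
move=> cf; apply/(measurable_restrictT _ _).1; first exact: mB.
by apply: measurable_funTS; exact: continuous_measurable2.
Qed.

Lemma continuous_Lp2_on (f : R * R -> R) : continuous f -> Lp_on B 2%:E f.
Proof.
move=> cf; have [C C0 fC] := continuous_bounded_disk cf.
rewrite /Lp_on inE; apply/andP; split; rewrite inE; first exact: restrict_continuous_measurable.
rewrite /= /finite_norm unlock; apply: poweR_lty.
have -> : (\int[leb2]_x `|(EFin \o f \_ B) x| `^ 2 = \int[leb2]_x ((f \_ B) x ^+ 2)%:E)%E.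
  by apply: eq_integral => x _; rewrite /= powR_mulrn// real_normK ?num_real.
apply: (@le_lt_trans _ _ (\int[leb2]_(x in (B : set P)) (C ^+ 2)%:E)%E); last first.
  by rewrite integral_cst// lte_mul_pinfty ?lee_fin ?sqr_ge0.
rewrite [leRHS]integral_mkcond; apply: ge0_le_integral => //.
- by move=> x _; rewrite lee_fin sqr_ge0.
- by apply/measurable_EFinP; apply: measurable_funX; exact: restrict_continuous_measurable.
- by apply/(measurable_restrictT _ _).1; [exact: mB|exact: measurable_cst].
- move=> x _; have := fC x; rewrite !patchE; case: ifPn => _ h; rewrite lee_fin ?expr0n//.
  by rewrite -real_normK ?num_real// ler_sqr ?nnegrE.
Qed.

Lemma cst_Lpoo_on (c : R) : Lp_on B +oo%E (fun=> c).
Proof.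
have cc : continuous (fun _ : R * R => c) by exact: cst_continuous.
rewrite /Lp_on inE; apply/andP; split; rewrite inE; first exact: restrict_continuous_measurable.
rewrite /= /finite_norm unlock; case: ifP => // _.
apply: (@le_lt_trans _ _ `|c|%:E); last exact: ltry.
apply/ess_supP; apply: aeW => x /=; rewrite patchE lee_fin.
by case: ifP; rewrite ?normr0.
Qed.

Lemma continuous_integrable_disk (f : R * R -> R) : continuous f -> leb2.-integrable (B : set P) (EFin \o f).
Proof.
move=> cf; apply: integrableS (continuous_integrable_rect (x0.1 - r) (x0.1 + r) (x0.2 - r) (x0.2 + r) cf) => //.
- exact: measurable_rect.
- exact: sub_disk_rect.
Qed.

(** Integrate along lines between the sides of a square, where [p] vanishes.
    Adding a constant to the derivative makes it nonnegative, so that Tonelli's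
    theorem applies; its contribution cancels in the end. *)
Lemma compact_derivative_integral (p p1 p2 : R * R -> R) : C1 p p1 p2 ->
  (forall x, ~ B x -> \forall y \near x, p y = 0) ->
  \int[leb2]_(x in B) p1 x = 0 /\ \int[leb2]_(x in B) p2 x = 0.
Proof.
move=> Cp pB; have [c1 c2 _] := Cp.
have p0 x : ~ B x -> p x = 0 by move=> /pB/nbhs_singleton.
have p120 x : ~ B x -> p1 x = 0 /\ p2 x = 0 by move=> /pB; exact: C1_near0.
pose a := x0.1 - r; pose b := x0.1 + r; pose c := x0.2 - r; pose d := x0.2 + r.
have ab : a < b by have := r0; rewrite /a /b; lra.
have cd : c < d by have := r0; rewrite /c /d; lra.
have BQ : B `<=` rect a b c d by exact: sub_disk_rect.
have mQ : measurable (rect a b c d : set P) by exact: measurable_rect.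
have bdry (x y : R) : (x = a \/ x = b) \/ (y = c \/ y = d) -> p (x, y) = 0.
  move=> h; apply: p0; rewrite /B /disk /= => xy.
  have r2 : 0 < r ^+ 2 by rewrite exprn_gt0.
  have := sqr_ge0 (x - x0.1); have := sqr_ge0 (y - x0.2).
  by case: h => -[h|h]; move: xy; rewrite h /a /b /c /d; nra.
have toQ (q : R * R -> R) : (forall x, ~ B x -> q x = 0) ->
    \int[leb2]_(x in B) q x = \int[leb2]_(x in (rect a b c d : set P)) q x.
  move=> q0; rewrite Rintegral_mkcond [RHS]Rintegral_mkcond; apply: eq_Rintegral => x _.
  rewrite /patch; case: ifPn => xB; case: ifPn => xQ //.
  - by move: xQ; rewrite notin_setE => nQ; exfalso; apply: nQ; apply: BQ; rewrite inE in xB.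
  - by move: xB; rewrite notin_setE => /q0.
have shift (q : R * R -> R) : continuous q ->
    (forall C : R, (forall x, rect a b c d x -> 0 <= q x + C) ->
       (\int[leb2]_(x in (rect a b c d : set P)) `|q x + C|%:E = (C * ((b - a) * (d - c)))%:E)%E) ->
    \int[leb2]_(x in (rect a b c d : set P)) q x = 0.
  move=> cq H; have [C C0 qC] := continuous_bounded_rect a b c d cq.
  have qC0 x : rect a b c d x -> 0 <= q x + C.
    by move=> /qC; rewrite ler_norml => /andP[? _]; lra.
  have := H C qC0.
  have -> : (\int[leb2]_(x in (rect a b c d : set P)) `|q x + C|%:E =
             \int[leb2]_(x in (rect a b c d : set P)) ((EFin \o q) x + (EFin \o cst C) x))%E.
    by apply: eq_integral => x; rewrite inE => /qC0 h; rewrite ger0_norm.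
  have cC : continuous (fun _ : R * R => C) by exact: cst_continuous.
  have iq := continuous_integrable_rect a b c d cq.
  rewrite integralD//; last exact: (continuous_integrable_rect a b c d cC).
  have IC : (\int[leb2]_(x in (rect a b c d : set P)) cst C%:E x = (C * ((b - a) * (d - c)))%:E)%E.
    by rewrite integral_cst// leb2_rect ?(ltW ab) ?(ltW cd).
  have -> : (\int[leb2]_(x in (rect a b c d : set P)) (EFin \o cst C) x = (C * ((b - a) * (d - c)))%:E)%E.
    exact: IC.
  rewrite -(fineK (integrable_fin_num mQ iq)) -EFinD => -[].
  by rewrite /Rintegral /= => h; apply: (addIr (C * ((b - a) * (d - c)))); rewrite h add0r.
have mabs (q : R * R -> R) (C : R) : continuous q -> measurable_fun [set: P] (fun x : P => `|q x + C|%:E).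
  move=> cq; apply/measurable_EFinP; apply: measurableT_comp => //.
  by apply: measurable_funD => //; exact: continuous_measurable2.
have line (F F' : R -> R) (C e f : R) : e < f -> (forall t, is_derive t (1 : R) F (F' t)) -> continuous F' ->
    F e = 0 -> F f = 0 -> (forall t, e <= t <= f -> 0 <= F' t + C) ->
    (\int[lebesgue_measure]_(t in `[e, f]) `|F' t + C|%:E = (C * (f - e))%:E)%E.
  move=> ef dF cF' Fe Ff pos.
  have -> : (\int[lebesgue_measure]_(t in `[e, f]) `|F' t + C|%:E =
     \int[lebesgue_measure]_(t in `[e, f]) (F' t + C)%:E)%E.
    by apply: eq_integral => t; rewrite inE /= in_itv/= => /pos h; rewrite ger0_norm.
  have dG t : is_derive t (1 : R) (fun t => F t + C * t) (F' t + C).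
    apply: is_derive_eq; rewrite /GRing.scale/=; ring.
  have cG : continuous (fun t => F' t + C).
    by move=> t; apply: cvgD; [exact: cF'|exact: cvg_cst].
  by rewrite (FTC2_everywhere ef dG cG) Fe Ff; congr EFin; ring.
split.
- rewrite toQ => [|x /p120[]//]; apply: shift => // C pos.
  have [_ ->] := @tonelli_rect R _ a b c d (mabs _ C c1) (fun x => ltac:(by rewrite lee_fin)).
  rewrite (eq_integral (fun=> (C * (b - a))%:E)); last first.
    move=> y; rewrite inE /= in_itv/= => /andP[y1 y2].
    apply: (line (fun x => p (x, y)) (fun x => p1 (x, y))) => //.
    + by move=> t; exact: C1_derive1 Cp.
    + exact: continuous_line2.
    + by apply: bdry; left; left.
    + by apply: bdry; left; right.
    + by move=> t /andP[t1 t2]; apply: pos; apply/rectP.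
  by rewrite integral_cst//= lebesgue_measure_itv/= lte_fin cd -EFinB -EFinM mulrA.
- rewrite toQ => [|x /p120[]//]; apply: shift => // C pos.
  have [-> _] := @tonelli_rect R _ a b c d (mabs _ C c2) (fun x => ltac:(by rewrite lee_fin)).
  rewrite (eq_integral (fun=> (C * (d - c))%:E)); last first.
    move=> x; rewrite inE /= in_itv/= => /andP[x1 x2].
    apply: (line (fun y => p (x, y)) (fun y => p2 (x, y))) => //.
    + by move=> t; exact: C1_derive2 Cp.
    + exact: continuous_line1.
    + by apply: bdry; right; left.
    + by apply: bdry; right; right.
    + by move=> t /andP[t1 t2]; apply: pos; apply/rectP.
  by rewrite integral_cst//= lebesgue_measure_itv/= lte_fin ab -EFinB -EFinM -mulrA [(d - c) * _]mulrC.
Qed.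

Lemma C1c_C1 phi : C1c B phi -> C1 phi (fun x => grad phi x 0 0) (fun x => grad phi x 1 0) /\
  forall x, ~ B x -> \forall y \near x, phi y = 0.
Proof.
move=> [dphi cphi _ sphi]; split; first exact: differentiable_C1.
move=> x xB; have : nbhs x (~` closure [set x | phi x != 0]).
  apply: open_nbhs_nbhs; split; first by apply: closed_openC; exact: closed_closure.
  by move=> /sphi.
by apply: filterS => y ny; apply: contrapT => /eqP py; apply: ny; exact: subset_closure.
Qed.

(** The derivative of the product [v phi] has integral zero. *)
Lemma C1_weak_gradient (v v1 v2 : R * R -> R) : C1 v v1 v2 ->
  L2_weak_gradient B v (fun x => \col_i (if i == 0 then v1 x else v2 x)).
Proof.
move=> Cv; have [c1 c2 _] := Cv; have cv := C1_continuous Cv.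
have prod (phi : R * R -> R) : C1c B phi ->
    \int[leb2]_(x in B) (v x * grad phi x 0 0) = - (\int[leb2]_(x in B) (v1 x * phi x)) /\
    \int[leb2]_(x in B) (v x * grad phi x 1 0) = - (\int[leb2]_(x in B) (v2 x * phi x)).
  move=> /C1c_C1[Cphi phi0]; have [d1 d2 _] := Cphi; have cphi := C1_continuous Cphi.
  have [|I1 I2] := compact_derivative_integral (C1_mul Cv Cphi).
    by move=> x /phi0; apply: filterS => y ->; rewrite mulr0.
  have im (f1 f2 : R * R -> R) : continuous f1 -> continuous f2 -> leb2.-integrable (B : set P) (EFin \o (fun x => f1 x * f2 x)).
    move=> cf1 cf2; apply: (@continuous_integrable_disk (fun x => f1 x * f2 x)) => x.
    by apply: cvgM; [exact: cf1|exact: cf2].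
  split; apply/eqP; rewrite -addr_eq0 -RintegralD//; try exact: im; apply/eqP.
  - by rewrite -[RHS]I1; apply: eq_Rintegral => x _; rewrite [v1 x * _]mulrC.
  - by rewrite -[RHS]I2; apply: eq_Rintegral => x _; rewrite [v2 x * _]mulrC.
move=> i; split.
  have [e|ni] := eqVneq i 0.
    rewrite e (_ : (fun x => _) = v1); first exact: continuous_Lp2_on.
    by apply/funext => x; rewrite mxE eqxx.
  rewrite (_ : (fun x => _) = v2); first exact: continuous_Lp2_on.
  by apply/funext => x; rewrite mxE (negbTE ni).
move=> phi /prod[I1 I2].
have [e|ni] := eqVneq i 0.
  by rewrite e I1; congr (- _); apply: eq_Rintegral => x _; rewrite mxE eqxx.
have -> : i = 1 by case: i ni => -[|[|i]] //= h _; apply: val_inj.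
by rewrite I2; congr (- _); apply: eq_Rintegral => x _; rewrite mxE.
Qed.

End BoundedLp.

(** * Optimality of the exponent *)

Section Saddle.
Context {R : realType}.
Local Notation mR := (measurableTypeR R).
Local Notation P := (mR * mR)%type.
Variables (x0 : R * R) (r : R).
Hypothesis r0 : 0 < r.
Let B := disk x0 r.
Variable L : R.
Hypothesis L1 : 1 <= L.
Let L0 : 0 < L. Proof. exact: lt_le_trans L1. Qed.

(** With respect to [aniso] the two second derivatives, [-2 L] and [2],
    contribute [-2 L] and [2 L] to the divergence. *)
Definition saddle (x : R * R) : R := r ^+ 2 + (x.2 - x0.2) ^+ 2 - L * (x.1 - x0.1) ^+ 2.
Definition saddle1 (x : R * R) : R := - (2 * L * (x.1 - x0.1)).
Definition saddle2 (x : R * R) : R := 2 * (x.2 - x0.2).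
Definition aniso : 'M[R]_2 := \matrix_(i, j) (if i == j then if i == 0 then 1 else L else 0).

Lemma saddle_C1 : C1 saddle saddle1 saddle2.
Proof.
have c1 : continuous (fst : R * R -> R) by exact: (C1_continuous C1_fst).
have c2 : continuous (snd : R * R -> R) by exact: (C1_continuous C1_snd).
apply: (@C1_quadratic R _ _ _ (1 + L)).
- move=> x; apply: cvgN; apply: cvgM; first exact: cvg_cst.
  by apply: cvgB; [exact: c1|exact: cvg_cst].
- move=> x; apply: cvgM; first exact: cvg_cst.
  by apply: cvgB; [exact: c2|exact: cvg_cst].
- move=> x h; rewrite /saddle /saddle1 /saddle2 /=.
  rewrite (_ : _ - _ - _ = h.2 ^+ 2 - L * h.1 ^+ 2); last by ring.
  have n1 : h.1 ^+ 2 <= `|h| ^+ 2 by rewrite -[h.1 ^+ 2]real_normK ?num_real// ler_sqr ?nnegrE// norm_fst.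
  have n2 : h.2 ^+ 2 <= `|h| ^+ 2 by rewrite -[h.2 ^+ 2]real_normK ?num_real// ler_sqr ?nnegrE// norm_snd.
  have n3 : L * h.1 ^+ 2 <= L * `|h| ^+ 2 by apply: ler_wpM2l => //; exact: ltW.
  have n4 : 0 <= L * h.1 ^+ 2 by apply: mulr_ge0; [exact: ltW|exact: sqr_ge0].
  by have := sqr_ge0 h.2; rewrite ler_norml => ?; apply/andP; split; lra.
Qed.

Lemma saddle_elliptic : bounded_elliptic B 1 L (fun=> aniso).
Proof.
have aT : aniso^T = aniso.
  by apply/matrixP => i j; rewrite !mxE eq_sym; case: eqVneq => // ->.
split.
- by move=> i j; exact: cst_Lpoo_on.
- by apply: aeW.
- apply: aeW => x _ z; rewrite dot_bil// dotE /bil !mxE /= mul1r.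
  have h1 := sqr_ge0 (z 0 0); have h2 := sqr_ge0 (z 1 0); have L1' := L1.
  by apply/andP; split; nra.
Qed.

Definition saddle_grad (x : R * R) : 'cV[R]_2 := \col_i (if i == 0 then saddle1 x else saddle2 x).

Lemma saddle_W12 : W12 B saddle.
Proof.
split; first exact: (continuous_Lp2_on x0 r0 (C1_continuous saddle_C1)).
by exists saddle_grad; exact: (C1_weak_gradient x0 r0 saddle_C1).
Qed.

(** [a grad v . grad phi] is the divergence of [phi a grad v], since [a grad v]
    is divergence free. *)
Lemma saddle_subsolution : subsolution B (fun=> aniso) saddle.
Proof.
have c1 : continuous (fst : R * R -> R) by exact: (C1_continuous C1_fst).
have c2 : continuous (snd : R * R -> R) by exact: (C1_continuous C1_snd).
have cc (c : R) : continuous (fun _ : R => c) by exact: cst_continuous.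
have dl (c a t : R) : is_derive t (1 : R) (fun t => c * (t - a)) c.
  by apply: is_derive_eq; rewrite /GRing.scale /=; ring.
exists saddle_grad; first exact: (C1_weak_gradient x0 r0 saddle_C1).
move=> phi phiB _.
have [Cphi phi0] := C1c_C1 phiB; have [d1 d2 _] := Cphi.
have Cw1 := C1_comp C1_fst (dl (- (2 * L)) x0.1) (cc _).
have Cw2 := C1_comp C1_snd (dl (2 * L) x0.2) (cc _).
have near0 (w : R * R -> R) x : ~ disk x0 r x -> \forall y \near x, w y * phi y = 0.
  by move=> /phi0; apply: filterS => y ->; rewrite mulr0.
have [I1 _] := compact_derivative_integral r0 (C1_mul Cw1 Cphi) (near0 _).
have [_ I2] := compact_derivative_integral r0 (C1_mul Cw2 Cphi) (near0 _).
have C12 := C1_mul Cw1 Cphi; have C22 := C1_mul Cw2 Cphi.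
have [e1 _ _] := C12; have [_ e2 _] := C22.
rewrite le_eqVlt; apply/orP; left; apply/eqP.
transitivity (0 + 0 : R); last by rewrite addr0.
rewrite -{1}I1 -I2 -RintegralD//.
- apply: eq_Rintegral => x _; rewrite dot_bil.
    by rewrite /bil !mxE /= /saddle1 /saddle2; ring.
  by apply/matrixP => i j; rewrite !mxE eq_sym; case: eqVneq => // ->.
- exact: measurable_disk.
- exact: (continuous_integrable_disk x0 r0 e1).
- exact: (continuous_integrable_disk x0 r0 e2).
Qed.

(** On the rectangle with half-sides [r / (4 L)] and [r / 4] around the centre
    the saddle exceeds [r^2 / 2]. *)
Lemma saddle_ess_sup (T : R) : (ess_sup_on (disk x0 (r / 2)) saddle <= T%:E)%E -> r ^+ 2 / 2 <= T.
Proof.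
move=> /ess_supP ae; rewrite leNgt; apply/negP => Tr.
have r2 : 0 < r ^+ 2 by rewrite exprn_gt0.
pose e := r / (4 * L); have e0 : 0 < e by rewrite divr_gt0// mulr_gt0.
have eL : L * e ^+ 2 <= r ^+ 2 / 16.
  rewrite (_ : L * e ^+ 2 = r ^+ 2 / 16 / L); last by rewrite /e; field; rewrite gt_eqF.
  by rewrite ler_pdivrMr// ler_peMr// divr_ge0// ltW.
have e3 : e ^+ 2 <= r ^+ 2 / 16 by apply: le_trans eL; rewrite ler_peMl// sqr_ge0.
pose Q : set P := rect (x0.1 - e) (x0.1 + e) (x0.2 - r / 4) (x0.2 + r / 4).
have mQ : measurable Q by exact: measurable_rect.
have [N [mN N0 sN]] := ae.
have QN : Q `<=` N.
  move=> x /rectP[q1 q2 q3 q4]; apply: sN => /=.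
  have s1 : (x.1 - x0.1) ^+ 2 <= e ^+ 2.
    rewrite -[_ ^+ 2]real_normK ?num_real// ler_sqr ?nnegrE ?normr_ge0 ?(ltW e0)//.
    by rewrite ler_norml; apply/andP; split; lra.
  have s2 : (x.2 - x0.2) ^+ 2 <= (r / 4) ^+ 2.
    have := r0 => r0'; rewrite -[_ ^+ 2]real_normK ?num_real// ler_sqr ?nnegrE ?normr_ge0 ?divr_ge0 ?(ltW r0)//.
    by rewrite ler_norml; apply/andP; split; lra.
  have xd : disk x0 (r / 2) x by rewrite /disk /=; rewrite expr_div_n in s2; rewrite expr_div_n; lra.
  rewrite /patch mem_set//= lee_fin => xT.
  have s3 : L * (x.1 - x0.1) ^+ 2 <= r ^+ 2 / 16.
    by apply: le_trans eL; apply: ler_wpM2l => //; exact: ltW.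
  have := sqr_ge0 (x.2 - x0.2); rewrite /saddle in xT; lra.
have : (leb2 Q <= 0)%E by rewrite -N0; apply: le_measure => //; rewrite inE.
apply/negP; rewrite -ltNge /Q; have := r0 => r0'.
by rewrite leb2_rect; [rewrite lte_fin mulr_gt0//; lra|lra|lra].
Qed.

(** On the disc the saddle is at most [2 r^2], and it is negative where [|x.1 -
    x0.1|] exceeds [2 r / sqrt L]. *)
Lemma saddle_average : \int[leb2]_(x in B) (Num.max (saddle x) 0 ^+ 2) <= 32 * r ^+ 6 / Num.sqrt L.
Proof.
have r2 : 0 < r ^+ 2 by rewrite exprn_gt0.
pose sL := Num.sqrt L; have sL0 : 0 < sL by rewrite sqrtr_gt0.
have sLE : sL ^+ 2 = L by rewrite sqr_sqrtr// ltW.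
pose w := 2 * r / sL; have w0 : 0 < w by rewrite divr_gt0// mulr_gt0.
pose Q : set P := rect (x0.1 - w) (x0.1 + w) (x0.2 - r) (x0.2 + r).
have mQ : measurable Q by exact: measurable_rect.
have mB : measurable (B : set P) by exact: measurable_disk.
have Lw : L * w ^+ 2 = 4 * r ^+ 2 by rewrite -sLE /w; field; rewrite gt_eqF.
have ms : measurable_fun [set: P] (fun x : P => (Num.max (saddle x) 0 ^+ 2)%:E).
  apply/measurable_EFinP; apply: measurable_funX.
  apply: (continuous_measurable2 (f := pos \o saddle)) => x.
  by apply: continuous_comp; [exact: (C1_continuous saddle_C1)|exact: pos_continuous].
have key (x : P) : B x -> Num.max (saddle x) 0 ^+ 2 <= (if x \in Q then 4 * r ^+ 4 else 0).
  move=> xB; have := sub_disk_rect r0 xB => /rectP[b1 b2 b3 b4].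
  have xB' : (x.1 - x0.1) ^+ 2 + (x.2 - x0.2) ^+ 2 < r ^+ 2 by [].
  have h1 := sqr_ge0 (x.1 - x0.1); have h2 := sqr_ge0 (x.2 - x0.2).
  have h3 : 0 <= L * (x.1 - x0.1) ^+ 2 by apply: mulr_ge0 => //; exact: ltW.
  rewrite -[Num.max _ _]/(pos (saddle x)).
  have le2 : pos (saddle x) <= 2 * r ^+ 2.
    by case: (posP (saddle x)) => -[_ ->]; rewrite /saddle; lra.
  case: ifPn => xQ.
    rewrite (_ : 4 * r ^+ 4 = (2 * r ^+ 2) ^+ 2); last by ring.
    by rewrite ler_sqr ?nnegrE ?pos_ge0// mulr_ge0// ltW.
  have : ~ Q x by move: xQ; rewrite notin_setE.
  move=> nQ; have wx : w < `|x.1 - x0.1|.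
    rewrite ltNge; apply/negP; rewrite ler_norml => /andP[? ?]; apply: nQ; apply/rectP; split => //; lra.
  have wx2 : w ^+ 2 < (x.1 - x0.1) ^+ 2.
    by rewrite -[(x.1 - x0.1) ^+ 2]real_normK ?num_real// ltr_sqr ?nnegrE// ltW.
  have h4 : L * w ^+ 2 <= L * (x.1 - x0.1) ^+ 2 by apply: ler_wpM2l; exact: ltW.
  case: (posP (saddle x)) => -[s ->]; first by rewrite expr0n.
  by exfalso; move: s; rewrite /saddle; lra.
have le1 : (\int[leb2]_(x in (B : set P)) (Num.max (saddle x) 0 ^+ 2)%:E <= (32 * r ^+ 6 / sL)%:E)%E.
  apply: (@le_trans _ _ (\int[leb2]_(x in (B : set P)) ((fun=> (4 * r ^+ 4)%:E) \_ Q) x)%E).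
    apply: ge0_le_integral => //.
    - by move=> x _; rewrite lee_fin sqr_ge0.
    - exact: measurable_funTS.
    - by apply: measurable_funTS; apply/(measurable_restrictT _ _).1; [exact: mQ|exact: measurable_cst].
    - by move=> x xB; rewrite patchE; have := key x xB; case: ifPn => _; rewrite lee_fin.
  have p4 : 0 <= 4 * r ^+ 4 by rewrite mulr_ge0// exprn_ge0// ltW.
  apply: (@le_trans _ _ (\int[leb2]_x ((fun=> (4 * r ^+ 4)%:E) \_ Q) x)%E).
    apply: ge0_subset_integral => //.
    - by apply/(measurable_restrictT _ _).1; [exact: mQ|exact: measurable_cst].
    - by move=> x _; rewrite patchE; case: ifP => _; rewrite lee_fin.
  rewrite -integral_mkcond integral_cst// /Q leb2_rect; [|lra|have := r0; lra].
  rewrite -EFinM lee_fin le_eqVlt; apply/orP; left; apply/eqP.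
  by rewrite /w; field; rewrite gt_eqF.
rewrite /Rintegral -lee_fin fineK//.
rewrite ge0_fin_numE; first exact: le_lt_trans le1 (ltry _).
by apply: integral_ge0 => x _; rewrite lee_fin sqr_ge0.
Qed.

End Saddle.

Section Optimality.
Context {R : realType}.

(** The saddle turns an estimate with exponent [theta] into [L^(1/4 - theta) <=
    D] for a constant [D] and all [L >= 1]; the choice [L^(1/4 - theta) = D + 1]
    refutes it. *)
Lemma exponent_optimal (x0 : R * R) (r theta : R) : 0 < r -> theta < 4^-1 ->
  ~ exists c : R, sup_estimate x0 r c theta.
Proof.
move=> r0 th [c est].
have Bfin := leb2_disk_fin x0 r0; have Bpos := leb2_disk_gt0 x0 r0.
pose b := fine (leb2 (disk x0 r)).
have b0 : 0 < b by rewrite fine_gt0// Bpos.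
have r2 : 0 < r ^+ 2 by rewrite exprn_gt0.
pose D := `|c| * Num.sqrt (b^-1 * (32 * r ^+ 6)) / (r ^+ 2 / 2).
have hr : 0 < r ^+ 2 / 2 by rewrite divr_gt0.
pose S := Num.sqrt (b^-1 * (32 * r ^+ 6)).
have S0 : 0 <= S by exact: sqrtr_ge0.
have D0 : 0 <= D by apply: divr_ge0; [exact: mulr_ge0|exact: ltW].
pose del := 4^-1 - theta; have del0 : 0 < del by rewrite subr_gt0.
pose L := (D + 1) `^ del^-1.
have D1 : 1 <= D + 1 by rewrite lerDr.
have L1 : 1 <= L.
  have -> : 1 = 1 `^ del^-1 :> R by rewrite powR1.
  by rewrite /L ge0_ler_powR ?nnegrE ?invr_ge0 ?(ltW del0)// (le_trans _ D1).
have L0 : 0 < L by apply: lt_le_trans L1.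
have Ldel : L `^ del = D + 1.
  by rewrite /L -powRrM mulVf ?gt_eqF// powRr1// (le_trans _ D1).
have := est 1 L (fun=> aniso L) (saddle x0 r L) ltr01 L1 (saddle_elliptic x0 r L1)
  (saddle_W12 x0 r0 L1) (saddle_subsolution x0 r0 L1).
move=> /(saddle_ess_sup r0 L1); rewrite divr1.
set A := average _ _.
have sL0 : 0 < Num.sqrt L by rewrite sqrtr_gt0.
have A_le : A <= b^-1 * (32 * r ^+ 6) / Num.sqrt L.
  by rewrite -mulrA; apply: ler_wpM2l; [rewrite invr_ge0 ltW|exact: saddle_average].
have LE : Num.sqrt (Num.sqrt L) = L `^ 4^-1.
  by rewrite (_ : 4^-1 = 2^-1 * 2^-1 :> R); [rewrite powRrM !powR12_sqrt// ?powR_ge0// ltW|field].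
have sA : Num.sqrt A <= Num.sqrt (b^-1 * (32 * r ^+ 6)) / L `^ 4^-1.
  rewrite -LE ler_pdivlMr ?sqrtr_gt0// -sqrtrM.
    by apply: ler_wsqrtr; rewrite -ler_pdivlMr.
  rewrite mulr_ge0 ?invr_ge0 ?(ltW b0)//; apply: Rintegral_ge0 => x _; exact: sqr_ge0.
have Lth : L `^ theta = L `^ 4^-1 / (D + 1).
  by rewrite -Ldel -powRN -powRD; [congr (_ `^ _); rewrite /del; ring|rewrite (gt_eqF L0) implybT].
have Lq : 0 < L `^ 4^-1 by rewrite powR_gt0.
apply/negP; rewrite -ltNge.
have Lth0 : 0 < L `^ theta by rewrite powR_gt0.
apply: (@le_lt_trans _ _ (`|c| * L `^ theta * (S / L `^ 4^-1))).
  apply: (@le_trans _ _ (`|c| * L `^ theta * Num.sqrt A)).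
    apply: ler_wpM2r; first exact: sqrtr_ge0.
    by apply: ler_wpM2r; [exact: ltW|exact: ler_norm].
  by apply: ler_wpM2l => //; apply: mulr_ge0 => //; exact: ltW.
have D10 : 0 < D + 1 by apply: lt_le_trans D1.
rewrite Lth (_ : _ * _ = `|c| * S / (D + 1)); last by field; rewrite !gt_eqF.
rewrite ltr_pdivrMr// (_ : `|c| * S = r ^+ 2 / 2 * D); last first.
  by rewrite /D -/S [RHS]mulrC divfK// gt_eqF.
by rewrite ltr_pM2l// ltrDl.
Qed.

End Optimality.

Theorem proposition1 (R : realType) (x0 : R * R) (r : R) (hr : 0 < r) :
  (exists c : R, sup_estimate x0 r c (4^-1)) /\
  (forall theta : R, theta < 4^-1 ->
     ~ exists c : R, sup_estimate x0 r c theta).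
Proof.
split; first exact: sup_estimate_quarter.
by move=> theta; exact: exponent_optimal.
Qed.
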